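(* Let $Q$ be a convex polygon with $n$ vertices and $r>\varepsilon>0$ such that $\mathrm{offset}(\Pi,r)$ is $\varepsilon$-close to $Q$, where $\Pi:=\mathrm{inset}(\mathrm{offset}(Q,\varepsilon),r)$. For an arbitrary initial vertex $s\in\partial\Pi$, computing the polygonal region $P^s$ requires $O(n)$ time (in the real-RAM model).
   Context: $D_s(c)$ is the closed disk of radius $s$ around $c$, $\mathrm{offset}(X,s):=X\oplus D_s(0)$, $\mathrm{inset}(X,s):=\{x\mid D_s(x)\subseteq X\}$. Closed sets are $\varepsilon$-close if their symmetric Hausdorff distance is at most $\varepsilon$. For convex $Q$ and $r>\varepsilon$, $\Pi$ is a convex polygon. Let $q_1,\ldots,q_n$ be the vertices of $Q$ in counterclockwise order, $K_i:=D_{r+\varepsilon}(q_i)$, and let the eyelets be $\kappa_i:=K_i\cap\Pi$. For $u,u'\in\partial\Pi$, $[u,u']\subset\partial\Pi$ is the set of points met when travelling along $\partial\Pi$ from $u$ to $u'$ counterclockwise; $(u,u')$, $(u,u']$, $[u,u')$ are the corresponding (half-)open versions. The portion of $\kappa_i\cap\partial\Pi$ visible from $q_i$ (with $\Pi$ as an obstacle) is an interval $[v_i,w_i]$; $v_i$ is called the spot of $\kappa_i$. For $u,u'\in\partial\Pi$, the segment $\overline{uu'}$ is good if for all spots $v_i\in(u,u')$, $\overline{uu'}$ intersects the eyelet $\kappa_i$. The horizon $h_u\in\partial\Pi$ of $u\in\partial\Pi$ is the maximal point in counterclockwise direction such that $\overline{u h_u}$ is good. For $s\in\partial\Pi$,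 the polygonal region $P^s$ is given by its vertices, defined iteratively: $p_1:=s$; for $j\ge1$, if the segment $\overline{p_j s}$ (which would close $P^s$) is good, stop; otherwise set $p_{j+1}:=h_{p_j}$. *)

(* Defs.v *)
From HB Require Import structures.
From mathcomp Require Import all_boot all_order all_algebra.
From mathcomp Require Import all_classical all_reals all_analysis.
Set Implicit Arguments.
Unset Strict Implicit.
Unset Printing Implicit Defensive.
Import Order.TTheory GRing.Theory Num.Theory.
Import numFieldNormedType.Exports.
Local Open Scope classical_set_scope.
Local Open Scope ring_scope.

(** * Plane geometry *)

(* The topology of the plane is the product topology; its library norm is the
   max-norm, so Euclidean distance is defined separately. *)
Definition pt (R : realType) : Type := (R * R)%type.

Definition edist (R : realType) (x y : pt R) : R :=
  Num.sqrt ((x.1 - y.1) ^+ 2 + (x.2 - y.2) ^+ 2).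

Definition disk (R : realType) (s : R) (c : pt R) : set (pt R) :=
  [set x | edist x c <= s].

Definition offset (R : realType) (X : set (pt R)) (s : R) : set (pt R) :=
  [set x | exists a b : pt R,
     [/\ X a, disk s (0, 0) b & x = (a.1 + b.1, a.2 + b.2)]].

Definition inset (R : realType) (X : set (pt R)) (s : R) : set (pt R) :=
  [set x | disk s x `<=` X].

Definition boundary (R : realType) (X : set (R * R)) : set (R * R) :=
  closure X `\` interior X.

(* [ereal_inf set0 = +oo], so the distance between an empty and a nonempty set
   is infinite. *)
Definition hausdorff (R : realType) (X Y : set (pt R)) : \bar R :=
  let dev A B := ereal_sup
    [set ereal_inf [set (edist a b)%:E | b in B] | a in A] in
  maxe (dev X Y) (dev Y X).

Definition eps_close (R : realType) (eps : R) (X Y : set (pt R)) : Prop :=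
  (hausdorff X Y <= eps%:E)%E.

(* Point dividing [a b] in the ratio [l : 1 - l]. *)
Definition lerp (R : realType) (l : R) (a b : pt R) : pt R :=
  ((1 - l) * a.1 + l * b.1, (1 - l) * a.2 + l * b.2).

Definition segment (R : realType) (a b : pt R) : set (pt R) :=
  [set x | exists l : R, 0 <= l <= 1 /\ x = lerp l a b].

Definition hull (R : realType) (V : seq (pt R)) : set (pt R) :=
  [set x | exists w : 'I_(size V) -> R,
     [/\ forall i, 0 <= w i, \sum_i w i = 1 &
         x = (\sum_i w i * (nth (0, 0) V i).1,
              \sum_i w i * (nth (0, 0) V i).2)]].

(* Twice the signed area of the triangle [a b c]. *)
Definition orient (R : realType) (a b c : pt R) : R :=
  (b.1 - a.1) * (c.2 - a.2) - (b.2 - a.2) * (c.1 - a.1).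

(* [V] lists the vertices, in counterclockwise order, of the nondegenerate
   convex polygon [hull V]; no vertex lies between its neighbours. *)
Definition ccw_polygon (R : realType) (V : seq (pt R)) : Prop :=
  (2 < size V)%N /\
  forall i j k : nat, (i < j)%N -> (j < k)%N -> (k < size V)%N ->
    0 < orient (nth (0, 0) V i) (nth (0, 0) V j) (nth (0, 0) V k).

(** * Travelling along the boundary

    From here on [V] is the counterclockwise vertex list of the polygon Pi,
    so Pi is [hull V]. *)

(* Counterclockwise parametrization of the boundary, defined for [0 <= t] and
   of period [size V]: the integer [k] is mapped to the vertex [k mod size V],
   and [t] in [k, k+1] to the corresponding point of the next edge. *)
Definition walk (R : realType) (V : seq (pt R)) (t : R) : pt R :=
  let k := Num.truncn t in
  lerp (t - k%:R) (nth (0, 0) V (k %% size V)) (nth (0, 0) V (k.+1 %% size V)).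

(* [[u, u']], with [[u, u] = [set u]]. *)
Definition closed_arc (R : realType) (V : seq (pt R)) (u u' : pt R) :
    set (pt R) :=
  [set x | exists a b t : R,
     [/\ 0 <= a < (size V)%:R, a <= b < a + (size V)%:R,
         walk V a = u, walk V b = u' & a <= t <= b /\ x = walk V t]].

(* [(u, u')]; the journey from [u] to [u] is a full turn, so [(u, u)] is the
   whole boundary except [u]. *)
Definition open_arc (R : realType) (V : seq (pt R)) (u u' : pt R) :
    set (pt R) :=
  [set x | exists a b t : R,
     [/\ 0 <= a < (size V)%:R, a < b <= a + (size V)%:R,
         walk V a = u, walk V b = u' & a < t < b /\ x = walk V t]].

(** * Eyelets, spots, horizons and the region P^s

    [q] is the vertex list of Q and [rho] the radius of the disks K_i. *)

Definition eyelet (R : realType) (q V : seq (pt R)) (rho : R) (i : nat) :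
    set (pt R) :=
  disk rho (nth (0, 0) q i) `&` hull V.

Definition visible_portion (R : realType) (q V : seq (pt R)) (rho : R)
    (i : nat) : set (pt R) :=
  [set x | [/\ eyelet q V rho i x, boundary (hull V) x &
               segment (nth (0, 0) q i) x `&` hull V = [set x]]].

Definition is_spot (R : realType) (q V : seq (pt R)) (rho : R) (i : nat)
    (v : pt R) : Prop :=
  exists w, [/\ boundary (hull V) v, boundary (hull V) w &
                visible_portion q V rho i = closed_arc V v w].

Definition good (R : realType) (q V : seq (pt R)) (rho : R) (u u' : pt R) :
    Prop :=
  forall (i : nat) (v : pt R), (i < size q)%N -> is_spot q V rho i v ->
    open_arc V u u' v -> segment u u' `&` eyelet q V rho i !=set0.

(* Every good endpoint [u'] is met, when starting from [u], no later than
   [h], i.e. lies in [(u, h]]. *)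
Definition is_horizon (R : realType) (q V : seq (pt R)) (rho : R)
    (u h : pt R) : Prop :=
  [/\ boundary (hull V) h, good q V rho u h &
      forall u', boundary (hull V) u' -> good q V rho u u' ->
        open_arc V u h u' \/ u' = h].

(* [P] lists the vertices p_1, p_2, ... of P^s. *)
Definition is_region (R : realType) (q V : seq (pt R)) (rho : R) (s : pt R)
    (P : seq (pt R)) : Prop :=
  [/\ (0 < size P)%N, nth (0, 0) P 0 = s,
      forall j : nat, (j.+1 < size P)%N ->
        ~ good q V rho (nth (0, 0) P j) s /\
        is_horizon q V rho (nth (0, 0) P j) (nth (0, 0) P j.+1) &
      good q V rho (last (0, 0) P) s].

(** * Real RAM

    A unit-cost random access machine with two sorts of data: real numbers,
    with exact arithmetic, square roots and comparisons, and natural numbers,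
    which serve as indices. Registers are addressed by constants; the memory
    consists of arrays, also named by constants, whose cells are addressed by
    index registers. As a program names only finitely many registers and
    arrays, interleaving them in one linear memory costs a constant factor.
    There is no multiplication of indices and no rounding of reals. *)

Inductive arith := Add | Sub | Mul | Div.

Inductive instr :=
| RConst (d c : nat)
| ROp (o : arith) (d a b : nat)
| RSqrt (d a : nat)
| RLoad (d A i : nat)
| RStore (A i a : nat)
| NConst (d c : nat)
| NAdd (d a b : nat)
| NSub (d a b : nat)
| NLoad (d A i : nat)
| NStore (A i a : nat)
| RJumpLt (a b l : nat)
| NJumpLt (a b l : nat)
| Jump (l : nat).

Record state (R : realType) := State {
  pc : nat;
  rreg : nat -> R;
  nreg : nat -> nat;
  rmem : nat -> nat -> R;
  nmem : nat -> nat -> nat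
}.

Definition upd (T : Type) (f : nat -> T) (k : nat) (v : T) : nat -> T :=
  fun j => if j == k then v else f j.

Definition eval_arith (R : realType) (o : arith) (x y : R) : R :=
  match o with
  | Add => x + y
  | Sub => x - y
  | Mul => x * y
  | Div => x / y
  end.

(* Division by zero and square roots of negative reals give 0, and [NSub] is
   truncated; a program can detect these cases by comparisons. *)
Definition exec (R : realType) (c : instr) (st : state R) : state R :=
  let: State p x n X N := st in
  match c with
  | RConst d k => State p.+1 (upd x d k%:R) n X N
  | ROp o d a b => State p.+1 (upd x d (eval_arith o (x a) (x b))) n X N
  | RSqrt d a => State p.+1 (upd x d (Num.sqrt (x a))) n X N
  | RLoad d A i => State p.+1 (upd x d (X A (n i))) n X N
  | RStore A i a =>
      State p.+1 x n (upd X A (upd (X A) (n i) (x a))) N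
  | NConst d k => State p.+1 x (upd n d k) X N
  | NAdd d a b => State p.+1 x (upd n d (n a + n b)%N) X N
  | NSub d a b => State p.+1 x (upd n d (n a - n b)%N) X N
  | NLoad d A i => State p.+1 x (upd n d (N A (n i))) X N
  | NStore A i a =>
      State p.+1 x n X (upd N A (upd (N A) (n i) (n a)))
  | RJumpLt a b l => State (if x a < x b then l else p.+1) x n X N
  | NJumpLt a b l => State (if (n a < n b)%N then l else p.+1) x n X N
  | Jump l => State l x n X N
  end.

(* The machine halts when its program counter leaves the program. *)
Definition halted (R : realType) (prog : seq instr) (st : state R) : Prop :=
  (size prog <= pc st)%N.

Definition step (R : realType) (prog : seq instr) (st : state R) : state R :=
  if onth prog (pc st) is Some c then exec c st else st.

(* Input: real registers 0, 1, 2, 3 hold [r], [eps] and the coordinates of [s];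
   index register 0 holds the number of vertices of Q, whose first and second
   coordinates are in the real arrays 0 and 1. Everything else is 0. *)
Definition init_state (R : realType) (q : seq (pt R)) (r eps : R) (s : pt R) :
    state R :=
  State 0
    (nth 0 [:: r; eps; s.1; s.2])
    (nth 0%N [:: size q])
    (fun A => nth 0 (nth [::] [:: map fst q; map snd q] A))
    (fun _ _ => 0%N).

(* Output: index register 0 holds the number of points, whose first and second
   coordinates are in the real arrays 2 and 3. *)
Definition outputs (R : realType) (st : state R) (P : seq (pt R)) : Prop :=
  nreg st 0 = size P /\
  forall j : nat, (j < size P)%N ->
    (rmem st 2 j, rmem st 3 j) = nth (0, 0) P j.

Definition computes_within (R : realType) (prog : seq instr) (st : state R)
    (P : seq (pt R)) (T : nat) : Prop :=
  exists t : nat,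
    [/\ (t <= T)%N, halted prog (iter t (step prog) st) &
        outputs (iter t (step prog) st) P].

(* Main.v *)
(* Pi is the intersection of the half-planes to the left of the edges of Q, shifted
   inwards by r - eps. The eps-closeness of the offset of Pi to Q puts the point of Pi
   nearest to a vertex q_i into the eyelet of q_i, on the visible arc, and an arc of
   eyelet points leads to it from the spot. Hence goodness does not change when the
   spot is replaced by this nearest point, which is a vertex of Pi. The nearest points
   follow the boundary of Pi in the order of the q_i, so they and s divide it into
   n + 1 straight stretches, possibly of length 0. For convex position a segment from
   u that meets the eyelet of a passed q_i keeps meeting it when its other endpoint
   moves back towards q_i, so the horizon of u is found by searching the stretches for
   the first one on which an eyelet is lost. It ends at the smallest of the last
   parameters at which the individual eyelets are met, and these are roots of quadratic
   equations.

   The program finds an edge of Pi through s, prunes the shifted edges as in Graham's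
   scan, computes the nearest points by merging, and then searches for each horizon
   with a window of doubling width that shrinks until the segment to its end meets all
   eyelets in it. A window costs time proportional to the number of stretches that are
   passed, so the total time is linear. *)

(* The boundary is cyclic, whereas loops and inductions need a linear order. The cut is made at [s]:
   points are lifted to parameters from [a] to [a + N], and shifted lines are numbered from a line
   [b] carrying the edge of Pi that leaves [s]. As line [b] and its copy [b + n] surely carry an
   edge of Pi, the scan never has to revise its start. That the point nearest to q_i is a vertex of
   Pi rests on the common shift [dl] of all lines: this vertex is at least [dl] away from the two
   edge lines through q_i, but at most [dl] away from the parallels through q_i to the edges of Pi
   that meet in it. The obstacle to linear time is that testing one segment against all passed
   eyelets costs time proportional to their number, so that trying the stops one after the other
   would be quadratic. By monotonicity one sweep finds the last admissible stop of a window, and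
   doubling keeps the final width within twice the progress. Which equation yields the last
   parameter of an eyelet is not decided by cases: six candidates are computed, and each is
   tested. *)
Require Import Defs.
From HB Require Import structures.
From mathcomp Require Import all_boot all_order all_algebra.
From mathcomp Require Import all_classical all_reals all_analysis.
From mathcomp Require Import ring lra zify.
Set Implicit Arguments.
Unset Strict Implicit.
Unset Printing Implicit Defensive.
Import Order.TTheory GRing.Theory Num.Theory.
Import numFieldNormedType.Exports.
Local Open Scope classical_set_scope.
Local Open Scope ring_scope.

(** * Convex polygons *)

(* Hypotheses about reals slow [lia] down considerably. *)
Ltac nlia :=
  repeat match goal with
  | H : ?P |- _ => lazymatch P with
    | is_true (leq _ _) => fail
    | is_true (andb (leq _ _) (leq _ _)) => fail
    | is_true (negb (@eq_op _ _ _)) => fail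
    | @eq ?T _ _ => let T' := eval hnf in T in
        lazymatch T' with nat => fail | _ => clear H end
    | _ => clear H
    end
  end; lia.

Section Plane.
Context {R : realType}.
Implicit Types a b c d x y : pt R.

Definition vsub a b : pt R := (a.1 - b.1, a.2 - b.2).
Definition crs a b : R := a.1 * b.2 - a.2 * b.1.
Definition dotp a b : R := a.1 * b.1 + a.2 * b.2.

Lemma crsC a b : crs a b = - crs b a.
Proof. by rewrite /crs; ring. Qed.

Lemma crs_self a : crs a a = 0.
Proof. by rewrite /crs; ring. Qed.

Lemma dotpC a b : dotp a b = dotp b a.
Proof. by rewrite /dotp; ring. Qed.

(** The three-term Plücker relation; it converts signs of cross products into the angular order of
    edges. *)
Lemma crs_plucker a b c d :
  crs a b * crs c d - crs a c * crs b d + crs a d * crs b c = 0.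
Proof. by rewrite /crs; ring. Qed.

Lemma dotp_ge0 a : 0 <= dotp a a.
Proof. by rewrite /dotp -!expr2 addr_ge0 ?sqr_ge0. Qed.

Lemma dotp_eq0 a : (dotp a a == 0) = (a == (0, 0)).
Proof.
case: a => a1 a2; rewrite /dotp /= -!expr2 paddr_eq0 ?sqr_ge0// !sqrf_eq0.
by rewrite xpair_eqE.
Qed.

Lemma vsub_eq0 a b : (vsub a b == (0, 0)) = (a == b).
Proof.
by case: a => ? ?; case: b => ? ?; rewrite /vsub /= !xpair_eqE !subr_eq0.
Qed.

Lemma dotp_gt0 a b : a != b -> 0 < dotp (vsub a b) (vsub a b).
Proof. by move=> ab; rewrite lt_def dotp_ge0 dotp_eq0 vsub_eq0 ab. Qed.

Lemma orient_rot a b c : orient a b c = orient b c a.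
Proof. by rewrite /orient; ring. Qed.

Lemma orient_lerp l a b c d :
  orient a b (lerp l c d) = (1 - l) * orient a b c + l * orient a b d.
Proof. by rewrite /orient /lerp /=; ring. Qed.

Lemma lerp0 a b : lerp 0 a b = a.
Proof. by rewrite /lerp subr0 !mul1r !mul0r !addr0; case: a. Qed.

Lemma lerp1 a b : lerp 1 a b = b.
Proof. by rewrite /lerp subrr !mul1r !mul0r !add0r; case: b. Qed.

Lemma lerp_id l a : lerp l a a = a.
Proof. by case: a => a1 a2; rewrite /lerp /=; congr pair; ring. Qed.

Lemma lerp_lerp m k l a b :
  lerp m (lerp k a b) (lerp l a b) = lerp ((1 - m) * k + m * l) a b.
Proof. by rewrite /lerp /=; congr pair; ring. Qed.

Lemma lerpC l a b : lerp l a b = lerp (1 - l) b a.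
Proof. by rewrite /lerp; congr pair; ring. Qed.

Lemma segmentC a b : segment a b = segment b a.
Proof.
by rewrite eqEsubset; split=> x [l [l01 ->]]; exists (1 - l); rewrite -lerpC;
  split=> //; lra.
Qed.

Lemma segment_l a b : segment a b a.
Proof. by exists 0; rewrite lerp0 lexx ler01. Qed.

Lemma segment_r a b : segment a b b.
Proof. by exists 1; rewrite lerp1 lexx ler01. Qed.

End Plane.

Section Vertices.
Context {R : realType}.
Variable V : seq (pt R).
Notation N := (size V).

(** Indices range over all naturals and wrap around, so that a stretch passing the first vertex is
    still an interval of indices. *)
Definition vx (k : nat) : pt R := nth (0, 0) V (k %% N).
Definition ed (k : nat) : pt R := vsub (vx k.+1) (vx k).
Definition side (k : nat) (x : pt R) : R := orient (vx k) (vx k.+1) x.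

Lemma vx_per m k : vx (m * N + k) = vx k.
Proof. by rewrite /vx modnMDl. Qed.

Lemma vx_addN k : vx (k + N) = vx k.
Proof. by rewrite /vx modnDr. Qed.

Lemma ed_per m k : ed (m * N + k) = ed k.
Proof. by rewrite /ed -addnS !vx_per. Qed.

Lemma ed_addN k : ed (k + N) = ed k.
Proof. by rewrite /ed -addSn !vx_addN. Qed.

Lemma side_per m k x : side (m * N + k) x = side k x.
Proof. by rewrite /side -addnS !vx_per. Qed.

Lemma side_addN k x : side (k + N) x = side k x.
Proof. by rewrite /side -addSn !vx_addN. Qed.

Lemma sideE k x : side k x = crs (ed k) (vsub x (vx k)).
Proof. by []. Qed.

Lemma side_lerp k l x y : side k (lerp l x y) = (1 - l) * side k x + l * side k y.
Proof. exact: orient_lerp. Qed.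

Lemma side_diff k x y : side k x - side k y = crs (ed k) (vsub x y).
Proof. by rewrite /side /orient /crs /vsub /=; ring. Qed.

Hypothesis ccw : ccw_polygon V.

Lemma size_ccw : (2 < N)%N.
Proof. by case: ccw. Qed.

Lemma vx_small k : (k < N)%N -> vx k = nth (0, 0) V k.
Proof. by move=> kN; rewrite /vx modn_small. Qed.

(** Once the multiple of [N] below [i] is removed, wrapping [j] or [k] merely rotates the triple,
    which preserves its orientation. *)
Lemma orient_vx i j k : (i < j)%N -> (j < k)%N -> (k < i + N)%N ->
  0 < orient (vx i) (vx j) (vx k).
Proof.
have N2 := size_ccw; have [_ H] := ccw.
rewrite [in X in X -> _](divn_eq i N) [in X in _ -> _ -> X -> _](divn_eq i N).
move=> ij jk ki; rewrite (divn_eq i N).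
have iN := ltn_pmod i (ltn_trans (isT : 0 < 2)%N N2).
set m := (i %/ N)%N in ij ki *; set i0 := (i %% N)%N in ij ki iN *.
rewrite -(@subnKC (m * N) j) ?vx_per; last by apply: (leq_trans (leq_addr i0 _)); apply: ltnW.
rewrite -(@subnKC (m * N) k) ?vx_per; last by lia.
have {}ij : (i0 < j - m * N)%N by lia.
have {}jk : (j - m * N < k - m * N)%N by lia.
have {}ki : (k - m * N < i0 + N)%N by lia.
move: (j - _)%N (k - _)%N ij jk ki => {}j {}k ij jk ki.
have [kN|Nk] := ltnP k N.
  by rewrite !vx_small ?H//; lia.
rewrite -{1}(subnK Nk) vx_addN.
have [jN|Nj] := ltnP j N.
  by rewrite -orient_rot !vx_small ?H//; lia.
by rewrite -{1}(subnK Nj) vx_addN orient_rot !vx_small ?H//; lia.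
Qed.

Lemma orient_vx_ge0 i j k : (i <= j)%N -> (j <= k)%N -> (k <= i + N)%N ->
  0 <= orient (vx i) (vx j) (vx k).
Proof.
move=> ij jk ki.
have [->|nij] := eqVneq i j; first by rewrite /orient; lra.
have [->|njk] := eqVneq j k; first by rewrite /orient; lra.
have [->|nki] := eqVneq k (i + N)%N; first by rewrite vx_addN /orient; lra.
by apply/ltW/orient_vx; lia.
Qed.

(** The agreement of all successors lets edges and lines, and not only vertices, be moved into the
    window that starts at [i]. *)
Lemma exists_lift i j : exists2 j', (i <= j' < i + N)%N & vx j = vx j' /\
  (forall k, vx (j + k) = vx (j' + k)).
Proof.
have N2 := size_ccw.
have jN := ltn_pmod (i * N + j - i) (ltn_trans (isT : 0 < 2)%N N2).
exists (i + (i * N + j - i) %% N)%N; first by lia.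
have H k : vx (j + k) = vx (i + (i * N + j - i) %% N + k).
  rewrite /vx; congr nth.
  rewrite addnAC modnDmr -[in LHS](modnMDl i).
  by congr modn; nia.
by split=> //; move: (H 0%N); rewrite !addn0.
Qed.

Lemma side_vx_ge0 i j : 0 <= side i (vx j).
Proof.
have [j' ij' [-> _]] := exists_lift i j.
have [->|nij] := eqVneq i j'; first by rewrite /side /orient; lra.
by apply: orient_vx_ge0; lia.
Qed.

Lemma side_vx_gt0 i j : (i.+1 < j < i + N)%N -> 0 < side i (vx j).
Proof. by move=> ij; apply: orient_vx; lia. Qed.

Lemma turn k : 0 < crs (ed k) (ed k.+1).
Proof.
have N2 := size_ccw; have := @orient_vx k k.+1 k.+2 (ltnSn _) (ltnSn _).
rewrite /orient /crs /ed /vsub /= => H; have {H} := H ltac:(lia); lra.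
Qed.

Lemma ed_neq0 k : ed k != (0, 0).
Proof.
by apply/eqP => ek; have := turn k; rewrite ek /crs /= !mul0r subrr ltxx.
Qed.

(* Once the boundary of a convex polygon has turned by more than a half turn
   away from the direction of edge [a], it never turns back before edge [a]. *)
Lemma turned_past a p : (a < p)%N -> (p.+1 < a + N)%N ->
  crs (ed a) (ed p) <= 0 -> crs (ed a) (ed p.+1) < 0.
Proof.
move=> ap pa le0; rewrite ltNge; apply/negP => ge0.
pose w := vsub (vx a) (vx p.+1).
have h1 : 0 < crs (ed p) (ed p.+1) by exact: turn.
have h2 : 0 < crs w (ed a).
  have : 0 < side a (vx p.+1) by apply: side_vx_gt0; lia.
  by rewrite /side /orient /crs /w /ed /vsub /=; lra.
have h3 : 0 < crs (ed p) w.
  have : 0 < side p (vx (a + N)) by apply: side_vx_gt0; lia.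
  by rewrite vx_addN /side /orient /crs /w /ed /vsub /=; lra.
have h4 : 0 <= crs (ed p.+1) w.
  by have := side_vx_ge0 p.+1 a; rewrite /side /orient /crs /w /ed /vsub.
(* With the signs collected above, the relation is a sum of one positive and two nonnegative
   terms. *)
have := crs_plucker (ed p) (ed p.+1) w (ed a).
rewrite (crsC (ed p.+1) (ed a)) (crsC (ed p) (ed a)).
have := mulr_gt0 h1 h2.
have := mulr_ge0 (ltW h3) ge0.
have : 0 <= - crs (ed a) (ed p) * crs (ed p.+1) w by rewrite mulr_ge0 // oppr_ge0.
by lra.
Qed.

(** If edge [p] did not turn left of edge [a], then by [turned_past] no later edge up to [b]
    would. *)
Lemma crs_ed_left a p b : (a < p)%N -> (p <= b)%N -> (b < a + N)%N ->
  0 < crs (ed a) (ed b) -> 0 < crs (ed a) (ed p).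
Proof.
move=> ap pb ba h; rewrite ltNge; apply/negP => le0.
suff : crs (ed a) (ed b) <= 0 by lra.
elim: b pb ba {h} => [|b IH] pb ba; first by lia.
move: pb; rewrite leq_eqVlt => /orP[/eqP <- //|pb].
by apply/ltW/turned_past; [lia|lia|apply: IH; lia].
Qed.

(** The counterpart of [turned_past] in which the target [b] is fixed and the first edge moves
    backwards. *)
Lemma turned_before b p : (p < b)%N -> (b < p + N - 1)%N -> (0 < p)%N ->
  crs (ed p) (ed b) <= 0 -> crs (ed p.-1) (ed b) < 0.
Proof.
move=> pb bp p0 le0; rewrite ltNge; apply/negP => ge0.
have [m pm] : exists m, p = m.+1 by exists p.-1; lia.
subst p; rewrite /= in ge0.
have [e|bm] := eqVneq b.+1 (m + N)%N.
  by have := turn b; rewrite e ed_addN crsC; lra.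
pose w := vsub (vx b.+1) (vx m.+1).
have h1 : 0 < crs (ed m) (ed m.+1) by exact: turn.
have h2 : 0 < crs (ed b) (vsub (vx m.+1) (vx b.+1)).
  have : 0 < side b (vx (m.+1 + N)) by apply: side_vx_gt0; lia.
  by rewrite vx_addN /side /orient /crs /ed /vsub /=; lra.
have h3 : 0 <= crs (ed m.+1) w.
  have := side_vx_ge0 m.+1 b.+1.
  by rewrite /side /orient /crs /w /ed /vsub.
have h4 : 0 < crs (ed m) w.
  have : 0 < side m (vx b.+1) by apply: side_vx_gt0; lia.
  by rewrite /side /orient /crs /w /ed /vsub /=; lra.
have := crs_plucker (ed m) (ed m.+1) w (ed b).
have h2' : 0 < crs w (ed b) by move: h2; rewrite /crs /w /vsub /=; lra.
have := mulr_gt0 h1 h2'.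
have := mulr_ge0 ge0 h3.
have : 0 <= crs (ed m) w * - crs (ed m.+1) (ed b) by rewrite mulr_ge0 ?oppr_ge0 ?(ltW h4).
by lra.
Qed.

Lemma crs_ed_right a p b : (a <= p)%N -> (p < b)%N -> (b < a + N)%N ->
  0 < crs (ed a) (ed b) -> 0 < crs (ed p) (ed b).
Proof.
move=> ap pb ba h; rewrite ltNge; apply/negP => le0.
suff : crs (ed a) (ed b) <= 0 by lra.
have -> : a = (p - (p - a))%N by lia.
have : (p - a <= p - a)%N by [].
elim: {1 3}(p - a)%N => [|m IH] pm; first by rewrite subn0.
rewrite subnS; apply/ltW/turned_before; [lia|lia|lia|].
by apply: IH; lia.
Qed.

Lemma crs_ed_between a p t b : (a <= p)%N -> (p < t)%N -> (t <= b)%N ->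
  (b < a + N)%N -> 0 < crs (ed a) (ed b) -> 0 < crs (ed p) (ed t).
Proof.
move=> ap pt tb ba h.
have h' : 0 < crs (ed a) (ed t) by apply: (crs_ed_left (b := b)) => //; lia.
by apply: crs_ed_right h'; lia.
Qed.

(** Each of two parallel edges lies on the inner side of the other, which is impossible if they have
    the same direction. *)
Lemma ed_parallel i j : (i < j)%N -> (j < i + N)%N ->
  crs (ed i) (ed j) = 0 -> dotp (ed i) (ed j) < 0.
Proof.
move=> ij ji c0; have N2 := size_ccw.
have nj1 : j != i.+1 by apply/eqP => e; have := turn i; rewrite -e c0 ltxx.
have hj : 0 < side i (vx j) by apply: side_vx_gt0; lia.
have hi : 0 <= side j (vx i) by exact: side_vx_ge0.
have i0 : 0 < dotp (ed i) (ed i) by apply: dotp_gt0; rewrite -vsub_eq0 ed_neq0.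
have j0 : 0 < dotp (ed j) (ed j) by apply: dotp_gt0; rewrite -vsub_eq0 ed_neq0.
have E : dotp (ed i) (ed i) * side j (vx i) = - (dotp (ed i) (ed j) * side i (vx j)).
  have : crs (ed i) (ed j) * dotp (ed i) (vsub (vx i) (vx j)) = 0 by rewrite c0 mul0r.
  rewrite !sideE; move: (ed i) (ed j) => [? ?] [? ?].
  by rewrite /crs /dotp /vsub /= => h; lra.
have F : dotp (ed i) (ed j) ^+ 2 = dotp (ed i) (ed i) * dotp (ed j) (ed j).
  have : crs (ed i) (ed j) ^+ 2 = 0 by rewrite c0 expr0n.
  by rewrite /crs /dotp => h; lra.
have le0 : dotp (ed i) (ed j) <= 0.
  have : 0 <= - (dotp (ed i) (ed j) * side i (vx j)) by rewrite -E mulr_ge0 // ltW.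
  by rewrite oppr_ge0 pmulr_lle0.
rewrite lt_neqAle le0 andbT; apply/eqP => e.
by move: F; rewrite e expr0n /= => /esym/eqP; rewrite mulf_eq0 !gt_eqF.
Qed.

End Vertices.

(** * Convex hulls as intersections of half-planes, and their boundaries *)

Section Hull.
Context {R : realType}.
Variable V : seq (pt R).
Notation N := (size V).

Lemma hull_lerp l (x y : pt R) : 0 <= l <= 1 ->
  hull V x -> hull V y -> hull V (lerp l x y).
Proof.
move=> /andP[l0 l1] [w [w0 w1 ->]] [u [u0 u1 ->]].
exists (fun i => (1 - l) * w i + l * u i); split.
- by move=> i; rewrite addr_ge0 ?mulr_ge0 ?subr_ge0.
- by rewrite big_split /= -!mulr_sumr w1 u1; ring.
- rewrite /lerp /= !mulr_sumr -!big_split /=.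
  by congr pair; apply: eq_bigr => i _; ring.
Qed.

Lemma hull_segment (x y z : pt R) :
  hull V x -> hull V y -> segment x y z -> hull V z.
Proof. by move=> hx hy [l [l01 ->]]; apply: hull_lerp. Qed.

Lemma hull_nth i : (i < N)%N -> hull V (nth (0, 0) V i).
Proof.
move=> iN; exists (fun j => (j == Ordinal iN)%:R); split.
- by move=> j; rewrite ler0n.
- by rewrite (bigD1 (Ordinal iN)) //= eqxx big1 ?addr0 // => j /negPf ->.
- have H (f : pt R -> R) : \sum_(j < N) (j == Ordinal iN)%:R * f (nth (0, 0) V j) = f (nth (0, 0) V i).
    rewrite (bigD1 (Ordinal iN)) //= eqxx mul1r big1 ?addr0 // => j /negPf ->.
    by rewrite mul0r.
  by rewrite (H fst) (H snd) -surjective_pairing.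
Qed.

Lemma hull3 (a b c : pt R) (p q r : R) : 0 <= p -> 0 <= q -> 0 <= r ->
  p + q + r = 1 -> hull V a -> hull V b -> hull V c ->
  hull V (p * a.1 + q * b.1 + r * c.1, p * a.2 + q * b.2 + r * c.2).
Proof.
move=> p0 q0 r0 e ha hb hc.
have [qr|qr] := eqVneq (q + r) 0.
  have -> : q = 0 by lra.
  have -> : r = 0 by lra.
  have -> : p = 1 by lra.
  by rewrite !mul1r !mul0r !addr0 -surjective_pairing.
have -> : (p * a.1 + q * b.1 + r * c.1, p * a.2 + q * b.2 + r * c.2) =
          lerp (q + r) a (lerp (r / (q + r)) b c).
  have e' : p = 1 - (q + r) by lra.
  by rewrite /lerp /= e'; congr pair; field.
apply: hull_lerp => //; first by apply/andP; split; lra.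
apply: hull_lerp => //; rewrite divr_ge0 ?addr_ge0//= ler_pdivrMr; first lra.
by rewrite lt_def qr addr_ge0.
Qed.

Lemma orient_sum (a b : pt R) (w : 'I_N -> R) : \sum_i w i = 1 ->
  orient a b (\sum_i w i * (nth (0, 0) V i).1,
              \sum_i w i * (nth (0, 0) V i).2)
  = \sum_i w i * orient a b (nth (0, 0) V i).
Proof.
move=> w1.
have -> : orient a b (\sum_i w i * (nth (0, 0) V i).1,
              \sum_i w i * (nth (0, 0) V i).2) =
   (b.1 - a.1) * (\sum_i w i * (nth (0, 0) V i).2) -
   (b.2 - a.2) * (\sum_i w i * (nth (0, 0) V i).1) -
   ((b.1 - a.1) * a.2 - (b.2 - a.2) * a.1) * (\sum_i w i).
  by rewrite w1 /orient /=; ring.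
rewrite !mulr_sumr -!sumrB; apply: eq_bigr => i _.
by rewrite /orient; ring.
Qed.

Hypothesis ccw : ccw_polygon V.
Let N2 : (2 < N)%N := size_ccw ccw.
Let N0 : (0 < N)%N := ltn_trans (isT : (0 < 2)%N) N2.

Lemma hull_vx k : hull V (vx V k).
Proof. by apply: hull_nth; rewrite ltn_pmod. Qed.

Lemma nth_vx (i : 'I_N) : nth (0, 0) V i = vx V i.
Proof. by rewrite vx_small. Qed.

Lemma side_hull k x : hull V x -> 0 <= side V k x.
Proof.
move=> [w [w0 w1 ->]]; rewrite /side orient_sum //.
by apply: sumr_ge0 => i _; rewrite mulr_ge0 // nth_vx; exact: side_vx_ge0.
Qed.

(** For the converse, a sign change of [f] locates [x] in a triangle of the fan around vertex 0; its
    barycentric coordinates there are quotients of areas. *)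
Lemma hullP x : hull V x <-> forall k, 0 <= side V k x.
Proof.
split=> [hx k|hx]; first exact: side_hull.
pose f i := orient (vx V 0) (vx V i) x.
have f1 : 0 <= f 1%N by exact: hx.
have fN : f N.-1 <= 0.
  have := hx N.-1; rewrite /side prednK //.
  have -> : vx V N = vx V 0 by rewrite -[N]add0n vx_addN.
  by rewrite /f /orient; lra.
have [i [i0 iN] [fi fi1]] : exists2 i, (0 < i)%N /\ (i.+1 < N)%N & 0 <= f i /\ f i.+1 <= 0.
  have : (1 < N.-1)%N by lia.
  have : (N.-1 < N)%N by lia.
  elim: N.-1 fN => [//|m IH] fm mN m1.
  have [fm'|fm'] := lerP 0 (f m); first by exists m => //; lia.
  have [m2|] := ltnP 1 m; first by apply: IH => //; [exact: ltW|lia].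
  move=> m2; have e1 : m = 1%N by lia.
  by move: fm'; rewrite e1 ltNge f1.
have D0 : 0 < orient (vx V 0) (vx V i) (vx V i.+1) by apply: orient_vx => //; lia.
set D := orient _ _ _ in D0.
have h3 : 0 <= side V i x by exact: hx.
have s : side V i x + - f i.+1 + f i = D.
  by rewrite /side /f /D /orient; ring.
have -> : x = (side V i x / D * (vx V 0).1 + - f i.+1 / D * (vx V i).1 +
     f i / D * (vx V i.+1).1, side V i x / D * (vx V 0).2 +
     - f i.+1 / D * (vx V i).2 + f i / D * (vx V i.+1).2).
  have Dn : D != 0 by rewrite gt_eqF.
  rewrite [LHS]surjective_pairing; congr pair; apply: (mulfI Dn);
    rewrite !mulrDr !(mulrCA D) !mulrA !divfK // -?mulrA;
    move: s; rewrite /side /f /D /orient => s; ring.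
apply: hull3; try exact: hull_vx.
- by rewrite divr_ge0 // ltW.
- by rewrite divr_ge0 ?oppr_ge0 // ltW.
- by rewrite divr_ge0 // ltW.
- by rewrite -!mulrDl s divff // gt_eqF.
Qed.

Lemma side_mod k x : side V k x = side V (k %% N) x.
Proof. by rewrite {1}(divn_eq k N) side_per. Qed.

(** The centroid of three vertices will do, since no edge line contains all three. *)
Lemma exists_inner : exists c : pt R, forall k, 0 < side V k c.
Proof.
exists (((vx V 0).1 + (vx V 1).1 + (vx V 2).1) / 3, ((vx V 0).2 + (vx V 1).2 + (vx V 2).2) / 3).
move=> k.
have -> : side V k (((vx V 0).1 + (vx V 1).1 + (vx V 2).1) / 3, ((vx V 0).2 + (vx V 1).2 + (vx V 2).2) / 3) =
  (side V k (vx V 0) + side V k (vx V 1) + side V k (vx V 2)) / 3.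
  by rewrite /side /orient /=; field.
rewrite divr_gt0 //.
have h j : 0 <= side V k (vx V j) by exact: side_vx_ge0.
have h0 := h 0%N; have h1 := h 1%N; have h2 := h 2%N.
rewrite !(side_mod k) in h0 h1 h2 *; move: (ltn_pmod k N0).
set i := (k %% N)%N in h0 h1 h2 * => iN.
suff : [\/ 0 < side V i (vx V 0), 0 < side V i (vx V 1) | 0 < side V i (vx V 2)].
  by case; lra.
have H j : (i.+1 < j + N)%N -> (j < i)%N -> 0 < side V i (vx V j).
  by move=> ? ?; rewrite -vx_addN; apply: side_vx_gt0 => //; lia.
have [i0|i0] := eqVneq i 0%N.
  by apply: Or33; rewrite i0; apply: side_vx_gt0 => //; lia.
have [i1|i1] := eqVneq i 1%N.
  by apply: Or31; apply: H; lia.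
by apply: Or32; apply: H; lia.
Qed.

Lemma vx_on_edge i j : side V i (vx V j) = 0 -> vx V j = vx V i \/ vx V j = vx V i.+1.
Proof.
have [j' ij' [-> _]] := exists_lift ccw i j => s0.
have [->|n1] := eqVneq j' i; first by left.
have [->|n2] := eqVneq j' i.+1; first by right.
have : 0 < side V i (vx V j') by apply: side_vx_gt0 => //; lia.
by rewrite s0 ltxx.
Qed.

(** The nonnegative values of [side V k] at the vertices have weighted mean 0, so all weight sits on
    vertices of the edge line, which are the two ends of the edge. *)
Lemma on_edge k x : hull V x -> side V k x = 0 ->
  segment (vx V k) (vx V k.+1) x.
Proof.
move=> hx sx; have [w [w0 w1 e]] := hx.
have s0 i : w i * side V k (vx V i) = 0.
  move: sx; rewrite e /side orient_sum // => /eqP.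
  rewrite psumr_eq0 => [/allP /(_ i) /=|j _].
    by rewrite mem_index_enum nth_vx => /(_ isT) /eqP.
  by rewrite mulr_ge0 // nth_vx; exact: side_vx_ge0.
pose p := \sum_(i < N | vx V i == vx V k.+1) w i.
have q : \sum_(i < N | vx V i != vx V k.+1) w i = 1 - p.
  have : \sum_(i < N) w i = p + \sum_(i < N | vx V i != vx V k.+1) w i.
    by rewrite (bigID (fun i : 'I_N => vx V i == vx V k.+1)).
  by rewrite w1; lra.
exists p; split.
  have : 0 <= p by apply: sumr_ge0.
  have : 0 <= 1 - p by rewrite -q; apply: sumr_ge0.
  by move=> ? ?; apply/andP; split; lra.
have H (f : pt R -> R) : \sum_i w i * f (nth (0, 0) V i) = (1 - p) * f (vx V k) + p * f (vx V k.+1).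
  rewrite (bigID (fun i : 'I_N => vx V i == vx V k.+1)) /= addrC; congr (_ + _).
    rewrite -q mulr_suml; apply: eq_bigr => i ne; rewrite nth_vx.
    have /eqP := s0 i; rewrite mulf_eq0 => /orP[/eqP ->|/eqP]; first by rewrite !mul0r.
    by move=> /vx_on_edge[->//|e']; rewrite e' eqxx in ne.
  by rewrite /p mulr_suml; apply: eq_bigr => i /eqP; rewrite nth_vx => ->.
by rewrite e /lerp (H fst) (H snd).
Qed.

Lemma side_continuous k : continuous (side V k : R * R -> R).
Proof.
move=> x; rewrite /side /orient.
by apply: cvgB; apply: cvgM; (apply: cvg_cst || apply: cvgB);
  (apply: cvg_cst || exact: cvg_snd || exact: cvg_fst).
Qed.

Lemma boundaryP x :
  boundary (hull V) x <-> hull V x /\ exists2 k, (k < N)%N & side V k x = 0.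
Proof.
rewrite /boundary; split=> [[cx nx]|[hx [k kN sx]]].
  have hx : hull V x.
    apply/hullP => k; rewrite leNgt; apply/negP => lt0.
    have : \forall y \near x, side V k y < 0.
      by apply: (@side_continuous k x _ (lt_nbhsl lt0)).
    by move=> /cx [y [/side_hull h]] /=; rewrite ltNge h.
  split=> //; apply: contrapT => nk; apply: nx.
  have pos : forall k : 'I_N, 0 < side V k x.
    move=> k; rewrite lt_neqAle side_hull // andbT eq_sym; apply/eqP => e.
    by apply: nk; exists k.
  have : nbhs (x : R * R) [set y | forall k : 'I_N, 0 < side V k y].
    apply: (@filter_forall (R * R)%type 'I_N (fun k y => 0 < side V k y)
      (nbhs (x : R * R)) (nbhs_filter _)) => k.
    exact: (@side_continuous k x _ (lt_nbhsr (pos k))).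
  apply: filterS => y hy; apply/hullP => k; rewrite side_mod.
  exact/ltW/(hy (Ordinal (ltn_pmod k N0))).
split; first exact: subset_closure.
rewrite /interior /= => nb.
have [c hc] := exists_inner.
(* Moving from [x] straight away from the inner point [c] leaves the half-plane of edge [k] at
   once. *)
pose f (t : R) : R * R := (x.1 + t * (x.1 - c.1), x.2 + t * (x.2 - c.2)).
have lin (u v : R) : (fun t : R => u + t * v) @ (0 : R) --> u.
  rewrite -[X in _ --> X]addr0 -[X in _ --> _ + X](mul0r v).
  by apply: cvgD; [exact: cvg_cst|apply: cvgM; [exact: cvg_id|exact: cvg_cst]].
have cf : f @ (0 : R) --> (x : R * R).
  by rewrite [X in _ --> X]surjective_pairing; apply: (cvg_pair (lin x.1 _) (lin x.2 _)).
have /nbhs_ballP[e /= e0 he] := cf _ nb.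
have /he /= : ball (0 : R) e (e / 2).
  by rewrite /ball /= sub0r normrN gtr0_norm ?divr_gt0 //; lra.
move=> /(side_hull k).
have -> : side V k (f (e / 2)) = (1 + e / 2) * side V k x - e / 2 * side V k c.
  by rewrite /side /orient /f /=; field.
rewrite sx mulr0 sub0r oppr_ge0 pmulr_rle0 ?divr_gt0 //.
by rewrite leNgt hc.
Qed.

End Hull.

(** * Travelling along the boundary *)

Section Walk.
Context {R : realType}.
Variable V : seq (pt R).
Notation N := (size V).
Notation g := (walk V).

Lemma nat_le_frac (k l : nat) (t u : R) :
  0 <= t -> u < 1 -> k%:R + t <= l%:R + u -> (k <= l)%N.
Proof. by move=> t0 u1 h; rewrite -ltnS -(ltr_nat R) -natr1; lra. Qed.

Lemma walk_lerp (k : nat) (t : R) : 0 <= t <= 1 ->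
  g (k%:R + t) = lerp t (vx V k) (vx V k.+1).
Proof.
move=> /andP[t0]; rewrite le_eqVlt => /orP[/eqP ->|t1].
  rewrite lerp1 natr1 /walk natrK subrr; exact: lerp0.
have e : Num.truncn (k%:R + t) = k.
  by apply/eqP; rewrite truncn_eq ?addr_ge0 // -natr1; apply/andP; split; lra.
by rewrite /walk e addrAC subrr add0r.
Qed.

Lemma walk_nat (k : nat) : g k%:R = vx V k.
Proof. by rewrite -[k%:R]addr0 walk_lerp ?lexx ?ler01 // lerp0. Qed.

Lemma floorP (a : R) : 0 <= a -> exists (k : nat) (t : R),
  [/\ 0 <= t < 1, a = k%:R + t & g a = lerp t (vx V k) (vx V k.+1)].
Proof.
move=> a0; have /andP[h1 h2] := truncn_itv a0.
exists (Num.truncn a), (a - (Num.truncn a)%:R); split=> //.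
- by rewrite -natr1 in h2; apply/andP; split; lra.
- by rewrite addrC subrK.
Qed.

Lemma walk_addN (a : R) : 0 <= a -> g (a + N%:R) = g a.
Proof.
move=> /floorP[k [t [/andP[t0 t1] -> ->]]].
by rewrite addrAC -natrD walk_lerp ?t0 ?ltW // -addSn !vx_addN.
Qed.

Hypothesis ccw : ccw_polygon V.
Let N2 : (2 < N)%N := size_ccw ccw.
Let N0 : (0 < N)%N := ltn_trans (isT : (0 < 2)%N) N2.

Lemma walk_hull (a : R) : 0 <= a -> hull V (g a).
Proof.
move=> /floorP[k [t [/andP[t0 t1] -> ->]]].
by apply: hull_lerp; rewrite ?t0 ?ltW //; exact: hull_vx.
Qed.

Lemma boundary_walk (a : R) : 0 <= a -> boundary (hull V) (g a).
Proof.
move=> a0; apply/boundaryP => //; split; first exact: walk_hull.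
have [k [t [/andP[t0 t1] _ ->]]] := floorP a0.
exists (k %% N)%N; first by rewrite ltn_pmod.
rewrite -side_mod side_lerp /side /orient; ring.
Qed.

Lemma boundary_walkP (x : pt R) :
  boundary (hull V) x -> exists2 a : R, 0 <= a < N%:R & x = g a.
Proof.
move=> /(boundaryP ccw)[hx [k kN sx]].
have [l [/andP[l0 l1] e]] := on_edge ccw hx sx.
move: l1; rewrite le_eqVlt => /orP[/eqP l1|l1].
  have [kN'|] := ltnP k.+1 N.
    by exists k.+1%:R; rewrite ?ler0n ?ltr_nat // walk_nat e l1 lerp1.
  move=> Nk; exists 0; rewrite ?lexx ?ltr0n //.
  have -> : (0 : R) = 0%:R by [].
  rewrite walk_nat e l1 lerp1.
  by have -> : k.+1 = (0 + N)%N; [lia|rewrite vx_addN].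
exists (k%:R + l); last by rewrite walk_lerp ?l0 ?ltW.
rewrite addr_ge0 //=; apply: (@lt_le_trans _ _ k.+1%:R); last by rewrite ler_nat.
by rewrite -natr1; lra.
Qed.

Lemma orient_lerp_same (s t : R) (A B x : pt R) :
  orient (lerp s A B) (lerp t A B) x = (t - s) * orient A B x.
Proof. by rewrite /orient /lerp /=; ring. Qed.

Lemma lerp_orient_ge0 s (A B C D : pt R) : 0 <= s < 1 ->
  0 <= orient A B C -> 0 <= orient A B D -> 0 <= orient A B (lerp s C D).
Proof.
move=> /andP[s0 s1] h1 h2; rewrite orient_lerp addr_ge0 // mulr_ge0 //; lra.
Qed.

Lemma lerp_orient_gt0 s (A B C D : pt R) : 0 <= s < 1 ->
  0 < orient A B C -> 0 <= orient A B D -> 0 < orient A B (lerp s C D).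
Proof.
move=> /andP[s0 s1] h1 h2; rewrite orient_lerp ltr_wpDr //.
  by rewrite mulr_ge0.
by rewrite mulr_gt0 //; lra.
Qed.

(** The orientation is affine in each point, so the vertices can be replaced one at a time; the
    half-open edges keep a positive weight on the strict case. *)
Lemma orient_walk_gt0 (i j k : nat) (s t u : R) :
  0 <= s < 1 -> 0 <= t < 1 -> 0 <= u < 1 ->
  (i < j)%N -> (j < k)%N -> (k < i + N)%N ->
  0 < orient (g (i%:R + s)) (g (j%:R + t)) (g (k%:R + u)).
Proof.
move=> hs ht hu ij jk ki.
have le1 (v : R) : 0 <= v < 1 -> 0 <= v <= 1 by move=> /andP[-> /ltW ->].
rewrite !walk_lerp ?le1 //.
have H i' j' k' : (i <= i' <= i.+1)%N -> (j <= j' <= j.+1)%N -> (k <= k' <= k.+1)%N ->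
    0 <= orient (vx V i') (vx V j') (vx V k').
  by move=> *; apply: orient_vx_ge0 => //; lia.
set P := lerp s _ _; set Q := lerp t _ _.
have hP j' k' : (j <= j' <= j.+1)%N -> (k <= k' <= k.+1)%N ->
    0 <= orient P (vx V j') (vx V k').
  by move=> jj kk; rewrite orient_rot; apply: lerp_orient_ge0 => //;
    rewrite -orient_rot; apply: H; lia.
have hQ k' : (k <= k' <= k.+1)%N -> 0 <= orient P Q (vx V k').
  by move=> kk; rewrite -orient_rot; apply: lerp_orient_ge0 => //;
    rewrite orient_rot; apply: hP; lia.
apply: lerp_orient_gt0 => //; last by apply: hQ; lia.
rewrite -orient_rot; apply: lerp_orient_gt0 => //; rewrite orient_rot; last by apply: hP; lia.
rewrite orient_rot; apply: lerp_orient_gt0 => //; rewrite -orient_rot; last by apply: H; lia.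
by apply: orient_vx => //; lia.
Qed.

Lemma orient_walk_ge0 (a b c : R) : 0 <= a -> a <= b -> b <= c -> c <= a + N%:R ->
  0 <= orient (g a) (g b) (g c).
Proof.
move=> a0 ab bc ca.
have [i [s [hs ea ga]]] := floorP a0.
have [j [t [ht eb gb]]] := floorP (le_trans a0 ab).
have [k [u [hu ec gc]]] := floorP (le_trans (le_trans a0 ab) bc).
have /andP[s0 s1] := hs; have /andP[t0 t1] := ht; have /andP[u0 u1] := hu.
have ij : (i <= j)%N by apply: (nat_le_frac s0 t1); rewrite -ea -eb // ltW.
have jk : (j <= k)%N by apply: (nat_le_frac t0 u1); rewrite -eb -ec.
have ki : (k <= i + N)%N by apply: (nat_le_frac u0 s1); rewrite natrD addrAC -ea -ec.
have [e|nij] := eqVneq i j.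
  subst j; rewrite ga gb orient_lerp_same mulr_ge0 //; first lra.
  by apply: side_hull => //; apply: walk_hull; lra.
have [e|njk] := eqVneq j k.
  subst k; rewrite gb gc orient_rot orient_lerp_same mulr_ge0 //; first lra.
  by apply: side_hull => //; apply: walk_hull; lra.
have [e|nki] := eqVneq k (i + N)%N.
  have e1 : g c = lerp u (vx V i) (vx V i.+1) by rewrite gc e -addSn !vx_addN.
  rewrite -orient_rot ga e1 orient_lerp_same mulr_ge0 //.
    by move: ca; rewrite ec ea e natrD; lra.
  by apply: side_hull => //; apply: walk_hull; lra.
have {}ij : (i < j)%N by rewrite ltn_neqAle nij.
have {}jk : (j < k)%N by rewrite ltn_neqAle njk.
have {}ki : (k < i + N)%N by rewrite ltn_neqAle nki.
by rewrite ea eb ec; apply: ltW; exact: orient_walk_gt0.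
Qed.

Lemma walk_on_edge (i k : nat) (u : R) : 0 <= u < 1 -> (i <= k)%N -> (k < i + N)%N ->
  side V i (g (k%:R + u)) = 0 -> k = i \/ k = i.+1 /\ u = 0.
Proof.
move=> /andP[u0 u1] ik ki; rewrite walk_lerp ?u0 ?ltW // side_lerp => h.
have [|nik] := eqVneq k i; first by left.
right.
have h1 : 0 <= side V i (vx V k) by exact: side_vx_ge0.
have h2 : 0 <= side V i (vx V k.+1) by exact: side_vx_ge0.
have m1 : 0 <= (1 - u) * side V i (vx V k) by rewrite mulr_ge0 //; lra.
have m2 : 0 <= u * side V i (vx V k.+1) by rewrite mulr_ge0.
have /eqP : (1 - u) * side V i (vx V k) = 0 by lra.
rewrite mulf_eq0 => /orP[/eqP|/eqP h0]; first by move=> ?; exfalso; lra.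
have ki1 : k = i.+1.
  apply/eqP; apply: contraT => nk.
  have : 0 < side V i (vx V k) by apply: side_vx_gt0 => //; lia.
  by rewrite h0 ltxx.
split=> //; have /eqP : u * side V i (vx V k.+1) = 0 by lra.
rewrite mulf_eq0 => /orP[/eqP //|/eqP h3].
have : 0 < side V i (vx V k.+1) by apply: side_vx_gt0 => //; lia.
by rewrite h3 ltxx.
Qed.

(** A point on two edges is a common vertex, and this is parametrized only as the start of the later
    edge. *)
Lemma walk_inj (a b : R) : 0 <= a -> a < b -> b < a + N%:R -> g a <> g b.
Proof.
move=> a0 ab ba e.
have [i [s [hs ea ga]]] := floorP a0.
have [j [t [ht eb gb]]] := floorP (le_trans a0 (ltW ab)).
have /andP[s0 s1] := hs; have /andP[t0 t1] := ht.
have ij : (i <= j)%N by apply: (nat_le_frac s0 t1); rewrite -ea -eb // ltW.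
have ji : (j <= i + N)%N by apply: (nat_le_frac t0 s1); rewrite natrD addrAC -ea -eb // ltW.
have same v w : lerp v (vx V i) (vx V i.+1) = lerp w (vx V i) (vx V i.+1) -> v = w.
  move=> h; apply/eqP; rewrite -subr_eq0; apply: contraT => vw.
  have := ed_neq0 ccw i; rewrite -dotp_eq0 => /eqP []; move: h.
  rewrite /lerp /dotp /ed /vsub /= => -[h1 h2].
  apply: (mulfI vw); rewrite mulr0.
  have h1' : (v - w) * ((vx V i.+1).1 - (vx V i).1) = 0 by lra.
  have h2' : (v - w) * ((vx V i.+1).2 - (vx V i).2) = 0 by lra.
  by rewrite mulrDr !mulrA h1' h2' !mul0r addr0.
have [e1|nji] := eqVneq j (i + N)%N.
  have gb' : g b = lerp t (vx V i) (vx V i.+1) by rewrite gb e1 -addSn !vx_addN.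
  have st : s = t by apply: same; rewrite -ga e gb'.
  by move: ba; rewrite eb ea e1 natrD st; lra.
have : side V i (g (j%:R + t)) = 0.
  by rewrite -eb -e ga side_lerp /side /orient; ring.
move=> /walk_on_edge [//|//||jE|[jE tE]]; first by lia.
  have st : s = t by apply: same; rewrite -ga e gb jE.
  by move: ab; rewrite ea eb jE st ltxx.
have s1' : s = 1 by apply: same; rewrite lerp1 -ga e gb jE tE lerp0.
by rewrite s1' ltxx in s1.
Qed.

Definition chords_meet (a b c d : R) :=
  segment (g a) (g c) `&` segment (g b) (g d) !=set0.

(** The collinear case, out of reach of Cramer's rule. Unless [a = b], all four points lie on the
    line of edge [i]; then [g b] is on the chord from [g a] to [g c], or [g a] is on the chord from
    [g b] to [g d]. *)
Lemma chords_meet_flat (i : nat) (a b c d : R) : i%:R <= a -> a <= b -> b < i%:R + 1 ->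
  b <= c -> c <= d -> d <= a + N%:R ->
  orient (g a) (g b) (g c) = 0 -> orient (g a) (g b) (g d) = 0 -> chords_meet a b c d.
Proof.
pose s := a - i%:R; pose t := b - i%:R.
have -> : a = i%:R + s by rewrite /s; lra.
have -> : b = i%:R + t by rewrite /t; lra.
rewrite lerDl lerD2l ltrD2l; move: s t => s t s0 st0 t1 tc cd ds oc od; have st := st0.
have i0 : 0 <= i%:R :> R by rewrite ler0n.
have ga : g (i%:R + s) = lerp s (vx V i) (vx V i.+1) by rewrite walk_lerp //; apply/andP; split; lra.
have gb : g (i%:R + t) = lerp t (vx V i) (vx V i.+1) by rewrite walk_lerp //; apply/andP; split; lra.
move: st; rewrite le_eqVlt => /orP[/eqP st|st].
  by exists (g (i%:R + s)); split; [exact: segment_l|rewrite st; exact: segment_l].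
have sc : side V i (g c) = 0.
  move/eqP: oc; rewrite ga gb orient_lerp_same mulf_eq0 => /orP[/eqP|/eqP //]; lra.
have sd : side V i (g d) = 0.
  move/eqP: od; rewrite ga gb orient_lerp_same mulf_eq0 => /orP[/eqP|/eqP //]; lra.
have c0 : 0 <= c by lra.
have d0 : 0 <= d by lra.
have [k [u [hu ec gc]]] := floorP c0; have /andP[u0 u1] := hu.
have [l [v [hv ed gd]]] := floorP d0; have /andP[v0 v1] := hv.
have ik : (i <= k)%N by apply: (nat_le_frac (le_trans s0 st0) u1); rewrite -ec.
have kl : (k <= l)%N by apply: (nat_le_frac u0 v1); rewrite -ec -ed.
have li : (l <= i + N)%N by apply: (nat_le_frac v0 (le_lt_trans st0 t1)); rewrite natrD addrAC -ed.
have bc u' : t <= u' -> u' <= 1 -> g c = lerp u' (vx V i) (vx V i.+1) ->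
    chords_meet (i%:R + s) (i%:R + t) c d.
  move=> tu u'1 e; exists (g (i%:R + t)); split; last exact: segment_l.
  rewrite ga gb e; exists ((t - s) / (u' - s)); split.
    apply/andP; split; first by rewrite divr_ge0 //; lra.
    by rewrite ler_pdivrMr; lra.
  by rewrite lerp_lerp; congr lerp; field; lra.
have [ki|nki] := eqVneq k (i + N)%N; last first.
  move: sc; rewrite {1}ec => /walk_on_edge [//|//||kE|[kE uE]]; first by rewrite ltn_neqAle nki (leq_trans kl).
    by apply: (bc u); [move: tc; rewrite ec kE; lra|lra|rewrite gc kE].
  by apply: (bc 1); [lra|lra|rewrite gc kE uE lerp0 lerp1].
have lE : l = (i + N)%N by apply/eqP; rewrite eqn_leq li -ki.
have e : g d = lerp v (vx V i) (vx V i.+1) by rewrite gd lE -addSn !vx_addN.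
have vs : v <= s by move: ds; rewrite ed lE natrD; lra.
exists (g (i%:R + s)); split; first exact: segment_l.
rewrite ga gb e; exists ((t - s) / (t - v)); split.
  apply/andP; split; first by rewrite divr_ge0 //; lra.
  by rewrite ler_pdivrMr; lra.
by rewrite lerp_lerp; congr lerp; field; lra.
Qed.

Lemma chords_meet_rot (a b c d : R) : 0 <= a ->
  chords_meet b c d (a + N%:R) -> chords_meet a b c d.
Proof.
move=> a0 [X []]; rewrite walk_addN // => h1 h2.
by exists X; split; rewrite // segmentC.
Qed.

(** Cramer's rule: the diagonals are divided in the ratio of the areas they cut off, and [m] is
    twice the area of the quadrilateral. *)
Lemma diagonals_point (A B C D : pt R) (m := orient A B C + orient A C D) :
  m != 0 -> lerp (orient A B D / m) A C = lerp (orient A B C / m) B D.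
Proof.
move: A B C D @m => [a1 a2] [b1 b2] [c1 c2] [d1 d2] m m0.
by rewrite /lerp; congr pair; rewrite /= /m /orient /=; field.
Qed.

(** If the quadrilateral has no area, all four triangles are flat. Then two cyclically consecutive
    points share an edge, as otherwise the first three would form a proper triangle. *)
Lemma walk_chords (a b c d : R) : 0 <= a -> a <= b -> b <= c -> c <= d ->
  d <= a + N%:R -> chords_meet a b c d.
Proof.
move=> a0 ab bc cd da.
have o1 := orient_walk_ge0 a0 ab bc (le_trans cd da).
have o2 := orient_walk_ge0 a0 (le_trans ab bc) cd da.
have o3 := orient_walk_ge0 a0 ab (le_trans bc cd) da.
have o4 : 0 <= orient (g b) (g c) (g d) by apply: orient_walk_ge0; lra.
have E : orient (g a) (g b) (g c) + orient (g a) (g c) (g d) =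
         orient (g b) (g c) (g d) + orient (g a) (g b) (g d) by rewrite /orient; ring.
have [z|nz] := eqVneq (orient (g a) (g b) (g c) + orient (g a) (g c) (g d)) 0; last first.
  set m := _ + _ in nz E.
  have m0 : 0 < m by rewrite lt_def nz addr_ge0.
  exists (lerp (orient (g a) (g b) (g d) / m) (g a) (g c)); split.
    exists (orient (g a) (g b) (g d) / m); split=> //.
    by rewrite divr_ge0 ?(ltW m0) //= ler_pdivrMr // mul1r; lra.
  exists (orient (g a) (g b) (g c) / m); split.
    by rewrite divr_ge0 ?(ltW m0) //= ler_pdivrMr // mul1r /m; lra.
  exact: diagonals_point.
have z1 : orient (g a) (g b) (g c) = 0 by lra.
have z2 : orient (g a) (g c) (g d) = 0 by lra.
have z3 : orient (g a) (g b) (g d) = 0 by lra.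
have z4 : orient (g b) (g c) (g d) = 0 by lra.
have [i [s [hs ea ga]]] := floorP a0; have /andP[s0 s1] := hs.
have b0 : 0 <= b by lra.
have [j [t [ht eb gb]]] := floorP b0; have /andP[t0 t1] := ht.
have c0 : 0 <= c by lra.
have [k [u [hu ec gc]]] := floorP c0; have /andP[u0 u1] := hu.
have d0 : 0 <= d by lra.
have [l [v [hv ed gd]]] := floorP d0; have /andP[v0 v1] := hv.
have ij : (i <= j)%N by apply: (nat_le_frac s0 t1); rewrite -ea -eb // ltW.
have jk : (j <= k)%N by apply: (nat_le_frac t0 u1); rewrite -eb -ec.
have kl : (k <= l)%N by apply: (nat_le_frac u0 v1); rewrite -ec -ed.
have li : (l <= i + N)%N by apply: (nat_le_frac v0 s1); rewrite natrD addrAC -?ea -ed.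
have ga' : g (a + N%:R) = g a by rewrite walk_addN.
have gb' : g (b + N%:R) = g b by rewrite walk_addN.
have gc' : g (c + N%:R) = g c by rewrite walk_addN.
have [e|nij] := eqVneq i j.
  apply: (chords_meet_flat (i := i) _ ab _ bc cd da z1 z3); first by rewrite ea lerDl.
  by rewrite eb e ltrD2l.
have da' : d <= a + N%:R by [].
have ab' : a + N%:R <= b + N%:R by rewrite lerD2r.
have bc' : b + N%:R <= c + N%:R by rewrite lerD2r.
have [e|njk] := eqVneq j k.
  apply/(chords_meet_rot a0)/(chords_meet_flat (i := j) _ bc _ cd da ab' z4).
  - by rewrite eb lerDl.
  - by rewrite ec e ltrD2l.
  - by rewrite ga' -orient_rot.
have [e|nkl] := eqVneq k l.
  apply/(chords_meet_rot a0)/(chords_meet_rot b0).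
  apply: (chords_meet_flat (i := k) _ cd _ da ab' bc').
  - by rewrite ec lerDl.
  - by rewrite ed e ltrD2l.
  - by rewrite ga' -orient_rot.
  - by rewrite gb' -orient_rot.
have [e|nli] := eqVneq l (i + N)%N.
  apply/(chords_meet_rot a0)/(chords_meet_rot b0)/(chords_meet_rot c0).
  apply: (chords_meet_flat (i := l) _ da _ ab' bc').
  - by rewrite ed lerDl.
  - by rewrite ea e natrD addrAC ltrD2l.
  - by rewrite lerD2r.
  - by rewrite ga' gb' orient_rot.
  - by rewrite ga' gc' orient_rot.
exfalso; have : 0 < orient (g a) (g b) (g c).
  have {}ij : (i < j)%N by rewrite ltn_neqAle nij.
  have {}jk : (j < k)%N by rewrite ltn_neqAle njk.
  have {}ki : (k < i + N)%N.
    by apply: leq_trans li; rewrite ltn_neqAle nkl.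
  by rewrite ea eb ec; exact: orient_walk_gt0.
by rewrite z1 ltxx.
Qed.

(** Two cevians of the triangle [a b d]. The denominator [s + t - s * t] vanishes only if both
    parameters do, and then the cevians coincide. *)
Lemma cevians_meet (a b d X p : pt R) : segment b d X -> segment a d p ->
  segment a X `&` segment b p !=set0.
Proof.
move=> [t [/andP[t0 t1] ->]] [s [/andP[s0 s1] ->]].
have h1 : 0 <= t * (1 - s) by rewrite mulr_ge0 //; lra.
have h2 : 0 <= s * (1 - t) by rewrite mulr_ge0 //; lra.
have [z|nz] := eqVneq (s + t - s * t) 0.
  have -> : s = 0 by lra.
  by rewrite lerp0; exists a; split; [exact: segment_l|exact: segment_r].
have m0 : 0 < s + t - s * t by rewrite lt_def nz; lra.
exists (lerp (s / (s + t - s * t)) a (lerp t b d)); split.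
  exists (s / (s + t - s * t)); split=> //.
  by rewrite divr_ge0 ?(ltW m0) //= ler_pdivrMr // mul1r; lra.
exists (t / (s + t - s * t)); split.
  by rewrite divr_ge0 ?(ltW m0) //= ler_pdivrMr // mul1r; lra.
by rewrite /lerp /=; congr pair; field.
Qed.

Lemma segment_sub (a b x y z : pt R) :
  segment a b x -> segment a b y -> segment x y z -> segment a b z.
Proof.
move=> [k [/andP[k0 k1] ->]] [l [/andP[l0 l1] ->]] [m [/andP[m0 m1] ->]].
exists ((1 - m) * k + m * l); rewrite lerp_lerp; split=> //.
have h1 : 0 <= (1 - m) * k by rewrite mulr_ge0 //; lra.
have h2 : 0 <= m * l by rewrite mulr_ge0 //; lra.
have h3 : 0 <= (1 - m) * (1 - k) by rewrite mulr_ge0 //; lra.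
have h4 : 0 <= m * (1 - l) by rewrite mulr_ge0 //; lra.
by apply/andP; split; lra.
Qed.

(** The source of all monotonicity of eyelets: if [g b] and [p] lie in one disk, then so does the
    crossing point, and the chord to the earlier end [g c] still meets the disk. *)
Lemma walk_crossing (a b c d : R) (p : pt R) : 0 <= a -> a <= b -> b <= c -> c <= d ->
  d <= a + N%:R -> segment (g a) (g d) p ->
  segment (g a) (g c) `&` segment (g b) p !=set0.
Proof.
move=> a0 ab bc cd da hp.
have [X [X1 X2]] := walk_chords a0 ab bc cd da.
have [Y [Y1 Y2]] := cevians_meet X2 hp.
by exists Y; split=> //; apply: segment_sub Y1; [exact: segment_l|].
Qed.

End Walk.

(** * The visible part of an eyelet *)

Section Chain.
Context {R : realType}.

Definition dist2 (x y : pt R) : R := dotp (vsub x y) (vsub x y).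

Lemma edist_sqrt (x y : pt R) : Defs.edist x y = Num.sqrt (dist2 x y).
Proof. by rewrite /Defs.edist /dist2 /dotp /vsub /= !expr2. Qed.

Lemma edist_le (x y : pt R) (rho : R) : 0 <= rho ->
  (Defs.edist x y <= rho) = (dist2 x y <= rho ^+ 2).
Proof.
move=> r0; rewrite edist_sqrt -[X in _ <= X](ger0_norm r0) -sqrtr_sqr.
by rewrite ler_sqrt // sqr_ge0.
Qed.

Lemma dist2_lerp (c A B : pt R) (t : R) : dist2 (lerp t A B) c =
  dist2 A c + t * 2 * dotp (vsub A c) (vsub B A) + t ^+ 2 * dist2 B A.
Proof. by rewrite /dist2 /dotp /vsub /lerp /=; ring. Qed.

Lemma dist2_edge (c A B : pt R) (t u : R) : 0 <= t -> t <= u ->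
  0 <= dotp (vsub A c) (vsub B A) -> dist2 (lerp t A B) c <= dist2 (lerp u A B) c.
Proof.
move=> t0 tu h; rewrite !dist2_lerp.
have h1 : 0 <= (u - t) * dotp (vsub A c) (vsub B A) by rewrite mulr_ge0 // subr_ge0.
have h2 : 0 <= (u - t) * (u + t) * dist2 B A.
  by rewrite !mulr_ge0 ?subr_ge0 ?dotp_ge0 // addr_ge0 // (le_trans t0).
by lra.
Qed.

(** The squared distance is a quadratic that does not decrease from parameter 0 on, so the disk is
    left at most once, at the larger root. *)
Lemma edge_exit (c A B : pt R) (rho : R) : 0 <= dotp (vsub A c) (vsub B A) ->
  dist2 A c <= rho ^+ 2 -> exists2 t : R, 0 <= t <= 1 &
  forall u : R, 0 <= u <= 1 -> dist2 (lerp u A B) c <= rho ^+ 2 <-> u <= t.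
Proof.
move=> b0 A0.
have [h1|h1] := lerP (dist2 B c) (rho ^+ 2).
  exists 1; first by rewrite ler01 lexx.
  move=> u /andP[u0 u1]; split=> // _; apply: le_trans h1.
  by rewrite -[in X in _ <= X](lerp1 A B); apply: dist2_edge.
set b := dotp _ _ in b0; pose a := dist2 B A; pose c0 := dist2 A c - rho ^+ 2.
have a0 : 0 < a.
  rewrite /a /dist2; apply: dotp_gt0; apply/eqP => e.
  by move: h1; rewrite e ltNge A0.
have D0 : 0 <= b ^+ 2 - a * c0.
  have : 0 <= a * - c0 by rewrite mulr_ge0 ?(ltW a0) // /c0; lra.
  by have := sqr_ge0 b; lra.
pose s := Num.sqrt (b ^+ 2 - a * c0).
have s0 : 0 <= s by exact: sqrtr_ge0.
have H (u : R) : 0 <= u -> (dist2 (lerp u A B) c <= rho ^+ 2) = (u <= (s - b) / a).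
  move=> u0; rewrite ler_pdivlMr //.
  have ab : 0 <= u * a + b by rewrite addr_ge0 // mulr_ge0 // ltW.
  have -> : (u * a <= s - b) = (u * a + b <= s) by apply/idP/idP => ?; lra.
  have -> : (u * a + b <= s) = ((u * a + b) ^+ 2 <= s ^+ 2) by rewrite ler_pXn2r // nnegrE.
  rewrite sqr_sqrtr // dist2_lerp -/a -/b.
  apply/idP/idP => h.
    have := mulr_ge0 (ltW a0) (_ : 0 <= rho ^+ 2 - (dist2 A c + u * 2 * b + u ^+ 2 * a)).
    by rewrite /c0; move=> /(_ ltac:(lra)); lra.
  rewrite leNgt; apply/negP => h'.
  have := mulr_gt0 a0 (_ : 0 < (dist2 A c + u * 2 * b + u ^+ 2 * a) - rho ^+ 2).
  by move=> /(_ ltac:(lra)); move: h; rewrite /c0; lra.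
exists ((s - b) / a); last by move=> u /andP[u0 _]; rewrite H.
apply/andP; split; first by rewrite -H // lerp0.
by apply/ltW; rewrite ltNge -H // lerp1 -ltNge.
Qed.

(* [A 0, A 1, ...] is a convex chain turning to the side given by the sign of
   [sg], and [c] lies strictly on its outer side. *)
Lemma outer_chain (A : nat -> pt R) (c : pt R) (sg : R) (m : nat)
    (E := fun j => vsub (A j.+1) (A j)) :
  (forall j, (j < m)%N -> 0 < sg * crs (E j) (vsub (A j) c)) ->
  (forall j, (j.+1 < m)%N -> 0 < sg * crs (E j) (E j.+1)) ->
  0 <= dotp (vsub (A 0%N) c) (E 0%N) ->
  forall j, (j < m)%N -> 0 <= dotp (vsub (A j) c) (E j).
Proof.
move=> out trn st; elim=> [//|j IH] jm.
have h0 := IH (ltnW jm); have h1 := out _ (ltnW jm); have h2 := out _ jm; have h3 := trn _ jm.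
set w := vsub (A j.+1) c.
have d1 : 0 <= dotp w (E j).
  suff -> : dotp w (E j) = dotp (vsub (A j) c) (E j) + dotp (E j) (E j).
    by rewrite addr_ge0 // dotp_ge0.
  by rewrite /w /E /dotp /vsub /=; ring.
have d2 : 0 < sg * crs (E j) w.
  suff -> : crs (E j) w = crs (E j) (vsub (A j) c) by [].
  by rewrite /w /E /crs /vsub /=; ring.
rewrite -(pmulr_rge0 _ d2).
(* An identity of plane vectors, which resolves the product into two nonnegative terms. *)
suff -> : sg * crs (E j) w * dotp w (E j.+1) =
    sg * crs (E j.+1) w * dotp w (E j) + sg * crs (E j) (E j.+1) * dotp w w.
  by rewrite addr_ge0 // mulr_ge0 ?dotp_ge0 // ltW.
by rewrite /crs /dotp; ring.
Qed.

(** The distance from [c] never decreases along the chain. The second clause about [T] carries the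
    induction over a vertex that is still in the disk. *)
Lemma chain_exit (A : nat -> pt R) (h : R -> pt R) (c : pt R) (rho : R) (m : nat) :
  h 0 = A 0%N ->
  (forall j u, (j < m)%N -> 0 <= u <= 1 -> h (j%:R + u) = lerp u (A j) (A j.+1)) ->
  (forall j, (j < m)%N -> 0 <= dotp (vsub (A j) c) (vsub (A j.+1) (A j))) ->
  dist2 (A 0%N) c <= rho ^+ 2 ->
  exists T : R, [/\ 0 <= T <= m%:R, dist2 (A m) c <= rho ^+ 2 -> T = m%:R &
    forall t : R, 0 <= t <= m%:R -> dist2 (h t) c <= rho ^+ 2 <-> t <= T].
Proof.
move=> h0 hE dots A0; elim: m hE dots => [|m IH] hE dots.
  exists 0; split=> [|_|t /andP[t0 t1]]; rewrite ?lexx //.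
  have -> : t = 0 by apply/eqP; rewrite eq_le t0 t1.
  by rewrite h0; split.
have [T [/andP[T0 Tm] TE TP]] := IH (fun j u jm => hE j u (ltnW jm)) (fun j jm => dots j (ltnW jm)).
have hm t : m%:R <= t -> t <= m.+1%:R -> 0 <= t - m%:R <= 1 /\
    h t = lerp (t - m%:R) (A m) (A m.+1).
  rewrite -natr1 => t1 t2; have e : 0 <= t - m%:R <= 1 by apply/andP; split; lra.
  by split=> //; rewrite -hE // addrC subrK.
have dm := dots m (ltnSn m).
have [Am|Am] := lerP (dist2 (A m) c) (rho ^+ 2); last first.
  have big t : m%:R <= t -> t <= m.+1%:R -> rho ^+ 2 < dist2 (h t) c.
    move=> t1 t2; have [/andP[e1 e2] ->] := hm t t1 t2; apply: lt_le_trans Am _.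
    by rewrite -[in X in X <= _](lerp0 (A m) (A m.+1)); apply: dist2_edge.
  exists T; split.
  - by rewrite T0 (le_trans Tm) // ler_nat.
  - move=> h1; have := big m.+1%:R; rewrite ler_nat leqnSn lexx => /(_ isT isT).
    have [_ ->] := hm m.+1%:R ltac:(by rewrite ler_nat) (lexx _).
    by rewrite -natr1 addrAC subrr add0r lerp1 ltNge h1.
  - move=> t /andP[t0 t1]; have [tm|tm] := lerP t m%:R; first by apply: TP; rewrite t0.
    split=> h1; last by move: (le_lt_trans Tm tm); rewrite ltNge h1.
    by have := big t (ltW tm) t1; rewrite ltNge h1.
have [u /andP[u0 u1] uP] := edge_exit dm Am.
exists (m%:R + u); split.
- by rewrite addr_ge0 //= -natr1 lerD2l.
- move=> h1; have : 1 <= u by apply/uP; rewrite ?lerp1 ?ler01 ?lexx.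
  by rewrite -natr1 => h2; congr (_ + _); apply/eqP; rewrite eq_le u1 h2.
- move=> t /andP[t0 t1]; have [tm|tm] := lerP t m%:R.
    split=> _; first by apply: (le_trans tm); rewrite lerDl.
    by apply/TP; rewrite ?t0 // TE.
  have [tu ->] := hm t (ltW tm) t1; rewrite uP //; split=> ?; lra.
Qed.

End Chain.

Section Perturb.
Context {R : realType}.

(** Active constraints also hold at [y], and each of the finitely many slack ones survives a short
    step from [x] towards [y]; the minimum of the step lengths serves all. *)
Lemma perturb (f : nat -> pt R -> R) (x y : pt R) (m : nat) :
  (forall j l u v, f j (lerp l u v) = (1 - l) * f j u + l * f j v) ->
  (forall j, (j < m)%N -> 0 <= f j x) ->
  (forall j, (j < m)%N -> f j x = 0 -> 0 <= f j y) ->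
  exists2 l : R, 0 < l <= 1 & forall j, (j < m)%N -> 0 <= f j (lerp l x y).
Proof.
move=> aff; elim: m => [|m IH] hx hy; first by exists 1; rewrite ?ltr01 ?lexx.
have [l /andP[l0 l1] lP] := IH (fun j jm => hx j (ltnW jm)) (fun j jm => hy j (ltnW jm)).
have xm := hx m (ltnSn m).
have [k /andP[k0 k1] kP] : exists2 k : R, 0 < k <= 1 & 0 <= f m (lerp k x y).
  have [ym|ym] := lerP 0 (f m y); first by exists 1; rewrite ?ltr01 ?lexx ?lerp1.
  have xm0 : 0 < f m x.
    rewrite lt_def xm andbT; apply/eqP => e.
    by have := hy m (ltnSn m) e; rewrite leNgt ym.
  exists (f m x / (f m x - f m y)).
    by rewrite divr_gt0 /= ?ler_pdivrMr ?mul1r; lra.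
  by rewrite aff le_eqVlt; apply/orP; left; apply/eqP; field; lra.
have sub (a b : R) (j : nat) : (j < m.+1)%N -> 0 < b -> 0 < a -> a <= b ->
    0 <= f j (lerp b x y) -> 0 <= f j (lerp a x y).
  move=> jm b0 a0 ab h.
  suff -> : f j (lerp a x y) = (1 - a / b) * f j x + a / b * f j (lerp b x y).
    rewrite addr_ge0 // mulr_ge0 ?hx ?(ltW (divr_gt0 a0 b0)) //.
    by rewrite subr_ge0 ler_pdivrMr // mul1r.
  by rewrite !aff; field; exact: lt0r_neq0.
have m0 : 0 < Num.min k l by rewrite lt_min k0.
exists (Num.min k l) => [|j jm]; first by rewrite m0 ge_min k1.
have := jm; rewrite ltnS leq_eqVlt => /orP[/eqP jE|jm'].
  by subst j; apply: (sub _ k) => //; rewrite ge_min lexx.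
by apply: (sub _ l) => //; [rewrite ge_min lexx orbT|exact: lP].
Qed.

End Perturb.

Section VisibleArc.
Context {R : realType}.
Variables (V : seq (pt R)) (c : pt R) (rho : R).
Notation N := (size V).
Notation g := (walk V).
Hypothesis ccw : ccw_polygon V.
Let N2 : (2 < N)%N := size_ccw ccw.
Let N0 : (0 < N)%N := ltn_trans (isT : (0 < 2)%N) N2.

Notation outer j := (side V j c < 0).

Definition sees x : Prop := segment c x `&` hull V = [set x].

Lemma crs_ed_vx j x : crs (ed V j) (vsub (vx V j) x) = - side V j x.
Proof. by rewrite /side /orient /crs /ed /vsub /=; ring. Qed.

Lemma crs_ed_vxS j x : crs (ed V j) (vsub (vx V j.+1) x) = - side V j x.
Proof. by rewrite /side /orient /crs /ed /vsub /=; ring. Qed.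

Lemma outer_visible j x : hull V x -> side V j x = 0 -> outer j -> sees x.
Proof.
move=> hx sx oj; apply/seteqP; split=> [y [[l [/andP[l0 l1] ->]] /(side_hull ccw j)]|y ->] /=.
  rewrite side_lerp sx mulr0 addr0 => h.
  have -> : l = 1; last by rewrite lerp1.
  apply/eqP; rewrite eq_le l1 -subr_le0 leNgt; apply/negP => l1'.
  by move: h; rewrite leNgt pmulr_rlt0 ?oj.
by split=> //; exact: segment_r.
Qed.

(** If no edge line through [x] had [c] on its outer side, a short step from [x] towards [c] would
    stay in the hull and block the view. *)
Lemma visible_outer x : ~ hull V c -> hull V x ->
  sees x -> exists2 j, side V j x = 0 & outer j.
Proof.
move=> nc hx vis; apply: contrapT => nj.
have [||l /andP[l0 l1] lP] := @perturb R (side V) x c N (@side_lerp R V).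
- by move=> j _; exact: side_hull.
- by move=> j _ e; rewrite leNgt; apply/negP => h; apply: nj; exists j.
have hy : hull V (lerp l x c).
  by apply/hullP => // j; rewrite side_mod //; apply: lP; rewrite ltn_pmod.
have : [set x] (lerp l x c).
  by rewrite -(vis : _ = [set x]); split=> //; rewrite segmentC; exists l; rewrite (ltW l0) l1.
move=> /= e; apply: nc.
have -> // : c = x.
move: e; rewrite [x in _ = x -> _]surjective_pairing [x in _ -> _ = x]surjective_pairing.
rewrite [c in _ -> c = _]surjective_pairing /lerp => -[e1 e2].
by congr pair; apply: (mulfI (lt0r_neq0 l0)); lra.
Qed.

(** The edges facing [c] are contiguous: an edge between two of them, on the side where the turn is
    less than a half turn, has a direction that is a positive combination of theirs. The sign of the
    turn tells which of the two arcs this is. *)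
Lemma outer_between i j : (i < j)%N -> (j < i + N)%N -> outer i -> outer j ->
  (forall e, (i <= e <= j)%N -> outer e) \/ (forall e, (j <= e <= i + N)%N -> outer e).
Proof.
have L a b : (a < b)%N -> (b < a + N)%N -> outer a -> outer b ->
    0 < crs (ed V a) (ed V b) -> forall e, (a <= e <= b)%N -> outer e.
  move=> ab ba oa ob ab0 e /andP[ae eb].
  have [<- //|nae] := eqVneq a e; have [-> //|neb] := eqVneq e b.
  have ae0 : 0 < crs (ed V a) (ed V e) by apply: (crs_ed_between ccw _ _ eb ba ab0); lia.
  have eb0 : 0 < crs (ed V e) (ed V b) by apply: (crs_ed_between ccw ae _ _ ba ab0); lia.
  rewrite -(pmulr_rlt0 _ ab0).
  have -> : crs (ed V a) (ed V b) * side V e c =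
     crs (ed V e) (ed V b) * (side V a c - side V a (vx V e)) +
     crs (ed V a) (ed V e) * (side V b c - side V b (vx V e)).
    by rewrite !side_diff sideE; rewrite /crs; ring.
  have h1 := side_vx_ge0 ccw a e; have h2 := side_vx_ge0 ccw b e.
  have : crs (ed V e) (ed V b) * (side V a c - side V a (vx V e)) < 0.
    by rewrite pmulr_rlt0 //; lra.
  have : crs (ed V a) (ed V e) * (side V b c - side V b (vx V e)) < 0.
    by rewrite pmulr_rlt0 //; lra.
  by lra.
move=> ij ji oi oj.
have [lt0|gt0|e0] := ltgtP (crs (ed V i) (ed V j)) 0; last 1 first.
(* Antiparallel edges bound a strip, and [c] cannot be beyond both of its sides. *)
- have par := ed_parallel ccw ij ji e0.
  have ii : 0 < dotp (ed V i) (ed V i) by apply: dotp_gt0; rewrite -vsub_eq0 ed_neq0.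
  have h1 := side_vx_ge0 ccw i j.
  have E : dotp (ed V i) (ed V i) * side V j c =
      dotp (ed V i) (ed V j) * (side V i c - side V i (vx V j)).
    have : crs (ed V i) (ed V j) * dotp (ed V i) (vsub c (vx V j)) = 0 by rewrite e0 mul0r.
    by rewrite side_diff sideE /crs /dotp => h; lra.
  have : dotp (ed V i) (ed V i) * side V j c < 0 by rewrite pmulr_rlt0.
  rewrite E nmulr_rlt0 //; lra.
- right; apply: L; rewrite ?side_addN ?ed_addN // ?ltn_add2r //.
  by rewrite crsC; lra.
- by left; exact: L.
Qed.

(** Both sums are twice the area of the polygon, which does not depend on [x]. *)
Lemma sum_side x : \sum_(0 <= j < N) side V j x = \sum_(0 <= j < N) crs (vx V j) (vx V j.+1).
Proof.
apply/eqP; rewrite -subr_eq0 -sumrB.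
have -> : \sum_(0 <= j < N) (side V j x - crs (vx V j) (vx V j.+1)) =
  \sum_(0 <= j < N) (crs x (vx V j.+1) * -1 - crs x (vx V j) * -1).
  by apply: eq_bigr => j _; rewrite /side /orient /crs; ring.
by rewrite telescope_sumr // -[N]add0n vx_addN subrr.
Qed.

(** If all edges faced [c], the area sum would be negative at [c], but it is positive at an inner
    point. *)
Lemma inner_edge k : exists2 e, (k <= e < k + N)%N & ~ outer e.
Proof.
apply: contrapT => ne.
have all e : outer e.
  have [e' ke' [_ e2]] := exists_lift ccw k e.
  have -> : side V e c = side V e' c.
    by rewrite /side; have := e2 0%N; have := e2 1%N; rewrite !addn0 !addn1 => -> ->.
  by apply: contrapT => h; apply: ne; exists e'.
have [p hp] := exists_inner ccw.
have : \sum_(0 <= j < N) side V j c < \sum_(0 <= j < N) side V j p.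
  apply: ltr_sum_nat => // j _; exact: lt_trans (all j) (hp j).
by rewrite !sum_side ltxx.
Qed.

Lemma maximal_prefix (P : nat -> Prop) (M : nat) : exists m, [/\ (m <= M)%N,
  forall i, (i < m)%N -> P i & forall j, (j <= M)%N -> (forall i, (i < j)%N -> P i) -> (j <= m)%N].
Proof.
elim: M => [|M [m [mM mP mmax]]]; first by exists 0%N; split.
have [all|nall] := pselect (forall i, (i < M.+1)%N -> P i).
  by exists M.+1; split.
exists m; split=> //; first exact: leqW.
move=> j; rewrite leq_eqVlt => /orP[/eqP ->//|jM]; exact: mmax.
Qed.

(** The first hypothesis is the variational characterization of [vx V k] as the point of the hull
    nearest to [c]; it starts the monotonicity of [outer_chain]. *)
Lemma exit_ccw k m : 
  (forall x, hull V x -> dotp (vsub c (vx V k)) (vsub x (vx V k)) <= 0) ->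
  dist2 (vx V k) c <= rho ^+ 2 ->
  (forall i, (i < m)%N -> outer (k + i)) -> exists T : R, [/\ 0 <= T <= m%:R,
   dist2 (vx V (k + m)) c <= rho ^+ 2 -> T = m%:R &
    forall t : R, 0 <= t <= m%:R -> dist2 (g (k%:R + t)) c <= rho ^+ 2 <-> t <= T].
Proof.
move=> near kin mfO.
apply: (chain_exit (A := fun i => vx V (k + i)) (h := fun t => g (k%:R + t))).
- by rewrite addr0 walk_nat addn0.
- by move=> j u jm u01; rewrite addrA -natrD walk_lerp // addnS.
- apply: (@outer_chain R (fun i => vx V (k + i)) c 1).
  + move=> j jm; rewrite mul1r addnS -/(ed V (k + j)) crs_ed_vx oppr_gt0; exact: mfO.
  + by move=> j _; rewrite mul1r !addnS; exact: turn.
  + have := near _ (hull_vx ccw k.+1).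
    by rewrite addn0 addn1 /dotp /vsub /= => ?; lra.
- by rewrite addn0.
Qed.

(** The clockwise version. The additional [N] in the indices keeps the subtractions of naturals
    exact, and [sg = -1] reflects the reversed turning. *)
Lemma exit_cw k m : (N <= k)%N -> (m < N)%N ->
  (forall x, hull V x -> dotp (vsub c (vx V k)) (vsub x (vx V k)) <= 0) ->
  dist2 (vx V k) c <= rho ^+ 2 ->
  (forall i, (i < m)%N -> outer (k + N - 1 - i)) -> exists T : R, [/\ 0 <= T <= m%:R,
   dist2 (vx V (k + N - m)) c <= rho ^+ 2 -> T = m%:R &
    forall t : R, 0 <= t <= m%:R -> dist2 (g (k%:R - t)) c <= rho ^+ 2 <-> t <= T].
Proof.
move=> Nk mN near kin mbO.
apply: (chain_exit (A := fun i => vx V (k + N - i)) (h := fun t => g (k%:R - t))).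
- by rewrite subr0 walk_nat subn0 vx_addN.
- move=> j u jm /andP[u0 u1].
  have -> : k%:R - (j%:R + u) = (k - j.+1)%:R + (1 - u).
    by rewrite natrB; [rewrite -natr1; ring|lia].
  rewrite walk_lerp; last by apply/andP; split; lra.
  rewrite -lerpC; congr lerp.
    by rewrite -addnBAC ?vx_addN; [congr vx; lia|lia].
  by rewrite -addnBAC ?vx_addN //; lia.
- apply: (@outer_chain R (fun i => vx V (k + N - i)) c (-1)).
  + move=> j jm; have -> : (k + N - j = (k + N - 1 - j).+1)%N by lia.
    have -> : (k + N - j.+1 = k + N - 1 - j)%N by lia.
    have -> : -1 * crs (vsub (vx V (k + N - 1 - j)) (vx V (k + N - 1 - j).+1))
        (vsub (vx V (k + N - 1 - j).+1) c) =
        crs (ed V (k + N - 1 - j)) (vsub (vx V (k + N - 1 - j).+1) c).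
      by rewrite /ed /crs /vsub /=; ring.
    by rewrite crs_ed_vxS oppr_gt0; exact: mbO.
  + move=> j jm; have -> : (k + N - j = (k + N - 2 - j).+2)%N by lia.
    have -> : (k + N - j.+1 = (k + N - 2 - j).+1)%N by lia.
    have -> : (k + N - j.+2 = k + N - 2 - j)%N by lia.
    have := turn ccw (k + N - 2 - j).
    by rewrite /ed /crs /vsub /= => ?; lra.
  + have := near _ (hull_vx ccw (k + N - 1)).
    by rewrite subn0 vx_addN /dotp /vsub /= => ?; lra.
- by rewrite subn0 vx_addN.
Qed.

(** The visible points are those on facing edges; these are contiguous around vertex [k], and along
    them the disk is left once in each direction. With [k] at least [N] the parameter [B] is
    positive. *)
Lemma visible_arc k : (N <= k)%N -> 0 <= rho -> ~ hull V c ->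
  (forall x, hull V x -> dotp (vsub c (vx V k)) (vsub x (vx V k)) <= 0) ->
  dist2 (vx V k) c <= rho ^+ 2 ->
  exists B F : R, [/\ k%:R - N%:R < B <= k%:R, k%:R <= F < B + N%:R &
    [set x | [/\ disk rho c x, hull V x, boundary (hull V) x & sees x]] =
    [set x | exists2 t, B <= t <= F & x = g t]].
Proof.
move=> Nk r0 nc near kin.
have kc : vx V k != c by apply/eqP => e; apply: nc; rewrite -e; exact: hull_vx.
have [e /andP[ke ekN] ne] := inner_edge k.
(* The edge [e], which does not face [c], stops the runs in both directions, so together they have
   fewer than [N] edges. *)
have [mf [mfE mfO mfmax]] := maximal_prefix (fun i => outer (k + i)) (e - k).
have [mb [mbE mbO mbmax]] := maximal_prefix (fun i => outer (k + N - 1 - i)) (k + N - 1 - e).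
have mN : (mf + mb < N)%N by nlia.
have [Tf [/andP[Tf0 Tfm] _ TfP]] := exit_ccw near kin mfO.
have [Tb [/andP[Tb0 Tbm] _ TbP]] := exit_cw Nk (leq_ltn_trans (leq_addl _ _) mN) near kin mbO.
have kR : 0 <= k%:R :> R by rewrite ler0n.
have NR : N%:R <= k%:R :> R by rewrite ler_nat.
have mNR : mf%:R + mb%:R <= N%:R - 1 :> R.
  by rewrite lerBrDr -natrD natr1 ler_nat.
have mbk : mb%:R <= k%:R :> R by rewrite ler_nat; nlia.
have disk2 x : disk rho c x <-> dist2 x c <= rho ^+ 2.
  by rewrite /disk /= edist_le.
have visk : sees (vx V k).
  apply/seteqP; split=> [y [[l [l01 ->]] hy]|y ->] /=; last first.
    by split; [exact: segment_r|exact: hull_vx].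
  have := near _ hy; have := dotp_gt0 kc.
  have -> : dotp (vsub c (vx V k)) (vsub (lerp l c (vx V k)) (vx V k)) =
     (1 - l) * dotp (vsub (vx V k) c) (vsub (vx V k) c).
    by rewrite /dotp /vsub /lerp /=; ring.
  move=> d0; rewrite pmulr_lle0 // subr_le0 => l1.
  by (have -> : l = 1 by lra); rewrite lerp1.
have base : outer k \/ outer (k + N - 1).
  have [j0 sj0 oj0] := visible_outer nc (hull_vx ccw k) visk.
  have [j /andP[kj jk] [e0 eS]] := exists_lift ccw k j0.
  have sE x : side V j0 x = side V j x.
    by rewrite /side e0; have := eS 1%N; rewrite !addn1 => ->.
  rewrite !sE in sj0 oj0.
  have [<-|nkj] := eqVneq j k; first by left.
  right; have [<- //|nj] := eqVneq j (k + N - 1)%N.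
  have : 0 < side V j (vx V (k + N)) by apply: side_vx_gt0 => //; nlia.
  by rewrite vx_addN sj0 ltxx.
have split_at (m : nat) (t : R) : (0 < m)%N -> 0 <= t <= m%:R ->
    exists j u, [/\ (j < m)%N, 0 <= u <= 1 & t = j%:R + u].
  move=> m0 /andP[t0 tm]; have [j [u [/andP[u0 u1] e1 _]]] := floorP V t0.
  have [jm|mj] := ltnP j m; first by exists j, u; rewrite u0 ltW.
  exists m.-1, 1; rewrite ltn_predL m0 ler01 lexx; split=> //.
  rewrite natr1 prednK //; have : m%:R <= j%:R :> R by rewrite ler_nat.
  by lra.
exists (k%:R - Tb), (k%:R + Tf); split; first by apply/andP; split; lra.
  by apply/andP; split; lra.
apply/seteqP; split=> x /=.
  move=> [/disk2 dx hx bx vx_]; have [j0 sj0 oj0] := visible_outer nc hx vx_.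
  have [j /andP[kj jk] [e0 eS]] := exists_lift ccw k j0.
  have sE y : side V j0 y = side V j y.
    by rewrite /side e0; have := eS 1%N; rewrite !addn1 => ->.
  rewrite !sE in sj0 oj0.
  have [u [/andP[u0 u1] xE]] := on_edge ccw hx sj0.
  (* As an edge at vertex [k] faces [c], contiguity joins edge [j] to that vertex on one side or the
     other. *)
  have alt : (forall i, (k <= i <= j)%N -> outer i) \/
             (forall i, (j <= i <= k + N - 1)%N -> outer i).
    case: base => [ok|ok].
      have [jE|njk] := eqVneq j k.
        by left=> i ik; have -> : i = j by nlia.
      have kj' : (k < j)%N by nlia.
      have [h|h] := outer_between kj' jk ok oj0; first by left.
      by right=> i ik; apply: h; nlia.
    have [jE|nj] := eqVneq j (k + N - 1)%N.
      by right=> i ik; have -> : i = j by nlia.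
    have jk' : (j < k + N - 1)%N by nlia.
    have jkN : (k + N - 1 < j + N)%N by nlia.
    have [h|h] := outer_between jk' jkN oj0 ok; first by right.
    by left=> i ik; rewrite -side_addN; apply: h; nlia.
  case: alt => alt.
    have jm : (j.+1 - k <= mf)%N.
      apply: mfmax => [|i ij]; last by apply: alt; nlia.
      rewrite leqNgt; apply/negP => h; apply: ne; apply: alt; nlia.
    have jR : (j - k)%:R + 1 <= mf%:R :> R by rewrite natr1 ler_nat; nlia.
    have jE : k%:R + ((j - k)%:R + u) = j%:R + u :> R.
      by rewrite addrA -natrD subnKC.
    have j0R : 0 <= (j - k)%:R :> R by rewrite ler0n.
    have xE' : x = g (k%:R + ((j - k)%:R + u)) by rewrite jE walk_lerp ?u0.
    exists (k%:R + ((j - k)%:R + u)) => //.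
    have tin : 0 <= (j - k)%:R + u <= mf%:R by apply/andP; split; lra.
    have h : (j - k)%:R + u <= Tf by apply/(TfP _ tin); rewrite -xE'.
    by apply/andP; split; lra.
  have jm : (k + N - j <= mb)%N.
    apply: mbmax => [|i ij]; last by apply: alt; nlia.
    rewrite leqNgt; apply/negP => h; apply: ne; apply: alt; nlia.
  have jR : (k + N - 1 - j)%:R + 1 <= mb%:R :> R by rewrite natr1 ler_nat; nlia.
  have j0R : 0 <= (k + N - 1 - j)%:R :> R by rewrite ler0n.
  have jE : k%:R - ((k + N - 1 - j)%:R + (1 - u)) + N%:R = j%:R + u :> R.
    by rewrite !natrB; [rewrite natrD; ring|nlia|nlia].
  have xE' : x = g (k%:R - ((k + N - 1 - j)%:R + (1 - u))).
    by rewrite -walk_addN ?jE ?walk_lerp ?u0 //; lra.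
  exists (k%:R - ((k + N - 1 - j)%:R + (1 - u))) => //.
  have tin : 0 <= (k + N - 1 - j)%:R + (1 - u) <= mb%:R by apply/andP; split; lra.
  have h : (k + N - 1 - j)%:R + (1 - u) <= Tb by apply/(TbP _ tin); rewrite -xE'.
  by apply/andP; split; lra.
move=> [t /andP[Bt tF] ->].
have t0 : 0 <= t by lra.
have [kt|tk] := lerP k%:R t.
  have tE : t = k%:R + (t - k%:R) by lra.
  have tm : 0 <= t - k%:R <= mf%:R by apply/andP; split; lra.
  split; [|exact: walk_hull|exact: boundary_walk|].
    by apply/disk2; rewrite tE; apply/TfP => //; lra.
  have [m0|m0] := posnP mf.
    have -> : t = k%:R by move: tm; rewrite m0 => /andP[? ?]; lra.
    by rewrite walk_nat.
  have [j [u [jm u01 e1]]] := split_at _ _ m0 tm.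
  have gE : g t = lerp u (vx V (k + j)) (vx V (k + j).+1).
    by rewrite -walk_lerp // natrD -addrA -e1 addrC subrK.
  apply: (outer_visible (j := k + j)); [exact: walk_hull| |exact: mfO].
  by rewrite gE side_lerp /side /orient; ring.
have tE : t = k%:R - (k%:R - t) by lra.
have tm : 0 <= k%:R - t <= mb%:R by apply/andP; split; lra.
split; [|exact: walk_hull|exact: boundary_walk|].
  by apply/disk2; rewrite tE; apply/TbP => //; lra.
have m0 : (0 < mb)%N.
  by rewrite -(ltr0n R); case/andP: tm => ? ?; lra.
have [j [u [jm /andP[u0 u1] e1]]] := split_at _ _ m0 tm.
have gE : g t = lerp (1 - u) (vx V (k + N - 1 - j)) (vx V (k + N - 1 - j).+1).
  rewrite -walk_addN // -walk_lerp; last by apply/andP; split; lra.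
  congr g; rewrite !natrB; [rewrite natrD; lra|nlia|nlia].
apply: (outer_visible (j := k + N - 1 - j)); [exact: walk_hull| |exact: mbO].
by rewrite gE side_lerp /side /orient; ring.
Qed.

End VisibleArc.

(** * Shifted edges *)

Section Norm.
Context {R : realType}.
Implicit Types u v x y : pt R.

Definition len u : R := Num.sqrt (dotp u u).

Lemma len_ge0 u : 0 <= len u. Proof. exact: sqrtr_ge0. Qed.

Lemma len2 u : len u ^+ 2 = dotp u u.
Proof. by rewrite sqr_sqrtr // dotp_ge0. Qed.

Lemma lagrange u v : crs u v ^+ 2 + dotp u v ^+ 2 = (len u * len v) ^+ 2.
Proof. by rewrite exprMn !len2 /crs /dotp; ring. Qed.

Lemma abs_le_sqr (x y z : R) : 0 <= z -> x ^+ 2 + y ^+ 2 = z ^+ 2 -> `|x| <= z.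
Proof.
move=> z0 e; rewrite -(@ler_pXn2r _ 2) ?nnegrE // real_normK ?num_real //.
by rewrite -e lerDl sqr_ge0.
Qed.

Lemma crs_le u v : `|crs u v| <= len u * len v.
Proof. by apply: abs_le_sqr (lagrange u v); rewrite mulr_ge0 ?len_ge0. Qed.

Lemma dotp_le u v : `|dotp u v| <= len u * len v.
Proof.
apply: (abs_le_sqr (y := crs u v)); first by rewrite mulr_ge0 ?len_ge0.
by rewrite addrC; exact: lagrange.
Qed.

Lemma edist_len x y : Defs.edist x y = len (vsub x y).
Proof. exact: edist_sqrt. Qed.

Lemma len_add u v : len (u.1 + v.1, u.2 + v.2) <= len u + len v.
Proof.
rewrite -(@ler_pXn2r _ 2) ?nnegrE ?addr_ge0 ?len_ge0 // sqrrD !len2.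
have := le_trans (ler_norm _) (dotp_le u v).
by rewrite /dotp /=; lra.
Qed.

Lemma len_scale k u : 0 <= k -> len (k * u.1, k * u.2) = k * len u.
Proof.
move=> k0; rewrite /len -[k in RHS](ger0_norm k0) -sqrtr_sqr -sqrtrM ?sqr_ge0 //.
by congr Num.sqrt; rewrite /dotp /=; ring.
Qed.

Lemma edist_triangle x y z : Defs.edist x z <= Defs.edist x y + Defs.edist y z.
Proof.
rewrite !edist_len; apply: le_trans (len_add _ _).
by rewrite le_eqVlt; apply/orP; left; apply/eqP; congr len; rewrite /vsub /=; congr pair; ring.
Qed.

Lemma len_gt0 u : u != (0, 0) -> 0 < len u.
Proof. by move=> u0; rewrite sqrtr_gt0 lt_def dotp_ge0 dotp_eq0 u0. Qed.

End Norm.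

(* The polygon Pi is obtained from Q by shifting every edge of Q inwards by
   [dl], which is r - eps. *)
Section Inset.
Context {R : realType}.
Variables (q : seq (pt R)) (dl : R).
Notation n := (size q).

Definition line (j : nat) (x : pt R) : R := side q j x - dl * len (ed q j).

Lemma line_lerp j l x y : line j (lerp l x y) = (1 - l) * line j x + l * line j y.
Proof. by rewrite /line side_lerp; ring. Qed.

Lemma line_diff j x y : line j x - line j y = crs (ed q j) (vsub x y).
Proof. by rewrite -side_diff /line; ring. Qed.

Lemma line_addN j x : line (j + n) x = line j x.
Proof. by rewrite /line side_addN ed_addN. Qed.

Lemma line_per m j x : line (m * n + j) x = line j x.
Proof. by rewrite /line side_per ed_per. Qed.

Lemma line_mod j x : line j x = line (j %% n) x.
Proof. by rewrite {1}(divn_eq j n) line_per. Qed.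

Lemma line_comb a t b x w :
  crs (ed q a) (ed q b) * (line t x - line t w) =
  crs (ed q t) (ed q b) * (line a x - line a w) +
  crs (ed q a) (ed q t) * (line b x - line b w).
Proof. by rewrite !line_diff /crs; ring. Qed.

Hypothesis ccw : ccw_polygon q.
Let n2 : (2 < n)%N := size_ccw ccw.
Let n0 : (0 < n)%N := ltn_trans (isT : (0 < 2)%N) n2.

Lemma len_ed_gt0 j : 0 < len (ed q j).
Proof. exact/len_gt0/ed_neq0. Qed.

(** Forwards, the disk point lying furthest beyond edge [j] is tested. Backwards, a disk point
    [x + d] is split as [(x + (dl / r) d) + (eps / r) d]: the first part stays in the hull, the
    second in the disk of radius [eps]. *)
Lemma inset_line (r eps : R) x : 0 < eps -> eps < r -> dl = r - eps ->
  inset (offset (hull q) eps) r x <-> forall j, 0 <= line j x.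
Proof.
move=> e0 er dlE; have r0 : 0 < r by exact: lt_trans e0 er.
split=> [hx j|hx y].
  have l0 := len_ed_gt0 j; have l2 := len2 (ed q j).
  pose y : pt R := (x.1 + r / len (ed q j) * (ed q j).2, x.2 - r / len (ed q j) * (ed q j).1).
  have rl : 0 <= r / len (ed q j) by rewrite divr_ge0 ?ltW.
  have dy : disk r x y.
    rewrite /disk /= edist_len.
    have -> : vsub y x = (r / len (ed q j) * ((ed q j).2, - (ed q j).1).1,
                          r / len (ed q j) * ((ed q j).2, - (ed q j).1).2).
      by rewrite /y /vsub /=; congr pair; ring.
    rewrite len_scale //.
    have -> : len ((ed q j).2, - (ed q j).1) = len (ed q j).
      by congr Num.sqrt; rewrite /dotp /=; ring.
    by rewrite divfK // gt_eqF.
  have [a [b [ha hb yE]]] := hx _ dy.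
  have sa := side_hull ccw j ha.
  have hb' : len b <= eps.
    by move: hb; rewrite /disk /= edist_len /vsub /= !subr0 -surjective_pairing.
  have := le_trans (ler_norm _) (crs_le b (ed q j)).
  have : len b * len (ed q j) <= eps * len (ed q j) by rewrite ler_pM2r.
  have : side q j y = side q j x - r * len (ed q j).
    have -> : side q j y = side q j x - r / len (ed q j) * dotp (ed q j) (ed q j).
      by rewrite !sideE /y /crs /dotp /vsub /=; ring.
    by rewrite -len2 expr2 mulrA divfK // gt_eqF.
  have : side q j y = side q j a - crs b (ed q j).
    by rewrite yE !sideE /crs /vsub /=; ring.
  by rewrite /line dlE; lra.
move=> hy; have [d dE] : exists d, d = vsub y x by exists (vsub y x).
have hd : len d <= r by move: hy; rewrite /disk /= edist_len dE.
have k0 : 0 <= dl / r by rewrite divr_ge0 ?(ltW r0) // dlE; lra.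
have k1 : 0 <= eps / r by rewrite divr_ge0 ?(ltW r0) // ltW.
have shrink (s : R) : 0 <= s -> s / r * len d <= s.
  by move=> s0; rewrite -mulrA [_^-1 * _]mulrC ler_piMr // ler_pdivrMr // mul1r.
exists (x.1 + dl / r * d.1, x.2 + dl / r * d.2), (eps / r * d.1, eps / r * d.2); split.
- apply/hullP => // j; have hj := hx j.
  have -> : side q j (x.1 + dl / r * d.1, x.2 + dl / r * d.2) =
     side q j x - crs (dl / r * d.1, dl / r * d.2) (ed q j).
    by rewrite !sideE /crs /vsub /=; ring.
  have := le_trans (ler_norm _) (crs_le (dl / r * d.1, dl / r * d.2) (ed q j)).
  rewrite len_scale //.
  have : dl / r * len d * len (ed q j) <= dl * len (ed q j).
    by rewrite ler_pM2r ?len_ed_gt0 // shrink // dlE; lra.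
  by move: hj; rewrite /line; lra.
- rewrite /disk /= edist_len /vsub /= !subr0 len_scale // shrink //; exact: ltW.
- rewrite /= -!addrA -!mulrDl dlE subrK divff ?gt_eqF // !mul1r dE /vsub /=.
  by rewrite [y]surjective_pairing /=; congr pair; ring.
Qed.

End Inset.

(** Each point of the offset is within [r] of a hull point, hence at distance at least [|c - z| - r]
    from [c]. This bound passes to the infimum, whether or not it is attained, and is compared with
    [eps]. *)
Lemma nearest_close {R : realType} (q V : seq (pt R)) (r eps : R) (c z : pt R) :
  0 < r -> 0 < eps -> eps_close eps (offset (hull V) r) (hull q) -> hull q c ->
  (forall x, hull V x -> dotp (vsub c z) (vsub x z) <= 0) ->
  dist2 z c <= (r + eps) ^+ 2.
Proof.
move=> r0 e0 cl hc near; rewrite -edist_le; last by rewrite addr_ge0 // ltW.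
have cz : Defs.edist z c = Defs.edist c z.
  by rewrite /Defs.edist; congr Num.sqrt; ring.
rewrite cz -lerBlDl -lee_fin.
move: cl; rewrite /eps_close /hausdorff ge_max => /andP[_]; apply: le_trans.
apply: (@le_trans _ _ (ereal_inf [set (Defs.edist c b)%:E | b in offset (hull V) r])); last first.
  by apply: ereal_sup_ubound; exists c.
apply: le_ereal_inf_tmp => _ [_ [x [e [hx he ->]]] <-]; rewrite lee_fin.
have h1 : Defs.edist c z <= Defs.edist c x.
  rewrite !edist_sqrt ler_sqrt ?dotp_ge0 //.
  have := near _ hx; have := dotp_ge0 (vsub x z).
  by rewrite /dist2 /dotp /vsub /=; lra.
have h2 := edist_triangle c (x.1 + e.1, x.2 + e.2) x.
have h3 : Defs.edist (x.1 + e.1, x.2 + e.2) x <= r.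
  move: he; rewrite /disk /= !edist_len /vsub /= !subr0.
  by congr (len _ <= _); congr pair; ring.
by lra.
Qed.

(** * The shifted lines that carry edges of Pi *)

Section TrueLines.
Context {R : realType}.
Variables (q V : seq (pt R)) (dl : R).
Notation n := (size q).
Notation N := (size V).
Notation Ln := (line q dl).
Hypothesis ccwq : ccw_polygon q.
Hypothesis ccwV : ccw_polygon V.
Hypothesis dl0 : 0 < dl.
Hypothesis hullE : forall x, hull V x <-> forall j, 0 <= Ln j x.
Let n2 : (2 < n)%N := size_ccw ccwq.
Let n0 : (0 < n)%N := ltn_trans (isT : (0 < 2)%N) n2.
Let N2 : (2 < N)%N := size_ccw ccwV.

(* Edge [k] of Pi lies on the shifted edge line [j] of Q. *)
Definition on_line (j k : nat) : Prop := Ln j (vx V k) = 0 /\ Ln j (vx V k.+1) = 0.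

Lemma line_vx j k : 0 <= Ln j (vx V k).
Proof. by move: j; apply/hullE; exact: hull_vx. Qed.

(** If all lines were slack at the midpoint [m] of the edge, a short step outwards would stay in the
    hull. A line active at [m] is nonnegative at both ends of the edge, hence vanishes there. *)
Lemma on_line_ex k : exists j, on_line j k.
Proof.
have [c hc] := exists_inner ccwV.
pose m := lerp (1 / 2) (vx V k) (vx V k.+1).
have sm : side V k m = 0 by rewrite /m side_lerp /side /orient; ring.
have hm j : 0 <= Ln j m.
  by rewrite /m line_lerp addr_ge0 // mulr_ge0 ?line_vx //; lra.
have mE j : Ln j m = 0 -> on_line j k.
  have := line_vx j k; have := line_vx j k.+1.
  by rewrite /m line_lerp => h1 h2 h3; split; lra.
apply: contrapT => nj.
pose y : pt R := (2 * m.1 - c.1, 2 * m.2 - c.2).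
have [||l /andP[l0 l1] lP] := @perturb R Ln m y n (@line_lerp R q dl).
- by move=> j _; exact: hm.
- by move=> j _ /mE h; exfalso; apply: nj; exists j.
have : hull V (lerp l m y).
  by apply/hullE => j; rewrite line_mod; apply: lP; rewrite ltn_pmod.
move=> /(side_hull ccwV k); rewrite side_lerp sm mulr0 add0r.
have -> : side V k y = 2 * side V k m - side V k c.
  by rewrite /y /side /orient /=; ring.
rewrite sm mulr0 sub0r pmulr_rge0 // oppr_ge0; have := hc k; lra.
Qed.

(** The factor is positive because the vertex after the edge lies strictly left of the edge and not
    right of the line. *)
Lemma on_line_dir j k : on_line j k ->
  exists2 m : R, 0 < m & ed V k = (m * (ed q j).1, m * (ed q j).2).
Proof.
move=> [h1 h2].
have d0 : 0 < dotp (ed q j) (ed q j) by apply: dotp_gt0; rewrite -vsub_eq0 ed_neq0.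
have c0 : crs (ed q j) (ed V k) = 0 by rewrite {2}/ed -(line_diff q dl) h1 h2 subrr.
have par (w : pt R) : dotp (ed q j) (ed q j) * crs (ed V k) w =
    dotp (ed V k) (ed q j) * crs (ed q j) w.
  have : crs (ed q j) (ed V k) * dotp (ed q j) w = 0 by rewrite c0 mul0r.
  by rewrite /crs /dotp => h; lra.
have s0 : 0 < crs (ed V k) (vsub (vx V k.+2) (vx V k)).
  by have : 0 < side V k (vx V k.+2) by apply: side_vx_gt0 => //; lia.
have l0 : 0 <= crs (ed q j) (vsub (vx V k.+2) (vx V k)).
  by rewrite -(line_diff q dl) h1 subr0 line_vx.
have m0 : 0 < dotp (ed V k) (ed q j).
  rewrite ltNge; apply/negP => le0.
  have := mulr_gt0 d0 s0; rewrite par ltNge => /negP; apply.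
  by rewrite mulr_le0_ge0.
exists (dotp (ed V k) (ed q j) / dotp (ed q j) (ed q j)); first exact: divr_gt0.
have dn : dotp (ed q j) (ed q j) != 0 by rewrite gt_eqF.
rewrite [LHS]surjective_pairing; congr pair; apply: (mulfI dn); rewrite mulrA mulrCA divff // mulr1.
  by have := par (0, 1); rewrite /crs /=; lra.
by have := par (1, 0); rewrite /crs /=; lra.
Qed.

(** Both edges of [q] would have the direction of one edge of the hull, but distinct parallel edges
    of a convex polygon point in opposite directions. *)
Lemma on_line_inj i j k : (i < j)%N -> (j < i + n)%N -> on_line i k -> on_line j k -> False.
Proof.
move=> ij ji /on_line_dir[a a0 ea] /on_line_dir[b b0 eb].
have ab : (a * (ed q i).1, a * (ed q i).2) = (b * (ed q j).1, b * (ed q j).2) by rewrite -ea.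
case: ab => e1 e2.
have c0 : a * crs (ed q i) (ed q j) = 0.
  have -> : a * crs (ed q i) (ed q j) = (a * (ed q i).1 - b * (ed q j).1) * (ed q j).2 -
      (a * (ed q i).2 - b * (ed q j).2) * (ed q j).1 by rewrite /crs; ring.
  by rewrite e1 e2 !subrr !mul0r subrr.
move/eqP: c0; rewrite mulf_eq0 gt_eqF //= => /eqP /(ed_parallel ccwq ij ji).
rewrite ltNge => /negP; apply; rewrite -(pmulr_rge0 _ a0).
have -> : a * dotp (ed q i) (ed q j) = b * dotp (ed q j) (ed q j) +
    (a * (ed q i).1 - b * (ed q j).1) * (ed q j).1 +
    (a * (ed q i).2 - b * (ed q j).2) * (ed q j).2 by rewrite /dotp; ring.
by rewrite e1 e2 !subrr !mul0r !addr0 mulr_ge0 ?(ltW b0) ?dotp_ge0.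
Qed.

Lemma on_line_edge_inj j k l : (k < l)%N -> (l < k + N)%N -> on_line j k -> on_line j l -> False.
Proof.
move=> kl lk /on_line_dir[a a0 ea] /on_line_dir[b b0 eb].
have c0 : crs (ed V k) (ed V l) = 0 by rewrite ea eb /crs /=; ring.
have := ed_parallel ccwV kl lk c0; rewrite ltNge => /negP; apply.
have -> : dotp (ed V k) (ed V l) = a * b * dotp (ed q j) (ed q j).
  by rewrite ea eb /dotp /=; ring.
by rewrite !mulr_ge0 ?(ltW a0) ?(ltW b0) ?dotp_ge0.
Qed.

Lemma on_line_turn a b k : on_line a k -> on_line b k.+1 -> 0 < crs (ed q a) (ed q b).
Proof.
move=> /on_line_dir[x x0 ex] /on_line_dir[y y0 ey].
have := turn ccwV k; rewrite ex ey.
have -> : crs (x * (ed q a).1, x * (ed q a).2) (y * (ed q b).1, y * (ed q b).2) =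
   (x * y) * crs (ed q a) (ed q b) by rewrite /crs /=; ring.
by rewrite pmulr_rgt0 // mulr_gt0.
Qed.

(** Up to a nonnegative constant, [Ln t] is a positive combination of [Ln a] and [Ln b]. On the hull
    it therefore vanishes only where [Ln a] does, and an edge on line [t] would also lie on line
    [a]. *)
Lemma on_line_between a t b k l : (a < t)%N -> (t < b)%N -> (b < a + n)%N ->
  on_line a k -> on_line b k.+1 -> on_line t l -> False.
Proof.
move=> at_ tb ba ha hb ht.
have ab := on_line_turn ha hb.
have at0 : 0 < crs (ed q a) (ed q t) by apply: (crs_ed_between ccwq _ _ _ ba ab); nlia.
have tb0 : 0 < crs (ed q t) (ed q b) by apply: (crs_ed_between ccwq _ _ _ ba ab); nlia.
have tw : 0 <= Ln t (vx V k.+1) by exact: line_vx.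
have H x : (forall j, 0 <= Ln j x) -> Ln t x = 0 -> Ln a x = 0.
  move=> hx tx; have := line_comb q dl a t b x (vx V k.+1).
  rewrite ha.2 hb.1 tx !subr0 sub0r => E.
  have h1 := mulr_ge0 (ltW tb0) (hx a); have h2 := mulr_ge0 (ltW at0) (hx b).
  have h3 := mulr_ge0 (ltW ab) tw.
  have : crs (ed q t) (ed q b) * Ln a x = 0 by lra.
  by move/eqP; rewrite mulf_eq0 gt_eqF //= => /eqP.
apply: (@on_line_inj a t l) => //; first lia.
split; apply: H.
- by move=> j; exact: line_vx.
- exact: ht.1.
- by move=> j; exact: line_vx.
- exact: ht.2.
Qed.

(** * The direction from a vertex of Q to the vertex of Pi cut out by two neighbouring lines *)

Section Cone.
Variables (a i b : nat) (y : pt R).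
Hypotheses (ai : (a < i)%N) (ib : (i <= b)%N) (ba : (b < a + n)%N).
Hypothesis ab : 0 < crs (ed q a) (ed q b).
Local Notation A := (ed q a).
Local Notation B := (ed q b).
Hypothesis yi : dl * len (ed q i) <= crs (ed q i) y.
Hypothesis yp : dl * len (ed q i.-1) <= crs (ed q i.-1) y.
Hypothesis yA : crs A y <= dl * len A.
Hypothesis yB : crs B y <= dl * len B.
Hypothesis yA1 : i = a.+1 -> crs A y = dl * len A.
Hypothesis yB1 : i = b -> crs B y = dl * len B.

(** Here [y] leads from vertex [i] of [q] to the meeting point of the lines [a] and [b]. Its
    distance from direction [t] is at least [dl], from direction [A] at most [dl]. If [t] turns left
    from [A] by at most a right angle, [y] cannot point forwards along [A]; for an obtuse turn the
    second bound has to be an equality. *)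
Lemma cone_left t : 0 < crs A (ed q t) -> dl * len (ed q t) <= crs (ed q t) y ->
  0 <= dotp A (ed q t) \/ crs A y = dl * len A -> dotp y A <= 0.
Proof.
move=> c0 ht alt; rewrite -(pmulr_lle0 _ c0).
have -> : dotp y A * crs A (ed q t) = dotp A (ed q t) * crs A y - dotp A A * crs (ed q t) y.
  by rewrite /crs /dotp; ring.
have h1 := le_trans (ler_norm _) (dotp_le A (ed q t)).
have h2 : 0 <= dl * len A by rewrite mulr_ge0 ?len_ge0 // ltW.
have h3 : dotp A (ed q t) * crs A y <= dotp A (ed q t) * (dl * len A).
  by case: alt => [h|->//]; exact: ler_wpM2l.
have h4 : dotp A (ed q t) * (dl * len A) <= len A * len (ed q t) * (dl * len A).
  exact: ler_wpM2r.
have h5 : dotp A A * (dl * len (ed q t)) <= dotp A A * crs (ed q t) y.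
  by apply: ler_wpM2l; rewrite ?dotp_ge0.
by move: h4 h5; rewrite -len2; lra.
Qed.

Lemma cone_right t : 0 < crs (ed q t) B -> dl * len (ed q t) <= crs (ed q t) y ->
  0 <= dotp (ed q t) B \/ crs B y = dl * len B -> 0 <= dotp y B.
Proof.
move=> c0 ht alt; rewrite -(pmulr_lge0 _ c0).
have -> : dotp y B * crs (ed q t) B = dotp B B * crs (ed q t) y - dotp (ed q t) B * crs B y.
  by rewrite /crs /dotp; ring.
have h1 := le_trans (ler_norm _) (dotp_le (ed q t) B).
have h2 : 0 <= dl * len B by rewrite mulr_ge0 ?len_ge0 // ltW.
have h3 : dotp (ed q t) B * crs B y <= dotp (ed q t) B * (dl * len B).
  by case: alt => [h|->//]; exact: ler_wpM2l.
have h4 : dotp (ed q t) B * (dl * len B) <= len (ed q t) * len B * (dl * len B).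
  exact: ler_wpM2r.
have h5 : dotp B B * (dl * len (ed q t)) <= dotp B B * crs (ed q t) y.
  by apply: ler_wpM2l; rewrite ?dotp_ge0.
by move: h4 h5; rewrite -len2; lra.
Qed.

(** The turns from [A] to [t] and from [t] to [B] add up to less than a half turn, so they are not
    both obtuse. *)
Lemma obtuse_split t : 0 < crs A (ed q t) -> 0 < crs (ed q t) B ->
  dotp A (ed q t) < 0 -> 0 < dotp (ed q t) B.
Proof.
move=> c1 c2 d1.
have A0 : 0 < dotp A A by apply: dotp_gt0; rewrite -vsub_eq0 ed_neq0.
have e1 : crs (ed q t) B * dotp A A = dotp A (ed q t) * crs A B - crs A (ed q t) * dotp A B.
  by rewrite /crs /dotp; ring.
have h1 := mulr_gt0 c2 A0.
have h2 : dotp A (ed q t) * crs A B < 0 by rewrite pmulr_llt0.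
have d2 : dotp A B < 0 by rewrite -(pmulr_rlt0 _ c1); lra.
rewrite -(pmulr_lgt0 _ A0).
have -> : dotp (ed q t) B * dotp A A = dotp A (ed q t) * dotp A B + crs A (ed q t) * crs A B.
  by rewrite /crs /dotp; ring.
have h3 : 0 < dotp A (ed q t) * dotp A B by rewrite nmulr_rgt0.
by have := mulr_gt0 c1 ab; lra.
Qed.

(** For [A], edge [i] is used, or edge [i - 1] if the former makes an obtuse angle with [A]. If both
    angles are obtuse, edge [i - 1] is acute to [B], which gives the bound for [B] first and that
    for [A] from it. The bound for [B] is symmetric. *)
Lemma cone_dots : dotp y A <= 0 /\ 0 <= dotp y B.
Proof.
have len_pos (t : nat) : 0 <= dl * len (ed q t) by rewrite mulr_ge0 ?len_ge0 // ltW.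
have Ai : 0 < crs A (ed q i) by apply: (crs_ed_between ccwq _ _ _ ba ab); nlia.
have pB : 0 < crs (ed q i.-1) B by apply: (crs_ed_between ccwq _ _ _ ba ab); nlia.
have yp0 : 0 <= crs (ed q i.-1) y by apply: le_trans yp.
have yi0 : 0 <= crs (ed q i) y by apply: le_trans yi.
have iB : i <> b -> 0 < crs (ed q i) B.
  by move=> /eqP nb; apply: (crs_ed_between ccwq _ _ _ ba ab); nlia.
have Ap : i <> a.+1 -> 0 < crs A (ed q i.-1).
  by move=> /eqP na; apply: (crs_ed_between ccwq _ _ _ ba ab); nlia.
split.
- have [d1|d1] := lerP 0 (dotp A (ed q i)); first by apply: (cone_left Ai yi); left.
  have [ia|ia] := eqVneq i a.+1; first by apply: (cone_left Ai yi); right; exact: yA1.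
  have {}Ap := Ap (elimN eqP ia).
  have [d2|d2] := lerP 0 (dotp A (ed q i.-1)); first by apply: (cone_left Ap yp); left.
  have d3 := obtuse_split Ap pB d2.
  have yB0 : 0 <= dotp y B by apply: (cone_right pB yp); left; exact: ltW.
  rewrite -(pmulr_lle0 _ d3).
  have -> : dotp y A * dotp (ed q i.-1) B =
     dotp y B * dotp A (ed q i.-1) - crs (ed q i.-1) y * crs A B.
    by rewrite /crs /dotp; ring.
  have h1 : dotp y B * dotp A (ed q i.-1) <= 0 by rewrite mulr_ge0_le0 // ltW.
  have h2 : 0 <= crs (ed q i.-1) y * crs A B by rewrite mulr_ge0 // ltW.
  lra.
- have [d1|d1] := lerP 0 (dotp (ed q i.-1) B); first by apply: (cone_right pB yp); left.
  have [ie|ie] := eqVneq i b; first by apply: (cone_right pB yp); right; exact: yB1.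
  have {}iB := iB (elimN eqP ie).
  have [d2|d2] := lerP 0 (dotp (ed q i) B); first by apply: (cone_right iB yi); left.
  have d3 : 0 < dotp A (ed q i).
    rewrite ltNge; apply/negP => d3; move: d3; rewrite le_eqVlt => /orP[/eqP d3|d3].
      have A0 : 0 < dotp A A by apply: dotp_gt0; rewrite -vsub_eq0 ed_neq0.
      have : dotp (ed q i) B * dotp A A = dotp A (ed q i) * dotp A B + crs A (ed q i) * crs A B.
        by rewrite /crs /dotp; ring.
      rewrite d3 mul0r add0r => E.
      have h1 : dotp (ed q i) B * dotp A A < 0 by rewrite pmulr_llt0.
      by have := mulr_gt0 Ai ab; lra.
    by have := obtuse_split Ai iB d3; lra.
  have yA0 : dotp y A <= 0 by apply: (cone_left Ai yi); left; exact: ltW.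
  rewrite -(pmulr_lge0 _ d3).
  have -> : dotp y B * dotp A (ed q i) =
     dotp y A * dotp (ed q i) B + crs (ed q i) y * crs A B.
    by rewrite /crs /dotp; ring.
  have h1 : 0 <= dotp y A * dotp (ed q i) B by rewrite mulr_le0 // ltW.
  have h2 : 0 <= crs (ed q i) y * crs A B by rewrite mulr_ge0 // ltW.
  lra.
Qed.

End Cone.

(** Seen from the common vertex of the lines [a] and [b], the hull lies in the cone spanned by the
    directions of [b] and of [a] reversed; [cone_dots] treats both. *)
Lemma nearest_vertex a i b k x : (a < i)%N -> (i <= b)%N -> (b < a + n)%N ->
  on_line a k -> on_line b k.+1 -> hull V x ->
  dotp (vsub (vx q i) (vx V k.+1)) (vsub x (vx V k.+1)) <= 0.
Proof.
move=> ai ib ba ha hb hx; have ab := on_line_turn ha hb.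
pose y := vsub (vx V k.+1) (vx q i).
have L j : Ln j (vx V k.+1) = crs (ed q j) y + (side q j (vx q i) - dl * len (ed q j)).
  by rewrite /line /y -side_diff; ring.
have Lp j : side q j (vx q i) = 0 -> dl * len (ed q j) <= crs (ed q j) y.
  by move=> e; have := line_vx j k.+1; rewrite L e; lra.
have s0 j : 0 <= side q j (vx q i) by exact: side_vx_ge0.
have si : side q i (vx q i) = 0 by rewrite /side /orient; ring.
have sp : side q i.-1 (vx q i) = 0.
  by rewrite /side prednK ?(leq_ltn_trans _ ai) // /orient; ring.
have [y1 y2] : dotp y (ed q a) <= 0 /\ 0 <= dotp y (ed q b).
  apply: (cone_dots ai ib ba ab (Lp _ si) (Lp _ sp)).
  - by have := ha.2; rewrite L; have := s0 a; lra.
  - by have := hb.1; rewrite L; have := s0 b; lra.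
  - by move=> iE; have := ha.2; rewrite L; move: sp; rewrite iE /= => ->; lra.
  - by move=> iE; have := hb.1; rewrite L; move: si; rewrite iE => ->; lra.
pose X := vsub x (vx V k.+1).
have Xa : 0 <= crs (ed q a) X by rewrite -(line_diff q dl) ha.2 subr0; move/hullE: hx.
have Xb : 0 <= crs (ed q b) X by rewrite -(line_diff q dl) hb.1 subr0; move/hullE: hx.
suff : 0 <= crs (ed q a) (ed q b) * dotp y X.
  rewrite (pmulr_rge0 _ ab) -/X; rewrite /y /dotp /vsub /=; lra.
have -> : crs (ed q a) (ed q b) * dotp y X =
   crs (ed q a) X * dotp y (ed q b) - crs (ed q b) X * dotp y (ed q a).
  by rewrite /crs /dotp; ring.
have h1 := mulr_ge0 Xa y2.
have h2 : crs (ed q b) X * dotp y (ed q a) <= 0 by rewrite mulr_ge0_le0.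
by lra.
Qed.

Lemma vx_not_hull i : ~ hull V (vx q i).
Proof.
move=> /hullE /(_ i); rewrite /line; have -> : side q i (vx q i) = 0 by rewrite /side /orient; ring.
have : 0 < dl * len (ed q i) by rewrite mulr_gt0 ?len_ed_gt0.
by lra.
Qed.

End TrueLines.

(** * Graham's scan of the shifted edges *)

Section Graham.
Context {R : realType}.
Variables (q V : seq (pt R)) (dl : R).
Notation n := (size q).
Notation N := (size V).
Notation Ln := (line q dl).
Notation onL := (on_line q V dl).
Notation E := (ed q).

Definition cst (j : nat) : R := crs (E j) (vx q j) + dl * len (E j).

Lemma lineE j x : Ln j x = crs (E j) x - cst j.
Proof. by rewrite /line /cst sideE /crs /vsub /=; ring. Qed.

(** Divided by [crs (E p) (E x)], this is the value of [Ln t] at the meeting point of the lines [p]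
    and [x]. *)
Definition det3 (p t x : nat) : R :=
  crs (E t) (E x) * cst p + crs (E p) (E t) * cst x - crs (E p) (E x) * cst t.

Lemma det3E p t x y : crs (E p) (E x) * Ln t y =
  crs (E t) (E x) * Ln p y + crs (E p) (E t) * Ln x y + det3 p t x.
Proof. by rewrite !lineE /det3 /crs; ring. Qed.

(* Line [t] is redundant between the lines [p] and [x]. *)
Definition popped (p t x : nat) : bool :=
  [&& 0 < crs (E p) (E t), 0 < crs (E t) (E x), 0 < crs (E p) (E x) & 0 <= det3 p t x].

Hypothesis ccwq : ccw_polygon q.
Hypothesis ccwV : ccw_polygon V.
Hypothesis dl0 : 0 < dl.
Hypothesis hullE : forall x, hull V x <-> forall j, 0 <= Ln j x.
Let n2 : (2 < n)%N := size_ccw ccwq.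
Let n0 : (0 < n)%N := ltn_trans (isT : (0 < 2)%N) n2.
Let N2 : (2 < N)%N := size_ccw ccwV.
Let N0 : (0 < N)%N := ltn_trans (isT : (0 < 2)%N) N2.

(** By [det3E], a hull point on line [t] is also on line [p], so an edge on line [t] would lie on
    two lines. *)
Lemma popped_not_true p t x k : (p < t)%N -> (t < p + n)%N -> popped p t x -> ~ onL t k.
Proof.
move=> pt_ tp /and4P[pt0 tx0 px0 d0] [h1 h2].
have H y : (forall j, 0 <= Ln j y) -> Ln t y = 0 -> Ln p y = 0.
  move=> hy ty; have := det3E p t x y; rewrite ty mulr0 => e.
  have m1 := mulr_ge0 (ltW tx0) (hy p); have m2 := mulr_ge0 (ltW pt0) (hy x).
  have /eqP : crs (E t) (E x) * Ln p y = 0 by lra.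
  by rewrite mulf_eq0 gt_eqF //= => /eqP.
apply: (@on_line_inj R q V dl ccwq ccwV dl0 hullE p t k) => //.
by split; apply: H => // j; apply: line_vx.
Qed.

Lemma exists_max (r : nat -> R) (lo hi : nat) : (lo <= hi)%N ->
  exists2 m, (lo <= m <= hi)%N & forall x, (lo <= x <= hi)%N -> r x <= r m.
Proof.
elim: hi => [|hi IH] lh; first by exists lo; [lia|move=> x xh; have -> : x = lo by lia].
have [e|ne] := eqVneq lo hi.+1.
  by exists lo; [lia|move=> x xh; have -> : x = lo by lia].
have [m mlh mP] := IH ltac:(lia).
have [h|h] := lerP (r hi.+1) (r m).
  exists m => [|x xh]; first lia.
  by have [->//|nx] := eqVneq x hi.+1; apply: mP; lia.
exists hi.+1 => [|x xh]; first lia.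
have [->//|nx] := eqVneq x hi.+1; apply: le_trans (ltW h); apply: mP; lia.
Qed.

(** The slack [f] of the lines at the vertex between the lines of [p] and [p'] is 0 at both ends and
    nonnegative between them. Where [f / g] is maximal, negative [det3] would contradict the linear
    relation satisfied by [g], so that line is redundant. *)
Lemma run_has_popped (st : nat -> nat) (p p' k : nat) : (p.+1 < p')%N ->
  (forall x y, (p <= x)%N -> (x < y)%N -> (y <= p')%N -> (st x < st y)%N) ->
  (st p' < st p + n)%N -> onL (st p) k -> onL (st p') k.+1 ->
  exists2 m, (p <= m)%N /\ (m.+2 <= p')%N & popped (st m) (st m.+1) (st m.+2).
Proof.
move=> pp' inc wid hp hp'.
have ab := on_line_turn ccwq ccwV dl0 hullE hp hp'.
have C x y : (p <= x)%N -> (x < y)%N -> (y <= p')%N -> 0 < crs (E (st x)) (E (st y)).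
  move=> px xy yp; apply: (crs_ed_between ccwq _ (inc _ _ px xy yp) _ wid ab).
    by have [->//|npx] := eqVneq x p; apply/ltnW/inc; lia.
  by have [->//|npy] := eqVneq y p'; apply/ltnW/inc; lia.
pose f x := Ln (st x) (vx V k.+1).
have f0 x : 0 <= f x by exact: line_vx.
(* A linear function of the direction that is positive on the run; it satisfies the relation of
   [det3E] without the constant term. *)
pose g x := crs (E (st p)) (E (st x)) + crs (E (st x)) (E (st p')).
have g0 x : (p <= x <= p')%N -> 0 < g x.
  move=> xp; rewrite /g; have [->|npx] := eqVneq x p; first by rewrite crs_self add0r C; lia.
  have [->|nxp] := eqVneq x p'; first by rewrite crs_self addr0 C; lia.
  by rewrite addr_gt0 // C; lia.
have [m mp mP] := @exists_max (fun x => f x / g x) p.+1 p'.-1 ltac:(lia).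
exists m.-1; first by split; lia.
have mE : m.-1.+1 = m by lia.
rewrite mE -{2}mE.
have mE2 : m.-1.+2 = m.+1 by lia.
rewrite -mE mE2 mE.
apply/and4P; split; try by apply: C; lia.
rewrite leNgt; apply/negP => d0.
have gm : 0 < g m by apply: g0; lia.
have mx x : (p <= x <= p')%N -> f x * g m <= f m * g x.
  move=> xp; have gx := g0 x xp.
  have [->|npx] := eqVneq x p; first by rewrite /f hp.2 mul0r mulr_ge0 ?f0 // ltW // g0; lia.
  have [->|nxp] := eqVneq x p'; first by rewrite /f hp'.1 mul0r mulr_ge0 ?f0 // ltW // g0; lia.
  have : f x / g x <= f m / g m by apply: mP; lia.
  by rewrite ler_pdivrMr // mulrAC ler_pdivlMr.
have c1 : 0 < crs (E (st m.-1)) (E (st m)) by apply: C; lia.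
have c2 : 0 < crs (E (st m)) (E (st m.+1)) by apply: C; lia.
have e1 := det3E (st m.-1) (st m) (st m.+1) (vx V k.+1).
have e2 : crs (E (st m.-1)) (E (st m.+1)) * g m =
   crs (E (st m)) (E (st m.+1)) * g m.-1 + crs (E (st m.-1)) (E (st m)) * g m.+1.
  by rewrite /g /crs; ring.
have h1 := ler_wpM2l (ltW c2) (mx m.-1 ltac:(lia)).
have h2 := ler_wpM2l (ltW c1) (mx m.+1 ltac:(lia)).
have h3 : det3 (st m.-1) (st m) (st m.+1) * g m < 0 by rewrite pmulr_llt0.
have h4 : (crs (E (st m.-1)) (E (st m.+1)) * f m) * g m =
  f m * (crs (E (st m.-1)) (E (st m.+1)) * g m) by ring.
move: h4; rewrite e2 /f e1 -/(f m) -/(f m.-1) -/(f m.+1) => h4.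
by move: h4 h1 h2 h3; lra.
Qed.

(** * The stack of the scan and the edges of Pi *)

Section Stack.
Variables (b f : nat) (st : nat -> nat) (top : nat).
Hypothesis bf : onL b f.

Definition stack_ok (j : nat) : Prop :=
  [/\ st 0 = b, (forall x y, (x < y)%N -> (y <= top)%N -> (st x < st y)%N),
      (st top < j)%N,
      (forall t k, (b <= t < j)%N -> onL t k -> exists2 x, (x <= top)%N & st x = t) &
      (forall m, (m.+2 <= top)%N -> ~~ popped (st m) (st m.+1) (st m.+2))].

Hypothesis ok : stack_ok (b + n).+1.

(** Line [b + n] is line [b] again; it carries edge [f], so it is still on the stack, and no larger
    index has been pushed. *)
Lemma stack_top : st top = (b + n)%N.
Proof.
case: ok => st0 inc topb tru _.
have bfn : onL (b + n) f by rewrite /on_line !line_addN.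
have [x xt xE] := tru (b + n)%N f ltac:(lia) bfn.
have [<- //|nx] := eqVneq x top.
by have := inc x top ltac:(lia) (leqnn _); lia.
Qed.

(** The line of the next edge is somewhere higher on the stack. Were it not the next entry,
    [run_has_popped] would find a redundant triple. *)
Lemma stack_true x : (x <= top)%N -> onL (st x) (f + x).
Proof.
case: (ok) => st0 inc topb tru np.
elim: x => [|x IH] xt; first by rewrite st0 addn0.
have hx := IH (ltnW xt).
have stx : (st x < b + n)%N by rewrite -stack_top; apply: inc.
have [j0 hj0] := on_line_ex ccwq ccwV hullE (f + x).+1.
have [b' ab' [e0 eS]] := exists_lift ccwq (st x) j0.
have lE y : Ln j0 y = Ln b' y.
  have sE : ed q j0 = ed q b' by rewrite /ed e0; have := eS 1%N; rewrite !addn1 => ->.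
  by rewrite /line !sideE sE e0.
have hb' : onL b' (f + x).+1 by case: hj0; rewrite !lE.
have nb : b' != st x.
  apply/eqP => e; rewrite e in hb'.
  by apply: (@on_line_edge_inj R q V dl ccwq ccwV dl0 hullE (st x) (f + x) (f + x).+1) => //; lia.
(* Otherwise the line [b + n], which carries an edge, would lie between the lines of two consecutive
   edges. *)
have b'n : (b' <= b + n)%N.
  rewrite leqNgt; apply/negP => h.
  have bfn : onL (b + n) f by rewrite /on_line !line_addN.
  apply: (@on_line_between R q V dl ccwq ccwV dl0 hullE (st x) (b + n) b' (f + x) f) => //.
  by case/andP: ab'.
have b'b : (b <= b')%N.
  apply: leq_trans (proj1 (andP ab')); rewrite -st0.
  by case: (x) xt => // x' xt; apply/ltnW/inc => //; exact: ltnW.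
have [x' x't x'E] := tru b' _ ltac:(lia) hb'.
have xx' : (x < x')%N.
  rewrite ltnNge; apply/negP => h.
  have [e|ne] := eqVneq x' x; first by rewrite -x'E e eqxx in nb.
  have : (st x' < st x)%N by apply: inc; lia.
  by lia.
rewrite addnS.
have [<-|ne] := eqVneq x' x.+1; first by rewrite x'E.
have [|||||m [m1 m2] hm] := @run_has_popped st x x' (f + x).
- by rewrite ltn_neqAle eq_sym ne.
- by move=> y z _ yz zx; apply: inc => //; exact: leq_trans x't.
- by rewrite x'E; case/andP: ab'.
- exact: hx.
- by rewrite x'E.
by move: hm; rewrite (negPf (np m (leq_trans m2 x't))).
Qed.

(** After [N] edges the walk is back at edge [f], and above [b] the only stack entry for this edge
    is [b + n], the top. *)
Lemma stack_size : top = N.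
Proof.
case: (ok) => st0 inc topb tru np.
have ht := stack_true (leqnn top).
have hN y : (N <= y)%N -> (y <= top)%N -> st N = (b + n)%N.
  move=> Ny yt; have hN := stack_true (leq_trans Ny yt).
  have {}hN : onL (st N) f by move: hN; rewrite /on_line -addSn !vx_addN.
  have bN : (b < st N)%N by rewrite -st0; apply: inc => //; exact: leq_trans yt.
  apply/eqP; apply: contraT => ne.
  have stN : (st N <= b + n)%N.
    rewrite -stack_top; have [->//|nN] := eqVneq N top; apply/ltnW/inc => //.
    by move: nN; lia.
  exfalso; apply: (@on_line_inj R q V dl ccwq ccwV dl0 hullE b (st N) f) => //.
  by rewrite ltn_neqAle ne.
have [Nt|tN] := leqP N top.
  have := hN top Nt (leqnn _) => stN.
  have [//|ne] := eqVneq top N.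
  have := inc N top ltac:(lia) (leqnn _); rewrite stN stack_top; lia.
exfalso.
have t0 : (0 < top)%N.
  by rewrite lt0n; apply/eqP => e; have := stack_top; rewrite e st0; lia.
rewrite stack_top in ht.
have {}ht : onL b (f + top) by move: ht; rewrite /on_line !line_addN.
by apply: (@on_line_edge_inj R q V dl ccwq ccwV dl0 hullE b f (f + top)) => //; lia.
Qed.

End Stack.

(* The vertices of Pi, listed by the vertices [b+1, ..., b+n] of Q to which they
   are nearest. *)
Definition nearest_chain (b f : nat) (kap : nat -> nat) : Prop :=
  [/\ kap b.+1 = f.+1, kap (b + n)%N = (f + N)%N,
      forall j, (b < j < b + n)%N -> (kap j <= kap j.+1 <= (kap j).+1)%N &
      forall j x, (b < j <= b + n)%N -> hull V x ->
        dotp (vsub (vx q j) (vx V (kap j))) (vsub x (vx V (kap j))) <= 0].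

Lemma chain_of_stack (b f : nat) (st : nat -> nat) (top : nat) (ptr : nat -> nat) :
  onL b f -> stack_ok b st top (b + n).+1 ->
  (forall j, (b < j <= b + n)%N -> (ptr j < top)%N /\ (st (ptr j) < j <= st (ptr j).+1)%N) ->
  nearest_chain b f (fun j => (f + ptr j).+1) /\
  forall j, (b < j <= b + n)%N ->
    onL (st (ptr j)) (f + ptr j) /\ onL (st (ptr j).+1) (f + ptr j).+1.
Proof.
move=> bf ok ptrP; case: (ok) => st0 inc topb _ _.
have topE := stack_top bf ok; have tru := stack_true bf ok; have tN := stack_size bf ok.
have leS x y : (st x < st y)%N -> (y <= top)%N -> (x <= top)%N -> (x < y)%N.
  move=> h yt xt; rewrite ltnNge; apply/negP => yx.
  have [e|ne] := eqVneq y x; first by rewrite e ltnn in h.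
  by have := inc y x ltac:(lia) xt; lia.
have T j : (b < j <= b + n)%N ->
    onL (st (ptr j)) (f + ptr j) /\ onL (st (ptr j).+1) (f + ptr j).+1.
  move=> jb; have [pt_ _] := ptrP j jb; split; first by apply: tru; exact: ltnW.
  by rewrite -addnS; apply: tru.
split=> //; split.
- have [pt_ /andP[p1 p2]] := ptrP b.+1 ltac:(lia).
  suff -> : ptr b.+1 = 0%N by rewrite addn0.
  apply/eqP; rewrite -leqn0 leqNgt; apply/negP => p0.
  by have := inc 0%N _ p0 (ltnW pt_); rewrite st0; lia.
- have [pt_ /andP[p1 p2]] := ptrP (b + n)%N ltac:(lia).
  have : (ptr (b + n)%N).+1 = top.
    apply/eqP; rewrite eqn_leq pt_ leqNgt; apply/negP => h.
    by have := inc _ _ h (leqnn _); rewrite topE; lia.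
  by rewrite tN; lia.
- move=> j jb; have [pt_ /andP[p1 p2]] := ptrP j ltac:(lia).
  have [pt' /andP[p1' p2']] := ptrP j.+1 ltac:(lia).
  have h1 : (ptr j < (ptr j.+1).+1)%N.
    by apply: leS; [lia|exact: pt'|exact: ltnW].
  have h2 : (ptr j.+1 <= (ptr j).+1)%N.
    rewrite leqNgt; apply/negP => h.
    by have := inc _ _ h (ltnW pt'); lia.
  by rewrite !ltnS !leq_add2l; move: h1; rewrite ltnS => ->; rewrite -addnS leq_add2l.
- move=> j x jb hx; have [pt_ /andP[p1 p2]] := ptrP j jb; have [h1 h2] := T j jb.
  apply: (nearest_vertex ccwq ccwV dl0 hullE p1 p2 _ h1 h2 hx).
  have := tru _ pt_.
  (* A pair of neighbours spanning [n] indices would be [b] and [b + n], making the height 1, but it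
     is [N], which exceeds 2. *)
  rewrite ltnNge; move=> _; apply/negP => h.
  have a1 : (b <= st (ptr j))%N.
    by rewrite -st0; case: (ptr j) pt_ => // y yt; apply/ltnW/inc => //; exact: ltnW.
  have a2 : (st (ptr j).+1 <= b + n)%N.
    rewrite -topE; have [->//|nt] := eqVneq (ptr j).+1 top; apply/ltnW/inc => //.
    by rewrite ltn_neqAle nt.
  have e1 : st (ptr j) = b by lia.
  have e2 : st (ptr j).+1 = (b + n)%N by lia.
  have pN : (ptr j).+1 = top.
    apply/eqP; rewrite eqn_leq pt_ leqNgt; apply/negP => h'.
    by have := inc _ _ h' (leqnn _); rewrite topE; lia.
  have p0 : ptr j = 0%N.
    apply/eqP; rewrite -leqn0 leqNgt; apply/negP => h'.
    by have := inc 0%N _ h' (ltnW pt_); rewrite st0; lia.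
  by move: pN; rewrite p0 tN; lia.
Qed.

Lemma line_meet a b k : onL a k -> onL b k.+1 ->
  vx V k.+1 = ((cst a * (E b).1 - cst b * (E a).1) / crs (E a) (E b),
               (cst a * (E b).2 - cst b * (E a).2) / crs (E a) (E b)).
Proof.
move=> ha hb; have := on_line_turn ccwq ccwV dl0 hullE ha hb.
have := ha.2; have := hb.1; rewrite !lineE => h1 h2 c0.
have cn : crs (E a) (E b) != 0 by rewrite gt_eqF.
rewrite [LHS]surjective_pairing; congr pair; apply: (mulfI cn); rewrite mulrCA divff // mulr1.
  have e1 : (E b).1 * (crs (E a) (vx V k.+1) - cst a) = 0 by rewrite h2 mulr0.
  have e2 : (E a).1 * (crs (E b) (vx V k.+1) - cst b) = 0 by rewrite h1 mulr0.
  by move: e1 e2; rewrite /crs; lra.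
have e1 : (E b).2 * (crs (E a) (vx V k.+1) - cst a) = 0 by rewrite h2 mulr0.
have e2 : (E a).2 * (crs (E b) (vx V k.+1) - cst b) = 0 by rewrite h1 mulr0.
by move: e1 e2; rewrite /crs; lra.
Qed.

End Graham.

(** * Horizons *)

Section Lifts.
Context {R : realType}.
Variable V : seq (pt R).
Notation N := (size V).
Notation g := (walk V).
Hypothesis ccw : ccw_polygon V.
Let N2 : (2 < N)%N := size_ccw ccw.
Let NR : 0 < N%:R :> R.
Proof. by rewrite ltr0n; lia. Qed.

Lemma walk_addmN (m : nat) (a : R) : 0 <= a -> g (a + (m * N)%:R) = g a.
Proof.
move=> a0; elim: m => [|m IH]; first by rewrite addr0.
by rewrite mulSn addnC natrD addrA walk_addN ?IH // addr_ge0.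
Qed.

Lemma reduce (x : R) : 0 <= x ->
  exists (m : nat) (x0 : R), 0 <= x0 < N%:R /\ x = x0 + (m * N)%:R.
Proof.
move=> x0; have xN : 0 <= x / N%:R by rewrite divr_ge0 // ltW.
have /andP[h1 h2] := truncn_itv xN.
exists (Num.truncn (x / N%:R)), (x - (Num.truncn (x / N%:R) * N)%:R).
rewrite natrM subrK; split=> //.
rewrite subr_ge0 -ler_pdivlMr // h1 /= ltrBlDr.
by rewrite -[X in X + _]mul1r -mulrDl addrC natr1 -ltr_pdivrMr.
Qed.

Lemma walk_lift_inj (y b b' : R) : 0 <= y -> y < b <= y + N%:R ->
  y < b' <= y + N%:R -> g b = g b' -> b = b'.
Proof.
move=> y0 /andP[b1 b2] /andP[c1 c2] e.
have [h|h|//] := ltgtP b b'; exfalso.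
  by apply: (walk_inj ccw _ h _ e); lra.
by apply: (walk_inj ccw _ h _ (esym e)); lra.
Qed.

Lemma lift_above (x : R) (z : pt R) : 0 <= x -> boundary (hull V) z ->
  exists2 t : R, x < t <= x + N%:R & z = g t.
Proof.
move=> x0 /(boundary_walkP ccw)[a /andP[a0 aN] ->].
have [m [x1 [/andP[x10 x1N] xE]]] := reduce x0.
have [h|h] := ltrP x1 a.
  by exists (a + (m * N)%:R); [rewrite xE; apply/andP; split; lra|rewrite walk_addmN].
exists (a + N%:R + (m * N)%:R); first by rewrite xE; apply/andP; split; lra.
by rewrite walk_addmN ?walk_addN //; lra.
Qed.

(** Arcs are defined with a start parameter below [N]; shifting by whole turns permits any lift of
    the start, so that positions are compared as reals. *)
Lemma shift_arc (x x' : R) : 0 <= x -> x <= x' -> exists (m : nat) (a b : R),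
  [/\ 0 <= a < N%:R, b - a = x' - x, x = a + (m * N)%:R, g a = g x & g b = g x'].
Proof.
move=> x0 xx'; have [m [a [/andP[a0 aN] xE]]] := reduce x0.
exists m, a, (a + (x' - x)); split=> //; first by rewrite a0.
- by rewrite addrC addKr.
- by rewrite xE walk_addmN.
- by rewrite -[LHS](walk_addmN m); [congr g; rewrite xE; ring|lra].
Qed.

Lemma open_arcP (x x' : R) (z : pt R) : 0 <= x -> x < x' <= x + N%:R ->
  open_arc V (g x) (g x') z <-> exists2 t : R, x < t < x' & z = g t.
Proof.
move=> x0 /andP[xx' x'N]; have [m [a [b [aN ba xE ga gb]]]] := shift_arc x0 (ltW xx').
have /andP[a0 a1] := aN.
split=> [[a' [b' [t [/andP[a'0 a'N] /andP[ab' b'N] ga' gb' [/andP[at_ tb] ->]]]]]|[t /andP[xt tx'] ->]].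
  have aa' : a = a'.
    have [h|h|//] := ltgtP a a'; exfalso.
      by apply: (walk_inj ccw a0 h _ _); [lra|rewrite ga ga'].
    by apply: (walk_inj ccw a'0 h _ _); [lra|rewrite ga ga'].
  have bb' : b = b'.
    apply: (@walk_lift_inj a) => //; [by apply/andP; split; lra|by rewrite aa' ab' b'N|].
    by rewrite gb gb'.
  exists (t + (m * N)%:R); first by apply/andP; split; lra.
  by rewrite walk_addmN //; lra.
exists a, b, (a + (t - x)); split; [exact: aN|by apply/andP; split; lra|exact: ga|exact: gb|].
split; first by apply/andP; split; lra.
by rewrite -[RHS](walk_addmN m); [congr g; lra|lra].
Qed.

Lemma closed_arcP (x x' : R) (z : pt R) : 0 <= x -> x <= x' < x + N%:R ->
  closed_arc V (g x) (g x') z <-> exists2 t : R, x <= t <= x' & z = g t.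
Proof.
move=> x0 /andP[xx' x'N]; have [m [a [b [aN ba xE ga gb]]]] := shift_arc x0 xx'.
have /andP[a0 a1] := aN.
split=> [[a' [b' [t [/andP[a'0 a'N] /andP[ab' b'N] ga' gb' [/andP[at_ tb] ->]]]]]|[t /andP[xt tx'] ->]].
  have aa' : a = a'.
    have [h|h|//] := ltgtP a a'; exfalso.
      by apply: (walk_inj ccw a0 h _ _); [lra|rewrite ga ga'].
    by apply: (walk_inj ccw a'0 h _ _); [lra|rewrite ga ga'].
  have bb' : b = b'.
    have [h|h|//] := ltgtP b b'; exfalso.
      by apply: (walk_inj ccw _ h _ _); [lra|lra|rewrite gb gb'].
    by apply: (walk_inj ccw _ h _ _); [lra|lra|rewrite gb gb'].
  exists (t + (m * N)%:R); first by apply/andP; split; lra.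
  by rewrite walk_addmN //; lra.
exists a, b, (a + (t - x)); split; [exact: aN|by apply/andP; split; lra|exact: ga|exact: gb|].
split; first by apply/andP; split; lra.
by rewrite -[RHS](walk_addmN m); [congr g; lra|lra].
Qed.

End Lifts.

(** * Goodness and horizons on the boundary cut open at the initial vertex *)

Section Region.
Context {R : realType}.
Variables (q V : seq (pt R)) (rho : R) (b f : nat) (kap : nat -> nat) (a : R).
Notation n := (size q).
Notation N := (size V).
Notation g := (walk V).
Hypothesis ccwq : ccw_polygon q.
Hypothesis ccwV : ccw_polygon V.
Hypothesis rho0 : 0 <= rho.
Hypothesis out : forall i, ~ hull V (vx q i).
Hypothesis chain : nearest_chain q V b f kap.
Hypothesis close : forall i z, (forall x, hull V x -> dotp (vsub (vx q i) z) (vsub x z) <= 0) ->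
  dist2 z (vx q i) <= rho ^+ 2.
Hypothesis fa : f%:R <= a < f%:R + 1.
Let n2 : (2 < n)%N := size_ccw ccwq.
Let n0 : (0 < n)%N := ltn_trans (isT : (0 < 2)%N) n2.
Let N2 : (2 < N)%N := size_ccw ccwV.
Let a0 : 0 <= a.
Proof. by have /andP[h _] := fa; apply: le_trans h. Qed.

(** The disk stands for the eyelet, because a segment between points of the hull never leaves it. *)
Definition hits (j : nat) (u u' : pt R) : Prop :=
  exists2 p, segment u u' p & dist2 p (vx q j) <= rho ^+ 2.

Definition rank j : bool := (b < j <= b + n)%N.

Lemma chain_near j x : rank j -> hull V x ->
  dotp (vsub (vx q j) (vx V (kap j))) (vsub x (vx V (kap j))) <= 0.
Proof. by case: chain => _ _ _; apply. Qed.

Lemma chain_close j : rank j -> dist2 (vx V (kap j)) (vx q j) <= rho ^+ 2.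
Proof. by move=> rj; apply: close => x; exact: chain_near. Qed.

Lemma rank_ex i : exists2 j, rank j & vx q i = vx q j.
Proof.
have [j /andP[h1 h2] [e _]] := exists_lift ccwq b.+1 i.
by exists j => //; rewrite /rank h1 -ltnS -addSn.
Qed.

Lemma visible_portionE j i : vx q j = nth (0, 0) q i ->
  visible_portion q V rho i = [set x | [/\ disk rho (vx q j) x, hull V x,
     boundary (hull V) x & sees V (vx q j) x]].
Proof.
by move=> e; apply/seteqP; split=> x /=;
  [move=> [[h1 h2] h3 h4]|move=> [h1 h2 h3 h4]];
  [split=> //; rewrite ?e //; rewrite /sees e|split; rewrite -?e //; split; rewrite -?e].
Qed.

Lemma spot_arc j : rank j -> exists B F : R, [/\ 0 <= B, B <= (kap j + N)%:R <= F, F < B + N%:R &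
  [set x | [/\ disk rho (vx q j) x, hull V x, boundary (hull V) x & sees V (vx q j) x]] =
  [set x | exists2 t, B <= t <= F & x = g t]].
Proof.
move=> rj; have e : vx V (kap j + N) = vx V (kap j) by rewrite vx_addN.
have [||B [F [/andP[h1 h2] /andP[h3 h4] h5]]] :=
  @visible_arc R V (vx q j) rho ccwV (kap j + N) (leq_addl _ _) rho0 (@out j).
- by move=> x; rewrite e; exact: chain_near.
- by rewrite e; exact: chain_close.
exists B, F; split=> //; last by rewrite h2 h3.
by apply/ltW; apply: le_lt_trans h1; rewrite natrD addrK ler0n.
Qed.

Lemma disk_dist2 s (c x : pt R) : 0 <= s -> disk s c x <-> dist2 x c <= s ^+ 2.
Proof. by move=> s0; rewrite /disk /= edist_le. Qed.

Lemma hits_l j u u' : dist2 u (vx q j) <= rho ^+ 2 -> hits j u u'.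
Proof. by exists u => //; exact: segment_l. Qed.

Lemma hits_r j u u' : dist2 u' (vx q j) <= rho ^+ 2 -> hits j u u'.
Proof. by exists u' => //; exact: segment_r. Qed.

Lemma hitsE j i u u' : hull V u -> hull V u' -> vx q j = nth (0, 0) q i ->
  hits j u u' <-> segment u u' `&` eyelet q V rho i !=set0.
Proof.
move=> hu hu' e; split=> [[p hp dp]|[p [hp [dp _]]]].
  exists p; split=> //; split; last exact: hull_segment hp.
  by rewrite -e; apply/disk_dist2.
by exists p => //; rewrite e; apply/disk_dist2.
Qed.

(* Replacing the spot of each eyelet by the point of Pi nearest to the vertex
   does not change which segments are good: the arc between the two points lies
   in the eyelet. *)
Lemma goodP (x x' : R) : 0 <= x -> x < x' <= x + N%:R ->
  good q V rho (g x) (g x') <->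
  forall j t, rank j -> x < t < x' -> g t = vx V (kap j) -> hits j (g x) (g x').
Proof.
move=> x0 /andP[xx' x'N]; have x'0 : 0 <= x' by lra.
have hx := walk_hull ccwV x0; have hx' := walk_hull ccwV x'0.
have qsmall j : (j %% n < n)%N by rewrite ltn_pmod.
split=> [gd j t rj /andP[xt tx'] gt|H i v iN [w [bv bw visE]] arc].
  have ji : vx q j = nth (0, 0) q (j %% n) by [].
  have [B [F [B0 /andP[BK KF] FB visE]]] := spot_arc rj.
  have K0 : 0 <= (kap j + N)%:R :> R by rewrite ler0n.
  have t0 : 0 <= t by lra.
  have [m [t1 [/andP[t10 t1N] tE]]] := reduce ccwV t0.
  have [m' [k1 [/andP[k10 k1N] kE]]] := reduce ccwV K0.
  have k1t1 : k1 = t1.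
    have e : g k1 = g t1.
      rewrite -(walk_addmN V m' k10) -kE walk_nat vx_addN -gt tE walk_addmN //.
    have [h|h|//] := ltgtP k1 t1; exfalso.
      by apply: (walk_inj ccwV k10 h _ e); lra.
    by apply: (walk_inj ccwV t10 h _ (esym e)); lra.
  (* Shifting [x] by [m'] turns and the arc [[B, F]] by [m] turns makes the lifts of the nearest
     point coincide. *)
  have [X XE] : exists X : R, X = x + (m' * N)%:R by eexists.
  have [D DE] : exists D : R, D = (m * N)%:R by eexists.
  have D0 : 0 <= D by rewrite DE ler0n.
  have M0 : 0 <= (m' * N)%:R :> R by rewrite ler0n.
  have mem s : B <= s <= F -> dist2 (g s) (vx q j) <= rho ^+ 2.
    move=> hs; have : [set z | exists2 t, B <= t <= F & z = g t] (g s) by exists s.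
    by rewrite -visE => -[/(disk_dist2 _ _ rho0) h _ _ _]; exact: h.
  have spotB : is_spot q V rho (j %% n) (g B).
    exists (g F); split; [exact: boundary_walk| |].
      by apply: boundary_walk => //; apply: le_trans KF.
    have BF : B <= F < B + N%:R by rewrite FB andbT (le_trans BK).
    by rewrite (visible_portionE ji) visE; apply/seteqP; split=> z /= hz;
      apply/(closed_arcP ccwV _ B0 BF).
  clear visE.
  rewrite -k1t1 -DE in tE.
  (* Either the spot is passed after [g x], or [g x] lies between the spot and the nearest point and
     hence in the eyelet. *)
  have [h|h] := ltrP X (B + D); last first.
    apply: hits_l; have -> : g x = g (X - D).
      rewrite -[RHS](walk_addmN V m); last by lra.
      by rewrite -DE subrK XE walk_addmN.
    by apply: mem; apply/andP; split; lra.
  have X0 : 0 <= X by rewrite XE addr_ge0.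
  apply/(hitsE hx hx' ji)/(gd _ (g B)) => //.
  have gX : g x = g X by rewrite XE walk_addmN.
  have gX' : g x' = g (x' + (m' * N)%:R) by rewrite walk_addmN.
  have XX' : X < x' + (m' * N)%:R <= X + N%:R by apply/andP; split; lra.
  rewrite gX gX'; apply/(open_arcP ccwV _ X0 XX').
  exists (B + D); last by rewrite DE walk_addmN.
  by apply/andP; split=> //; lra.
have [j rj e] := rank_ex i.
rewrite vx_small // in e.
apply/(hitsE hx hx' (esym e)).
have xx'N : x < x' <= x + N%:R by rewrite xx' x'N.
have [t /andP[xt tx'] vE] := (open_arcP ccwV v x0 xx'N).1 arc.
have arc_disk z : closed_arc V v w z -> dist2 z (vx q j) <= rho ^+ 2.
  by rewrite -visE (visible_portionE (esym e)) => -[/disk_dist2 h _ _ _]; exact: h.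
have : closed_arc V v w (vx V (kap j)).
  rewrite -visE (visible_portionE (esym e)).
  have [B [F [B0 hBF FB ->]]] := spot_arc rj.
  by exists (kap j + N)%:R => //; rewrite walk_nat vx_addN.
move=> [a' [b' [t1 [a'N ab' ga' gb' [/andP[at1 tb1] zE]]]]].
have /andP[a'0 a'1] := a'N.
have t0 : 0 <= t by lra.
have sh (s : R) : 0 <= s -> g (t + s) = g (a' + s).
  move=> s0; have [m [t2 [/andP[t20 t2N] tE]]] := reduce ccwV t0.
  have e2 : t2 = a'.
    have e3 : g t2 = g a' by rewrite ga' vE tE walk_addmN.
    have [h|h|//] := ltgtP t2 a'; exfalso.
      by apply: (walk_inj ccwV t20 h _ e3); lra.
    by apply: (walk_inj ccwV a'0 h _ (esym e3)); lra.
  by rewrite tE e2 addrAC walk_addmN // addr_ge0.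
(* Either the nearest point is also passed before [g x'], or [g x'] lies between the spot and the
   nearest point and hence in the eyelet. *)
have [h|h] := ltrP (t + (t1 - a')) x'.
  apply: (H j (t + (t1 - a'))) => //; first by apply/andP; split; lra.
  by rewrite sh ?subr_ge0 // addrC subrK.
apply: hits_r; apply: arc_disk; exists a', b', (a' + (x' - t)); split=> //.
split; first by apply/andP; split; lra.
by rewrite -sh; [congr g; ring|lra].
Qed.

Lemma disk_lerp (c x y : pt R) (l : R) : 0 <= l <= 1 -> dist2 x c <= rho ^+ 2 ->
  dist2 y c <= rho ^+ 2 -> dist2 (lerp l x y) c <= rho ^+ 2.
Proof.
move=> /andP[l0 l1] hx hy.
have -> : dist2 (lerp l x y) c = (1 - l) * dist2 x c + l * dist2 y c - l * (1 - l) * dist2 x y.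
  by rewrite /dist2 /dotp /vsub /lerp /=; ring.
have h1 : (1 - l) * dist2 x c <= (1 - l) * rho ^+ 2 by rewrite ler_wpM2l // subr_ge0.
have h2 : l * dist2 y c <= l * rho ^+ 2 by rewrite ler_wpM2l.
have h3 : 0 <= l * (1 - l) * dist2 x y by rewrite !mulr_ge0 ?dotp_ge0 // subr_ge0.
by lra.
Qed.

Lemma hits_mono j (x t y x' : R) : rank j -> 0 <= x -> x <= t -> t <= y -> y <= x' ->
  x' <= x + N%:R -> g t = vx V (kap j) -> hits j (g x) (g x') -> hits j (g x) (g y).
Proof.
move=> rj x0 xt ty yx' x'N gt [p hp dp].
have [z [z1 z2]] := walk_crossing ccwV x0 xt ty yx' x'N hp.
exists z => //; case: z2 => l [l01 ->].
by apply: disk_lerp => //; rewrite gt; exact: chain_close.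
Qed.

Notation e := (b + n).+1.

(* The stops: the initial vertex of the region at the indices [b] and [b+n+1], and in
   between the points of Pi nearest to the vertices of Q. *)
Definition pos (j : nat) : R :=
  if (j <= b)%N then a else if (j <= b + n)%N then (kap j)%:R else a + N%:R.

Lemma pos_b : pos b = a. Proof. by rewrite /pos leqnn. Qed.

Lemma pos_rank j : rank j -> pos j = (kap j)%:R.
Proof. by rewrite /rank /pos => /andP[bj ->]; rewrite leqNgt bj. Qed.

Lemma pos_e : pos e = a + N%:R.
Proof. by rewrite /pos ltnn leqNgt ltnS leq_addr. Qed.

Lemma walk_pos j : rank j -> g (pos j) = vx V (kap j).
Proof. by move=> rj; rewrite pos_rank // walk_nat. Qed.

(** No stretch between consecutive stops goes around a corner, so the walk is affine on it. *)
Lemma pos_step j : (b <= j < e)%N -> exists k : nat,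
  [/\ k%:R <= pos j, pos j <= pos j.+1 & pos j.+1 <= k%:R + 1].
Proof.
have /andP[fa1 fa2] := fa; case: chain => k1 kn ks _ jb.
have [jE|nb] := eqVneq j b.
  exists f; rewrite jE pos_b pos_rank ?k1; last by rewrite /rank; nlia.
  by split=> //; rewrite -natr1 // ltW.
have [jE|ne] := eqVneq j (b + n)%N.
  exists (f + N)%N; rewrite jE pos_e pos_rank ?kn ?natrD; last by rewrite /rank; nlia.
  by split=> //; lra.
have := ks j ltac:(nlia).
rewrite !pos_rank; try by rewrite /rank; nlia.
by move=> /andP[s1 s2]; exists (kap j); split; rewrite ?natr1 ?ler_nat.
Qed.

Lemma pos_mono i j : (b <= i)%N -> (i <= j)%N -> (j <= e)%N -> pos i <= pos j.
Proof.
move=> bi; elim: j => [|j IH] ij je; first by have -> : i = 0%N by nlia.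
have [->//|ne] := eqVneq i j.+1.
have [k [_ h _]] := @pos_step j ltac:(nlia).
by apply: le_trans h; apply: IH; nlia.
Qed.

Lemma pos_ge_a j : (b <= j <= e)%N -> a <= pos j <= a + N%:R.
Proof. by move=> /andP[h1 h2]; rewrite -{1}pos_b -pos_e !pos_mono. Qed.

Lemma pos_gt_a j : (b < j <= e)%N -> a < pos j.
Proof.
move=> /andP[h1 h2]; have /andP[_ fa2] := fa; case: chain => k1 _ _ _.
apply: (@lt_le_trans _ _ (pos b.+1)); last by apply: pos_mono; nlia.
rewrite pos_rank; last by rewrite /rank; nlia.
by rewrite k1 -natr1.
Qed.

Lemma walk_edge j (l : R) : (b <= j < e)%N -> 0 <= l <= 1 ->
  g (pos j + l * (pos j.+1 - pos j)) = lerp l (g (pos j)) (g (pos j.+1)).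
Proof.
move=> jb /andP[l0 l1]; have [k [h1 h2 h3]] := pos_step jb.
have w (t : R) : k%:R <= t -> t <= k%:R + 1 -> g t = lerp (t - k%:R) (vx V k) (vx V k.+1).
  by move=> t0 t1; rewrite -walk_lerp; [congr g; ring|apply/andP; split; lra].
have m1 : 0 <= l * (pos j.+1 - pos j) by rewrite mulr_ge0 ?subr_ge0.
have m2 : l * (pos j.+1 - pos j) <= pos j.+1 - pos j by rewrite ler_piMl ?subr_ge0.
have e3 := w (pos j + l * (pos j.+1 - pos j)) ltac:(lra) ltac:(lra).
rewrite e3 (w (pos j) h1 (le_trans h2 h3)) (w (pos j.+1) (le_trans h1 h2) h3) lerp_lerp.
by congr lerp; ring.
Qed.

(** Stops may coincide; the half-open condition selects the last one not after [x], so exactly the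
    stops after [t] are still ahead. *)
Definition at_stop (t : nat) (x : R) : Prop := (b <= t < e)%N /\ pos t <= x < pos t.+1.

Lemma at_stop_range t x : at_stop t x -> a <= x < a + N%:R.
Proof.
move=> [tb /andP[h1 h2]]; have /andP[h3 _] := @pos_ge_a t ltac:(nlia).
have /andP[_ h4] := @pos_ge_a t.+1 ltac:(nlia).
by apply/andP; split; lra.
Qed.

Lemma stop_unique t x t0 j : at_stop t x -> rank j -> x < t0 -> t0 <= a + N%:R ->
  g t0 = vx V (kap j) -> t0 = pos j /\ (t < j)%N.
Proof.
move=> st rj xt0 t0N gt0; have /andP[ax xN] := at_stop_range st.
have rj' : (b < j <= b + n)%N := rj.
have /andP[_ pN] := @pos_ge_a j ltac:(nlia).
have pa := @pos_gt_a j ltac:(nlia).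
have tE : t0 = pos j.
  apply: (@walk_lift_inj R V ccwV a) => //; try by apply/andP; split; lra.
  by rewrite walk_pos.
split=> //; rewrite ltnNge; apply/negP => jt.
have [tb /andP[h1 _]] := st.
have : pos j <= pos t by apply: pos_mono; nlia.
by lra.
Qed.

Lemma hits_self j u : rank j -> hits j u (g (pos j)).
Proof. by move=> rj; apply: hits_r; rewrite walk_pos //; exact: chain_close. Qed.

(** A stop that coincides with the end of the turn is outside the open arc, but its eyelet contains
    that end and is met anyway. *)
Lemma good_end t x : at_stop t x ->
  good q V rho (g x) (g (pos e)) <->
  forall j, (t < j < e)%N -> hits j (g x) (g (pos e)).
Proof.
move=> st; have /andP[ax xN] := at_stop_range st; have [tb /andP[h1 h2]] := st.
have xe : x < pos e <= x + N%:R by rewrite pos_e; apply/andP; split; lra.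
split=> [gd j tj|H].
  have rj : rank j by rewrite /rank; nlia.
  have pj := @pos_ge_a j ltac:(nlia).
  have [h|h] := ltrP (pos j) (pos e).
    apply: ((goodP (le_trans a0 ax) xe).1 gd j (pos j)) => //; last exact: walk_pos.
    by rewrite h andbT; apply: lt_le_trans h2 _; apply: pos_mono; nlia.
  have -> : pos e = pos j by apply/eqP; rewrite eq_le h pos_e; case/andP: pj.
  exact: hits_self.
apply/(goodP (le_trans a0 ax) xe) => j t0 rj /andP[xt0 t0e] gt0.
have [_ tj] : t0 = pos j /\ (t < j)%N.
  by apply: stop_unique st rj xt0 _ gt0; rewrite -pos_e ltW.
by apply: H; move: rj; rewrite /rank; nlia.
Qed.

Lemma hits_down t x j J J' : at_stop t x -> (t < j)%N -> (j <= J')%N -> (J' <= J)%N -> (J <= e)%N ->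
  rank j -> hits j (g x) (g (pos J)) -> hits j (g x) (g (pos J')).
Proof.
move=> st tj jJ' JJ' Je rj; have /andP[ax xN] := at_stop_range st; have [tb /andP[h1 h2]] := st.
apply: (hits_mono (t := pos j)) => //.
- exact: le_trans ax.
- by apply/ltW; apply: lt_le_trans h2 _; apply: pos_mono; nlia.
- by apply: pos_mono; nlia.
- by apply: pos_mono; nlia.
- have /andP[_] := @pos_ge_a J ltac:(nlia); lra.
- exact: walk_pos.
Qed.

(** By [hits_mono] the eyelet lost just after [lam] remains lost for all later end points, also
    beyond this stretch, so no later end point is good. *)
Lemma horizonP t x J lam : at_stop t x -> (t < J < e)%N -> 0 <= lam -> lam < 1 ->
  (forall j, (t < j < J)%N -> hits j (g x) (g (pos J))) ->
  (exists2 j, (t < j <= J)%N & ~ hits j (g x) (g (pos J.+1))) ->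
  (forall j (l : R), (t < j <= J)%N -> 0 <= l <= lam ->
     hits j (g x) (lerp l (g (pos J)) (g (pos J.+1)))) ->
  (exists2 j, (t < j <= J)%N & forall l : R, lam < l <= 1 ->
     ~ hits j (g x) (lerp l (g (pos J)) (g (pos J.+1)))) ->
  exists y, [/\ at_stop J y, lerp lam (g (pos J)) (g (pos J.+1)) = g y &
                is_horizon q V rho (g x) (g y)].
Proof.
move=> st tJ l0 l1 okJ [j1 j1J nok] okl [j2 j2J nol].
have /andP[ax xN] := at_stop_range st; have [tb /andP[h1 h2]] := st.
have rk j : (t < j <= J)%N -> rank j by rewrite /rank => ?; nlia.
(* A stretch of length 0 cannot lose an eyelet. *)
have D0 : 0 < pos J.+1 - pos J.
  rewrite subr_gt0 lt_def; apply/andP; split; last by apply: pos_mono; nlia.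
  apply/eqP => E; apply: nok; rewrite E.
  have [->|nj] := eqVneq j1 J; first by apply: hits_self; apply: rk; nlia.
  by apply: okJ; nlia.
have x0 : 0 <= x by exact: le_trans ax.
have xJ : x < pos J by apply: lt_le_trans h2 _; apply: pos_mono; nlia.
have JbE : (b <= J < e)%N by nlia.
have /andP[_ JN] := @pos_ge_a J.+1 ltac:(nlia).
exists (pos J + lam * (pos J.+1 - pos J)).
set y := pos J + _.
have y1 : pos J <= y by rewrite lerDl mulr_ge0 // ltW.
have y2 : y < pos J.+1.
  by rewrite /y -ltrBrDl -[X in _ < X]mul1r ltr_pM2r.
have gy : g y = lerp lam (g (pos J)) (g (pos J.+1)).
  by rewrite walk_edge // l0 ltW.
have xy : x < y <= x + N%:R by apply/andP; split; lra.
split=> //; first by split=> //; rewrite y1.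
have y0 : 0 <= y by lra.
split; first exact: boundary_walk.
  apply/(goodP x0 xy) => j t0 rj /andP[xt0 t0y] gt0.
  have [tE tj] : t0 = pos j /\ (t < j)%N.
    by apply: stop_unique st rj xt0 _ gt0; lra.
  rewrite gy; apply: okl; last by rewrite l0 lexx.
  rewrite tj leqNgt; apply/negP => Jj.
  have : pos J.+1 <= pos j by apply: pos_mono => //; move: rj; rewrite /rank; nlia.
  by lra.
move=> u' bu' gd; have [x' /andP[xx' x'N] u'E] := lift_above ccwV x0 bu'.
have [h|h|h] := ltgtP x' y; last by right; rewrite u'E h.
  left; apply/(open_arcP ccwV _ x0 xy); exists x' => //.
  by rewrite xx'.
exfalso.
have xx'N : x < x' <= x + N%:R by rewrite xx' x'N.
have p2 := @pos_mono j2 J ltac:(nlia) ltac:(nlia) ltac:(nlia).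
have p2' : x < pos j2 by apply: lt_le_trans h2 _; apply: pos_mono; nlia.
have ok2 : hits j2 (g x) (g x').
  rewrite u'E in gd; apply: ((goodP x0 xx'N).1 gd j2 (pos j2)).
  - exact: rk.
  - by apply/andP; split; lra.
  - by apply: walk_pos; exact: rk.
(* If [x'] lies beyond the stretch, the end of the stretch takes its place. *)
pose l := Num.min 1 ((x' - pos J) / (pos J.+1 - pos J)).
have lam_l : lam < l.
  by rewrite lt_min l1 ltr_pdivlMr // ltrBrDl.
have le1 : l <= 1 by rewrite ge_min lexx.
have lx : l <= (x' - pos J) / (pos J.+1 - pos J) by rewrite ge_min lexx orbT.
apply: (nol l); first by rewrite lam_l.
have l00 : 0 <= l by lra.
rewrite -walk_edge ?l00 //.
have lD : l * (pos J.+1 - pos J) <= x' - pos J by rewrite -ler_pdivlMr.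
have lD0 : 0 <= l * (pos J.+1 - pos J) by rewrite mulr_ge0 // ltW.
have h3 : x <= pos j2 by exact: ltW.
have h4 : pos j2 <= pos J + l * (pos J.+1 - pos J) by lra.
have h5 : pos J + l * (pos J.+1 - pos J) <= x' by lra.
exact: (hits_mono (rk _ j2J) x0 h3 h4 h5 x'N (walk_pos (rk _ j2J)) ok2).
Qed.

End Region.

(** * The last point of an edge reached through an eyelet *)

Section Touch.
Context {R : realType}.
Variables (rho : R) (c u : pt R).
Hypothesis rho0 : 0 <= rho.
Implicit Types x A B : pt R.

Definition touches x : Prop := exists2 p, segment u x p & dist2 p c <= rho ^+ 2.

(** The foot of the perpendicular from [c] has the parameter [tau x / dist2 x u] on the segment from
    [u] to [x]. *)
Definition tau x : R := dotp (vsub c u) (vsub x u).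

(** Built from strict comparisons, negation and conjunction, as program tests are; [touchbE] is the
    readable form. *)
Definition touchb x : bool :=
  ~~ [&& rho ^+ 2 < dist2 u c, rho ^+ 2 < dist2 x c &
      ~~ [&& 0 < tau x, tau x < dist2 x u &
             ~~ (rho ^+ 2 * dist2 x u < crs (vsub c u) (vsub x u) ^+ 2)]].

Lemma touchbE x : touchb x = [|| dist2 u c <= rho ^+ 2, dist2 x c <= rho ^+ 2 |
  [&& 0 < tau x, tau x < dist2 x u &
      crs (vsub c u) (vsub x u) ^+ 2 <= rho ^+ 2 * dist2 x u]].
Proof. by rewrite /touchb !leNgt !(negb_and, negb_or, negbK). Qed.

Lemma dist2_on_segment x l : dist2 (lerp l u x) c =
  dist2 u c - 2 * l * tau x + l ^+ 2 * dist2 x u.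
Proof. by rewrite /dist2 /tau /dotp /vsub /lerp /=; ring. Qed.

Lemma dist2_crs x l : dist2 (lerp l u x) c * dist2 x u =
  (l * dist2 x u - tau x) ^+ 2 + crs (vsub c u) (vsub x u) ^+ 2.
Proof. by rewrite /dist2 /tau /dotp /crs /vsub /lerp /=; ring. Qed.

Lemma closest_point x : exists2 l0 : R, 0 <= l0 <= 1 &
  (forall l, 0 <= l <= 1 -> dist2 (lerp l0 u x) c <= dist2 (lerp l u x) c) /\
  [\/ l0 = 0, l0 = 1 | [/\ 0 < tau x, tau x < dist2 x u & l0 = tau x / dist2 x u]].
Proof.
have D0 : 0 <= dist2 x u by exact: dotp_ge0.
have [t0|t0] := lerP (tau x) 0.
  exists 0; first by rewrite lexx ler01.
  split; [move=> l /andP[l0 l1]|by constructor 1].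
  rewrite !dist2_on_segment mulr0 mul0r expr0n /= mul0r.
  have h1 : 0 <= l * - tau x by rewrite mulr_ge0 // oppr_ge0.
  have h2 : 0 <= l ^+ 2 * dist2 x u by rewrite mulr_ge0 ?sqr_ge0.
  by lra.
have [t1|t1] := lerP (dist2 x u) (tau x).
  exists 1; first by rewrite lexx ler01.
  split; [move=> l /andP[l0 l1]|by constructor 2].
  rewrite !dist2_on_segment.
  have h1 : 0 <= (1 - l) * (tau x - dist2 x u) by rewrite mulr_ge0 ?subr_ge0.
  have h2 : 0 <= (1 - l) ^+ 2 * dist2 x u by rewrite mulr_ge0 ?sqr_ge0.
  by lra.
have D1 : 0 < dist2 x u by exact: lt_trans t1.
exists (tau x / dist2 x u).
  by rewrite divr_ge0 ?(ltW t0) //= ler_pdivrMr // mul1r ltW.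
split; last by constructor 3.
move=> l _; rewrite -(ler_pM2r D1) !dist2_crs divfK ?gt_eqF // subrr expr0n /= add0r.
by rewrite lerDr sqr_ge0.
Qed.

Lemma touchP x : reflect (touches x) (touchb x).
Proof.
apply: (iffP idP) => [|[_ [l [l01 ->]] hl]].
  rewrite touchbE => /or3P[h|h|/and3P[h1 h2 h3]].
  - by exists u => //; exact: segment_l.
  - by exists x => //; exact: segment_r.
  - have D1 : 0 < dist2 x u by exact: lt_trans h2.
    exists (lerp (tau x / dist2 x u) u x).
      exists (tau x / dist2 x u); split=> //.
      by rewrite divr_ge0 ?(ltW h1) ?(ltW D1) //= ler_pdivrMr // mul1r ltW.
    by rewrite -(ler_pM2r D1) dist2_crs divfK ?gt_eqF // subrr expr0n /= add0r.
have [l0 l001 [/(_ l l01) min cases]] := closest_point x.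
have {}hl := le_trans min hl.
rewrite touchbE.
case: cases hl => [->|->|[h1 h2 ->]].
- by rewrite lerp0 => ->.
- by rewrite lerp1 => ->; rewrite orbT.
- have D1 : 0 < dist2 x u by exact: lt_trans h2.
  rewrite -(ler_pM2r D1) dist2_crs divfK ?gt_eqF // subrr expr0n /= add0r => ->.
  by rewrite h1 h2 !orbT.
Qed.

(** The distance from [c] attains its minimum on the segment, so a missed disk is missed by a
    margin. This makes the set of touching parameters closed. *)
Lemma touches_gap x : ~ touches x -> exists2 h : R, 0 < h &
  forall p, segment u x p -> rho + h <= len (vsub p c).
Proof.
move=> nt; have [l0 l001 [min _]] := closest_point x.
have lt0 : rho ^+ 2 < dist2 (lerp l0 u x) c.
  by rewrite ltNge; apply/negP => h; apply: nt; exists (lerp l0 u x) => //; exists l0.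
exists (len (vsub (lerp l0 u x) c) - rho).
  by rewrite subr_gt0 -(@ltr_pXn2r _ 2) ?nnegrE ?len_ge0 // len2.
move=> p [l [l01 ->]]; rewrite addrC subrK.
by rewrite ler_sqrt ?dotp_ge0 //; exact: min.
Qed.

Section Edge.
Variables A B : pt R.
Hypothesis touchA : touches A.
Notation X l := (lerp l A B).

(** Moving the end from [X l] to [X l'] moves no point of the segment by more than the distance of
    the two ends. The alternative is shaped to meet a margin [h] from [touches_gap]. *)
Lemma touches_near l l' : touches (X l) -> forall h, rho + h <= rho + `|l - l'| * len (vsub B A) \/
   exists2 p, segment u (X l') p & len (vsub p c) < rho + h.
Proof.
move=> [_ [k [/andP[k0 k1] ->]] hd] h.
have [hh|hh] := lerP (rho + h) (rho + `|l - l'| * len (vsub B A)); first by left.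
right; exists (lerp k u (X l')); first by exists k; rewrite k0.
apply: le_lt_trans hh.
have -> : vsub (lerp k u (X l')) c = ((vsub (lerp k u (X l)) c).1 + (k * (l' - l) * (vsub B A).1),
   (vsub (lerp k u (X l)) c).2 + (k * (l' - l) * (vsub B A).2)).
  by rewrite /vsub /lerp /=; congr pair; ring.
apply: le_trans (len_add (_, _) (_, _)) _; apply: lerD.
  by rewrite -(@ler_pXn2r _ 2) ?nnegrE ?len_ge0 // len2.
have -> : len (k * (l' - l) * (vsub B A).1, k * (l' - l) * (vsub B A).2) =
    `|k * (l' - l)| * len (vsub B A).
  by rewrite /len -sqrtr_sqr -sqrtrM ?sqr_ge0 //; congr Num.sqrt; rewrite /dotp /=; ring.
rewrite ler_wpM2r ?len_ge0 // normrM distrC ger0_norm // ler_piMl //.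
Qed.

Lemma last_touch : exists2 m : R, 0 <= m <= 1 & touches (X m) /\
  forall l, 0 <= l <= 1 -> touches (X l) -> l <= m.
Proof.
pose S := [set l : R | 0 <= l <= 1 /\ touches (X l)].
have S0 : S 0 by split; [rewrite lexx ler01|rewrite lerp0].
have hs : has_sup S.
  by split; [exists 0|exists 1 => l [/andP[_ l1] _]].
have ub l : S l -> l <= sup S by move=> Sl; exact: sup_upper_bound.
have s01 : 0 <= sup S <= 1.
  by rewrite ub //=; apply: ge_sup; [exists 0|move=> l [/andP[_ l1] _]].
exists (sup S) => //; split; last by move=> l l01 tl; apply: ub.
apply: contrapT => /touches_gap[h h0 gap].
(* The summand 1 covers the case [A = B]. *)
have L0 : 0 < len (vsub B A) + 1 by rewrite ltr_wpDl ?len_ge0.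
have [l Sl ls] := sup_adherent (divr_gt0 h0 L0) hs.
have [/andP[l0 l1] tl] := Sl.
have [h1|[p sp lp]] := @touches_near l (sup S) tl h; last first.
  by have := gap p sp; rewrite leNgt lp.
have := ub l Sl => lsup.
have e1 : `|l - sup S| = sup S - l by rewrite distrC ger0_norm // subr_ge0.
have e2 : sup S - l < h / (len (vsub B A) + 1) by lra.
have e3 : (sup S - l) * (len (vsub B A) + 1) < h by rewrite -ltr_pdivlMr.
have e4 : 0 <= sup S - l by rewrite subr_ge0.
by move: h1; rewrite e1; lra.
Qed.

(** [M] exceeds the slope of every chord from [x] to a point at most 1 to its right, which gives an
    explicit width. *)
Lemma quad_open (a b d x : R) : a * x ^+ 2 + b * x + d < 0 ->
  exists2 h : R, 0 < h & forall y, x <= y -> y <= x + h -> a * y ^+ 2 + b * y + d < 0.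
Proof.
move=> neg; pose M := `|2 * a * x + b| + `|a| + 1.
have M0 : 0 < M by rewrite ltr_wpDl ?addr_ge0 ?normr_ge0.
pose P := a * x ^+ 2 + b * x + d.
have h0 : 0 < - P / M by rewrite divr_gt0 // oppr_gt0.
exists (Num.min 1 (- P / M)); first by rewrite lt_min ltr01.
move=> y xy yx; pose e := y - x.
have e0 : 0 <= e by rewrite subr_ge0.
have : e <= Num.min 1 (- P / M) by rewrite /e; lra.
rewrite le_min => /andP[e1]; rewrite ler_pdivlMr // => eM.
have [->|ne] := eqVneq y x; first exact: neg.
have e0' : 0 < e by rewrite subr_gt0 lt_def ne.
have -> : a * y ^+ 2 + b * y + d = P + e * (2 * a * x + b + a * e).
  by rewrite /e /P; ring.
have h1 : a * e <= `|a|.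
  apply: le_trans (ler_norm _) _; rewrite normrM (ger0_norm e0) ler_piMr //.
have h2 : e * (2 * a * x + b + a * e) < e * M.
  rewrite ltr_pM2l // /M; have := ler_norm (2 * a * x + b); lra.
by lra.
Qed.

(* Coefficients of the quadratic equations saying that the point [X l] is on the
   circle around [c] or that the line from [u] to it is tangent to the circle. *)
Definition circ2 : R := dist2 B A.
Definition circ1 : R := dotp (vsub A c) (vsub B A).
Definition circ0 : R := dist2 A c - rho ^+ 2.
Definition tang2 : R := crs (vsub c u) (vsub B A) ^+ 2 - rho ^+ 2 * dist2 B A.
Definition tang1 : R := crs (vsub c u) (vsub A u) * crs (vsub c u) (vsub B A) -
  rho ^+ 2 * dotp (vsub A u) (vsub B A).
Definition tang0 : R := crs (vsub c u) (vsub A u) ^+ 2 - rho ^+ 2 * dist2 A u.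

Lemma circE l : dist2 (X l) c - rho ^+ 2 = circ2 * l ^+ 2 + 2 * circ1 * l + circ0.
Proof. by rewrite /circ2 /circ1 /circ0 /dist2 /dotp /vsub /lerp /=; ring. Qed.

Lemma tangE l : crs (vsub c u) (vsub (X l) u) ^+ 2 - rho ^+ 2 * dist2 (X l) u =
  tang2 * l ^+ 2 + 2 * tang1 * l + tang0.
Proof. by rewrite /tang2 /tang1 /tang0 /dist2 /crs /dotp /vsub /lerp /=; ring. Qed.

(** The equation is [a l^2 + 2 b l + d = 0]; [root3] solves it when [a] is 0. *)
Definition root1 (a b d : R) : R := (- b - Num.sqrt (b * b - a * d)) / a.
Definition root2 (a b d : R) : R := (- b + Num.sqrt (b * b - a * d)) / a.
Definition root3 (b d : R) : R := - d / (2 * b).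

(* At the last parameter below 1 at which the segment from [u] meets the disk, its end
   is on the circle or the segment is tangent to it. *)
Definition candidates : seq R :=
  [:: 1; root1 circ2 circ1 circ0; root2 circ2 circ1 circ0;
      root1 tang2 tang1 tang0; root2 tang2 tang1 tang0; root3 tang1 tang0].

Lemma quad_roots (a b d l : R) : a * l ^+ 2 + 2 * b * l + d = 0 -> a != 0 ->
  l = root1 a b d \/ l = root2 a b d.
Proof.
move=> e a0; have D : (a * l + b) ^+ 2 = b * b - a * d.
  have : a * (a * l ^+ 2 + 2 * b * l + d) = 0 by rewrite e mulr0.
  by move=> h; lra.
rewrite /root1 /root2 -D sqrtr_sqr.
have [h|h] := lerP 0 (a * l + b).
  by right; rewrite ger0_norm // addrC addrK mulrC mulKf.
by left; rewrite ltr0_norm // opprK addrC addrK mulrC mulKf.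
Qed.

(** An alternative of [touchbE] that holds with room to spare persists beyond [m], against
    maximality. So for [m] below 1 the circle or the tangent equation holds at [m], and an equation
    vanishing identically would persist as well. *)
Lemma last_touch_candidate (m : R) : 0 <= m <= 1 -> touches (X m) ->
  (forall l, 0 <= l <= 1 -> touches (X l) -> l <= m) -> m \in candidates.
Proof.
move=> /andP[m0 m1] tm mmax; rewrite /candidates.
move: m1; rewrite le_eqVlt => /orP[/eqP->|m1]; first by rewrite mem_head.
have beyond (h : R) : 0 < h -> (forall y, m <= y -> y <= m + h -> touches (X y)) -> False.
  move=> h0 H; pose y := Num.min 1 (m + h).
  have my : m < y by rewrite lt_min m1 ltrDl.
  have y1 : y <= 1 by rewrite ge_min lexx.
  have yh : y <= m + h by rewrite ge_min lexx orbT.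
  have y01 : 0 <= y <= 1 by rewrite y1 andbT (le_trans m0) // ltW.
  by have := mmax y y01 (H y (ltW my) yh); rewrite leNgt my.
move/touchP: (tm); rewrite touchbE => /or3P[h|h|/and3P[h1 h2 h3]].
- exfalso; apply: (@beyond 1) => // y _ _; exists u => //; exact: segment_l.
- have e : circ2 * m ^+ 2 + 2 * circ1 * m + circ0 = 0.
    rewrite -circE; apply/eqP; rewrite subr_eq0 eq_le h /= leNgt; apply/negP => lt.
    have [|k k0 kP] := @quad_open circ2 (2 * circ1) circ0 m.
      by rewrite -circE subr_lt0.
    apply: (beyond k k0) => y my yk; exists (X y); first exact: segment_r.
    by apply/ltW; rewrite -subr_lt0 circE; exact: kP.
  have c2 : circ2 != 0.
    rewrite /circ2 /dist2 dotp_eq0 vsub_eq0; apply/eqP => BA.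
    by apply: (@beyond 1) => // y _ _; rewrite BA lerp_id.
  by have [->|->] := quad_roots e c2; rewrite !inE eqxx ?orbT.
- have tE y : tau (X y) = 0 * y ^+ 2 + (tau B - tau A) * y + tau A.
    by rewrite /tau /dotp /vsub /lerp /=; ring.
  have dE y : dist2 (X y) u = dist2 B A * y ^+ 2 + 2 * dotp (vsub A u) (vsub B A) * y + dist2 A u.
    by rewrite /dist2 /dotp /vsub /lerp /=; ring.
  have [|k1 k10 k1P] := @quad_open 0 (tau A - tau B) (- tau A) m.
    by move: h1; rewrite tE; lra.
  have [|k2 k20 k2P] := @quad_open (- dist2 B A) (tau B - tau A - 2 * dotp (vsub A u) (vsub B A))
      (tau A - dist2 A u) m.
    by move: h2; rewrite tE dE; lra.
  have pos_near y : m <= y -> y <= m + Num.min k1 k2 -> 0 < tau (X y) /\ tau (X y) < dist2 (X y) u.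
    rewrite -lerBlDl le_min => my /andP[y1 y2]; split.
      by have := k1P y my ltac:(lra); rewrite tE; lra.
    by have := k2P y my ltac:(lra); rewrite tE dE; lra.
  have k0 : 0 < Num.min k1 k2 by rewrite lt_min k10.
  have near_touch y : m <= y -> y <= m + Num.min k1 k2 ->
      tang2 * y ^+ 2 + 2 * tang1 * y + tang0 <= 0 -> touches (X y).
    move=> my yk ty; have [p1 p2] := pos_near y my yk.
    have le : crs (vsub c u) (vsub (X y) u) ^+ 2 <= rho ^+ 2 * dist2 (X y) u.
      by rewrite -subr_le0 tangE.
    by apply/touchP; rewrite touchbE p1 p2 le !orbT.
  have e : tang2 * m ^+ 2 + 2 * tang1 * m + tang0 = 0.
    apply/eqP; rewrite eq_le -{1}tangE subr_le0 h3 /= leNgt; apply/negP => lt.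
    have [k3 k30 k3P] := quad_open lt.
    apply: (beyond (Num.min k3 (Num.min k1 k2))); first by rewrite lt_min k30.
    move=> y my; rewrite -lerBlDl le_min => /andP[y1 y2].
    apply: near_touch => //; first by rewrite -lerBlDl.
    by apply/ltW/k3P => //; rewrite -lerBlDl.
  have [t2|t2] := eqVneq tang2 0; last first.
    by have [->|->] := quad_roots e t2; rewrite !inE eqxx ?orbT.
  have [t1|t1] := eqVneq tang1 0; last first.
    suff -> : m = root3 tang1 tang0 by rewrite !inE eqxx ?orbT.
    move: e; rewrite t2 mul0r add0r /root3 => e.
    have -> : - tang0 = 2 * tang1 * m by lra.
    by field.
  exfalso; apply: (beyond _ k0) => y my yk; apply: near_touch => //.
  by move: e; rewrite t1 t2 !mulr0 !mul0r !add0r => ->.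
Qed.

End Edge.
End Touch.

(** * Structured programs and their compilation *)

Inductive nexp :=
| NVar (r : nat) | NCst (c : nat) | NPlus (e1 e2 : nexp) | NMinus (e1 e2 : nexp)
| NArr (A : nat) (e : nexp).

Inductive rexp :=
| RVar (r : nat) | RCst (c : nat) | RBin (o : arith) (e1 e2 : rexp) | RRoot (e : rexp)
| RArr (A : nat) (i : nexp).

Inductive bexp :=
| BLtR (e1 e2 : rexp) | BLtN (e1 e2 : nexp) | BNot (b : bexp) | BAnd (b1 b2 : bexp).

Inductive cmd :=
| CSkip | CReal (r : nat) (e : rexp) | CNat (r : nat) (e : nexp)
| CRealArr (A : nat) (i : nexp) (e : rexp) | CNatArr (A : nat) (i e : nexp)
| CSeq (c1 c2 : cmd) | CIf (b : bexp) (c1 c2 : cmd) | CWhile (b : bexp) (c : cmd).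

Section Semantics.
Context {R : realType}.

Record mem := Mem {
  mr : nat -> R; mn : nat -> nat; mra : nat -> nat -> R; mna : nat -> nat -> nat }.

Fixpoint neval (m : mem) (e : nexp) : nat :=
  match e with
  | NVar r => mn m r
  | NCst c => c
  | NPlus e1 e2 => (neval m e1 + neval m e2)%N
  | NMinus e1 e2 => (neval m e1 - neval m e2)%N
  | NArr A e => mna m A (neval m e)
  end.

Fixpoint reval (m : mem) (e : rexp) : R :=
  match e with
  | RVar r => mr m r
  | RCst c => c%:R
  | RBin o e1 e2 => eval_arith o (reval m e1) (reval m e2)
  | RRoot e => Num.sqrt (reval m e)
  | RArr A i => mra m A (neval m i)
  end.

Fixpoint beval (m : mem) (b : bexp) : bool :=
  match b with
  | BLtR e1 e2 => reval m e1 < reval m e2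
  | BLtN e1 e2 => (neval m e1 < neval m e2)%N
  | BNot b => ~~ beval m b
  | BAnd b1 b2 => beval m b1 && beval m b2
  end.

(* The last argument counts assignments and tests. *)
Inductive run : cmd -> mem -> mem -> nat -> Prop :=
| run_skip m : run CSkip m m 0
| run_real r e m :
    run (CReal r e) m (Mem (upd (mr m) r (reval m e)) (mn m) (mra m) (mna m)) 1
| run_nat r e m :
    run (CNat r e) m (Mem (mr m) (upd (mn m) r (neval m e)) (mra m) (mna m)) 1
| run_real_arr A i e m :
    run (CRealArr A i e) m
      (Mem (mr m) (mn m) (upd (mra m) A (upd (mra m A) (neval m i) (reval m e))) (mna m)) 1
| run_nat_arr A i e m :
    run (CNatArr A i e) m
      (Mem (mr m) (mn m) (mra m) (upd (mna m) A (upd (mna m A) (neval m i) (neval m e)))) 1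
| run_seq c1 c2 m m1 m2 k1 k2 :
    run c1 m m1 k1 -> run c2 m1 m2 k2 -> run (CSeq c1 c2) m m2 (k1 + k2)
| run_if b c1 c2 m m' k :
    run (if beval m b then c1 else c2) m m' k -> run (CIf b c1 c2) m m' k.+1
| run_stop b c m : ~~ beval m b -> run (CWhile b c) m m 1
| run_loop b c m m1 m2 k1 k2 : beval m b ->
    run c m m1 k1 -> run (CWhile b c) m1 m2 k2 -> run (CWhile b c) m m2 (k1 + k2).+1.

(* Weakest precondition, with the elapsed time as a second argument. *)
Definition wp (c : cmd) (Q : mem -> nat -> Prop) (m : mem) (T : nat) : Prop :=
  exists m' k, run c m m' k /\ Q m' (T + k)%N.

Lemma wp_skip (Q : mem -> nat -> Prop) m T : Q m T -> wp CSkip Q m T.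
Proof. by exists m, 0%N; rewrite addn0; split=> //; constructor. Qed.

Lemma wp_real r e (Q : mem -> nat -> Prop) m T :
  Q (Mem (upd (mr m) r (reval m e)) (mn m) (mra m) (mna m)) T.+1 -> wp (CReal r e) Q m T.
Proof. by rewrite -addn1; eexists _, 1%N; split; [constructor|]. Qed.

Lemma wp_nat r e (Q : mem -> nat -> Prop) m T :
  Q (Mem (mr m) (upd (mn m) r (neval m e)) (mra m) (mna m)) T.+1 -> wp (CNat r e) Q m T.
Proof. by rewrite -addn1; eexists _, 1%N; split; [constructor|]. Qed.

Lemma wp_real_arr A i e (Q : mem -> nat -> Prop) m T :
  Q (Mem (mr m) (mn m) (upd (mra m) A (upd (mra m A) (neval m i) (reval m e))) (mna m)) T.+1 ->
  wp (CRealArr A i e) Q m T.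
Proof. by rewrite -addn1; eexists _, 1%N; split; [constructor|]. Qed.

Lemma wp_nat_arr A i e (Q : mem -> nat -> Prop) m T :
  Q (Mem (mr m) (mn m) (mra m) (upd (mna m) A (upd (mna m A) (neval m i) (neval m e)))) T.+1 ->
  wp (CNatArr A i e) Q m T.
Proof. by rewrite -addn1; eexists _, 1%N; split; [constructor|]. Qed.

Lemma wp_seq c1 c2 Q m T : wp c1 (wp c2 Q) m T -> wp (CSeq c1 c2) Q m T.
Proof.
move=> [m1 [k1 [r1 [m2 [k2 [r2 q]]]]]]; exists m2, (k1 + k2)%N.
by rewrite addnA; split=> //; apply: run_seq r1 r2.
Qed.

Lemma wp_if b c1 c2 Q m T :
  (beval m b -> wp c1 Q m T.+1) -> (~~ beval m b -> wp c2 Q m T.+1) -> wp (CIf b c1 c2) Q m T.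
Proof.
move=> h1 h2; have [m' [k [r q]]] : wp (if beval m b then c1 else c2) Q m T.+1.
  by case: ifPn => h; [exact: h1|exact: h2].
by exists m', k.+1; rewrite addnS -addSn; split=> //; constructor.
Qed.

Lemma wp_while b c (I Q : mem -> nat -> Prop) (mu : mem -> nat) m T :
  I m T ->
  (forall m T, I m T -> beval m b ->
     wp c (fun m' T' => I m' T' /\ (mu m' < mu m)%N) m T.+1) ->
  (forall m T, I m T -> ~~ beval m b -> Q m T.+1) ->
  wp (CWhile b c) Q m T.
Proof.
move=> i0 body stop; have [x] := ubnP (mu m); elim: x m T i0 => // x IH m T i0 mx.
have [tb|fb] := boolP (beval m b); last first.
  by exists m, 1%N; rewrite addn1; split; [constructor|exact: stop].
have [m1 [k1 [r1 [i1 d1]]]] := body _ _ i0 tb.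
have [m2 [k2 [r2 q2]]] := IH m1 _ i1 (leq_trans d1 mx).
exists m2, (k1 + k2).+1; rewrite addnS -addSn addnA; split=> //.
exact: run_loop r1 r2.
Qed.

End Semantics.
Arguments mem : clear implicits.

(* Registers from [K] on are used for intermediate results. *)
Section Compiler.
Variable K : nat.

(** The result is left in register [k], with scratch space above. The machine has no move
    instruction, so copying adds to 0. *)
Fixpoint cn (e : nexp) (k : nat) : seq instr :=
  match e with
  | NVar r => [:: NConst k 0; NAdd k k r]
  | NCst c => [:: NConst k c]
  | NPlus e1 e2 => cn e1 k ++ cn e2 k.+1 ++ [:: NAdd k k k.+1]
  | NMinus e1 e2 => cn e1 k ++ cn e2 k.+1 ++ [:: NSub k k k.+1]
  | NArr A e => cn e k ++ [:: NLoad k A k]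
  end.

Fixpoint cr (e : rexp) (k : nat) : seq instr :=
  match e with
  | RVar r => [:: RConst k 0; ROp Defs.Add k k r]
  | RCst c => [:: RConst k c]
  | RBin o e1 e2 => cr e1 k ++ cr e2 k.+1 ++ [:: ROp o k k k.+1]
  | RRoot e => cr e k ++ [:: RSqrt k k]
  | RArr A i => cn i k ++ [:: RLoad k A k]
  end.

(** Jump targets are absolute, so the address [p] of the code is passed along. Truth values are 0
    and 1, and conjunction is the truncated difference [x + y - 1]. *)
Fixpoint cb (b : bexp) (k p : nat) : seq instr :=
  match b with
  | BLtR e1 e2 => let c := cr e1 k ++ cr e2 k.+1 in
      c ++ [:: NConst k 1; RJumpLt k k.+1 (p + size c + 3); NConst k 0]
  | BLtN e1 e2 => let c := cn e1 k ++ cn e2 k.+1 in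
      c ++ [:: NJumpLt k k.+1 (p + size c + 3); NConst k 0; Jump (p + size c + 4); NConst k 1]
  | BNot b => cb b k p ++ [:: NConst k.+1 1; NSub k k.+1 k]
  | BAnd b1 b2 => let c := cb b1 k p in
      c ++ cb b2 k.+1 (p + size c) ++ [:: NAdd k k k.+1; NConst k.+1 1; NSub k k k.+1]
  end.

Fixpoint cc (c : cmd) (p : nat) : seq instr :=
  match c with
  | CSkip => [::]
  | CReal r e => cr e K ++ [:: RConst r 0; ROp Defs.Add r r K]
  | CNat r e => cn e K ++ [:: NConst r 0; NAdd r r K]
  | CRealArr A i e => cn i K ++ cr e K.+1 ++ [:: RStore A K K.+1]
  | CNatArr A i e => cn i K ++ cn e K.+1 ++ [:: NStore A K K.+1]
  | CSeq c1 c2 => let d := cc c1 p in d ++ cc c2 (p + size d)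
  | CIf b c1 c2 =>
      let t := cb b K p in
      let d2 := cc c2 (p + size t + 2) in
      let d1 := cc c1 (p + size t + 2 + size d2 + 1) in
      t ++ [:: NConst K.+1 0; NJumpLt K.+1 K (p + size t + 2 + size d2 + 1)] ++
      d2 ++ [:: Jump (p + size t + 2 + size d2 + 1 + size d1)] ++ d1
  | CWhile b c =>
      let t := cb b K p in
      let d := cc c (p + size t + 3) in
      t ++ [:: NConst K.+1 0; NJumpLt K.+1 K (p + size t + 3);
               Jump (p + size t + 3 + size d + 1)] ++ d ++ [:: Jump p]
  end.

Fixpoint wfn (e : nexp) : bool :=
  match e with
  | NVar r => (r < K)%N
  | NCst _ => true
  | NPlus e1 e2 | NMinus e1 e2 => wfn e1 && wfn e2
  | NArr _ e => wfn e
  end.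

Fixpoint wfr (e : rexp) : bool :=
  match e with
  | RVar r => (r < K)%N
  | RCst _ => true
  | RBin _ e1 e2 => wfr e1 && wfr e2
  | RRoot e => wfr e
  | RArr _ i => wfn i
  end.

Fixpoint wfb (b : bexp) : bool :=
  match b with
  | BLtR e1 e2 => wfr e1 && wfr e2
  | BLtN e1 e2 => wfn e1 && wfn e2
  | BNot b => wfb b
  | BAnd b1 b2 => wfb b1 && wfb b2
  end.

Fixpoint wfc (c : cmd) : bool :=
  match c with
  | CSkip => true
  | CReal r e => (r < K)%N && wfr e
  | CNat r e => (r < K)%N && wfn e
  | CRealArr _ i e => wfn i && wfr e
  | CNatArr _ i e => wfn i && wfn e
  | CSeq c1 c2 => wfc c1 && wfc c2
  | CIf b c1 c2 => [&& wfb b, wfc c1 & wfc c2]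
  | CWhile b c => wfb b && wfc c
  end.

(** * Correctness and cost of compiled code *)

Section Correct.
Context {R : realType}.
Variable prog : seq instr.
Implicit Types (st : state R) (m : mem R).

Definition code_at (p : nat) (c : seq instr) : Prop :=
  exists s1 s2, prog = s1 ++ c ++ s2 /\ size s1 = p.

Lemma code_at_cat p c1 c2 : code_at p (c1 ++ c2) -> code_at p c1 /\ code_at (p + size c1) c2.
Proof.
move=> [s1 [s2 [e <-]]]; split; first by exists s1, (c2 ++ s2); rewrite e -catA.
by exists (s1 ++ c1), s2; rewrite e size_cat !catA.
Qed.

Lemma code_at_cons p i c : code_at p (i :: c) ->
  onth prog p = Some i /\ code_at p.+1 c.
Proof.
rewrite -cat1s => /code_at_cat[[s1 [s2 [e <-]]]]; rewrite addn1; split=> //.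
by rewrite e onth_cat ltnn subnn.
Qed.

Definition reach st (T : nat) st' : Prop :=
  exists2 t, (t <= T)%N & iter t (Defs.step prog) st = st'.

Lemma reach0 st : reach st 0 st.
Proof. by exists 0%N. Qed.

Lemma reach_trans T1 T2 st1 st2 st3 :
  reach st1 T1 st2 -> reach st2 T2 st3 -> reach st1 (T1 + T2) st3.
Proof.
move=> [t1 h1 <-] [t2 h2 <-]; exists (t2 + t1)%N; first by rewrite addnC leq_add.
by rewrite iterD.
Qed.

Lemma reach_le T T' st st' : (T <= T')%N -> reach st T st' -> reach st T' st'.
Proof. by move=> TT' [t tT e]; exists t => //; exact: leq_trans TT'. Qed.

Lemma reach_step i st : onth prog (pc st) = Some i -> reach st 1 (exec i st).
Proof. by move=> e; exists 1%N => //=; rewrite /Defs.step e. Qed.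

Definition keep (k : nat) st st' : Prop :=
  [/\ forall r, (r < k)%N -> rreg st' r = rreg st r,
      forall r, (r < k)%N -> nreg st' r = nreg st r,
      rmem st' = rmem st & nmem st' = nmem st].

Lemma keep_trans k st1 st2 st3 : keep k st1 st2 -> keep k st2 st3 -> keep k st1 st3.
Proof.
move=> [a1 b1 c1 d1] [a2 b2 c2 d2]; split; rewrite ?c2 ?d2 //.
  by move=> r rk; rewrite a2 ?a1.
by move=> r rk; rewrite b2 ?b1.
Qed.

Lemma keep_le k k' st st' : (k <= k')%N -> keep k' st st' -> keep k st st'.
Proof.
by move=> kk [a1 b1 c1 d1]; split=> // r rk; [apply: a1|apply: b1]; exact: leq_trans kk.
Qed.

Definition agree m st : Prop :=
  [/\ forall r, (r < K)%N -> rreg st r = mr m r, forall r, (r < K)%N -> nreg st r = mn m r,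
      rmem st = mra m & nmem st = mna m].

Lemma agree_keep m k st st' : (K <= k)%N -> agree m st -> keep k st st' -> agree m st'.
Proof.
move=> Kk [a1 b1 c1 d1] [a2 b2 c2 d2]; split; rewrite ?c2 ?d2 //.
  by move=> r rk; rewrite a2 ?a1 //; exact: leq_trans Kk.
by move=> r rk; rewrite b2 ?b1 //; exact: leq_trans Kk.
Qed.

Lemma upd_eq (A : Type) (h : nat -> A) k v : upd h k v k = v.
Proof. by rewrite /upd eqxx. Qed.

Lemma upd_lt (A : Type) (h : nat -> A) k v r : (r < k)%N -> upd h k v r = h r.
Proof. by rewrite /upd => rk; rewrite ltn_eqF. Qed.

(** Code for expressions never jumps backwards, so its length bounds its running time. *)
Definition calc (c : seq instr) (k : nat) st (post : state R -> Prop) : Prop :=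
  exists st', [/\ reach st (size c) st', pc st' = (pc st + size c)%N, keep k st st' & post st'].

Lemma cn_ok e k m st : (K <= k)%N -> wfn e -> agree m st -> code_at (pc st) (cn e k) ->
  calc (cn e k) k st (fun st' => nreg st' k = neval m e).
Proof.
elim: e k st => [r|c|e1 IH1 e2 IH2|e1 IH1 e2 IH2|A e IH] k st Kk /=.
- move=> rK ag /code_at_cons[u1 /code_at_cons[u2 _]].
  case: st ag u1 u2 => p x n X N /= ag u1 u2.
  have ra := reach_step (st := State p x n X N) u1.
  have rb := reach_step (st := exec (NConst k 0) (State p x n X N)) u2.
  eexists; split; first exact: reach_trans ra rb.
  + by rewrite /= addn2.
  + by split=> //= r' rk; rewrite !upd_lt.
  + rewrite /= !upd_eq add0n upd_lt; last by exact: leq_trans Kk.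
    by case: ag => _ /(_ _ rK).
- move=> _ _ /code_at_cons[u1 _]; case: st u1 => p x n X N /= u1.
  eexists; split; first exact: (reach_step (st := State p x n X N) u1).
  + by rewrite /= addn1.
  + by split=> //= r' rk; rewrite upd_lt.
  + by rewrite /= upd_eq.
- move=> /andP[w1 w2] ag /code_at_cat[c1 /code_at_cat[c2 /code_at_cons[u9 _]]].
  have [st1 [r1 p1 k1 v1]] := IH1 k st Kk w1 ag c1.
  have ag1 := agree_keep Kk ag k1.
  rewrite -p1 in c2 u9.
  have [st2 [r2 p2 k2 v2]] := IH2 k.+1 st1 (leqW Kk) w2 ag1 c2.
  rewrite -p2 in u9.
  eexists; split.
  + by rewrite !size_cat addnA; apply: reach_trans (reach_trans r1 r2) (reach_step u9).
  + by rewrite !size_cat; case: (st2) p2 => /= *; lia.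
  + apply: keep_trans k1 (keep_trans (keep_le (leqnSn k) k2) _).
    by case: (st2) => p x n X N; split=> //= r rk; rewrite upd_lt.
  + have -> : nreg (exec (NAdd k k k.+1) st2) k = (nreg st2 k + nreg st2 k.+1)%N.
      by case: (st2) => p x n X N /=; rewrite upd_eq.
    by rewrite v2; case: k2 => _ -> //; rewrite v1.
- move=> /andP[w1 w2] ag /code_at_cat[c1 /code_at_cat[c2 /code_at_cons[u9 _]]].
  have [st1 [r1 p1 k1 v1]] := IH1 k st Kk w1 ag c1.
  have ag1 := agree_keep Kk ag k1.
  rewrite -p1 in c2 u9.
  have [st2 [r2 p2 k2 v2]] := IH2 k.+1 st1 (leqW Kk) w2 ag1 c2.
  rewrite -p2 in u9.
  eexists; split.
  + by rewrite !size_cat addnA; apply: reach_trans (reach_trans r1 r2) (reach_step u9).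
  + by rewrite !size_cat; case: (st2) p2 => /= *; lia.
  + apply: keep_trans k1 (keep_trans (keep_le (leqnSn k) k2) _).
    by case: (st2) => p x n X N; split=> //= r rk; rewrite upd_lt.
  + have -> : nreg (exec (NSub k k k.+1) st2) k = (nreg st2 k - nreg st2 k.+1)%N.
      by case: (st2) => p x n X N /=; rewrite upd_eq.
    by rewrite v2; case: k2 => _ -> //; rewrite v1.
- move=> w ag /code_at_cat[c1 /code_at_cons[u9 _]].
  have [st1 [r1 p1 k1 v1]] := IH k st Kk w ag c1.
  rewrite -p1 in u9; have [_ _ _ e4] := agree_keep Kk ag k1.
  eexists; split.
  + by rewrite size_cat; apply: reach_trans r1 (reach_step u9).
  + by rewrite !size_cat; case: (st1) p1 => /= *; lia.
  + apply: keep_trans k1 _.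
    by case: (st1) => p x n X N; split=> //= r rk; rewrite upd_lt.
  + by rewrite -e4 -v1; case: (st1) => p x n X N /=; rewrite upd_eq.
Qed.

Lemma cr_ok e k m st : (K <= k)%N -> wfr e -> agree m st -> code_at (pc st) (cr e k) ->
  calc (cr e k) k st (fun st' => rreg st' k = reval m e).
Proof.
elim: e k st => [r|c|o e1 IH1 e2 IH2|e IH|A i] k st Kk /=.
- move=> rK ag /code_at_cons[u1 /code_at_cons[u2 _]].
  case: st ag u1 u2 => p x n X N /= ag u1 u2.
  have ra := reach_step (st := State p x n X N) u1.
  have rb := reach_step (st := exec (RConst k 0) (State p x n X N)) u2.
  eexists; split; first exact: reach_trans ra rb.
  + by rewrite /= addn2.
  + by split=> //= r' rk; rewrite !upd_lt.
  + rewrite /= !upd_eq add0r upd_lt; last by exact: leq_trans Kk.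
    by case: ag => /(_ _ rK).
- move=> _ _ /code_at_cons[u1 _]; case: st u1 => p x n X N /= u1.
  eexists; split; first exact: (reach_step (st := State p x n X N) u1).
  + by rewrite /= addn1.
  + by split=> //= r' rk; rewrite upd_lt.
  + by rewrite /= upd_eq.
- move=> /andP[w1 w2] ag /code_at_cat[c1 /code_at_cat[c2 /code_at_cons[u8 _]]].
  have [st1 [r1 p1 k1 v1]] := IH1 k st Kk w1 ag c1.
  have ag1 := agree_keep Kk ag k1.
  rewrite -p1 in c2 u8.
  have [st2 [r2 p2 k2 v2]] := IH2 k.+1 st1 (leqW Kk) w2 ag1 c2.
  rewrite -p2 in u8.
  eexists; split.
  + by rewrite !size_cat addnA; apply: reach_trans (reach_trans r1 r2) (reach_step u8).
  + by rewrite !size_cat; case: (st2) p2 => /= *; lia.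
  + apply: keep_trans k1 (keep_trans (keep_le (leqnSn k) k2) _).
    by case: (st2) => p x n X N; split=> //= r rk; rewrite upd_lt.
  + have -> : rreg (exec (ROp o k k k.+1) st2) k = eval_arith o (rreg st2 k) (rreg st2 k.+1).
      by case: (st2) => p x n X N /=; rewrite upd_eq.
    by rewrite v2; case: k2 => -> //; rewrite v1.
- move=> w ag /code_at_cat[c1 /code_at_cons[u9 _]].
  have [st1 [r1 p1 k1 v1]] := IH k st Kk w ag c1.
  rewrite -p1 in u9.
  eexists; split.
  + by rewrite size_cat; apply: reach_trans r1 (reach_step u9).
  + by rewrite !size_cat; case: (st1) p1 => /= *; lia.
  + apply: keep_trans k1 _.
    by case: (st1) => p x n X N; split=> //= r rk; rewrite upd_lt.
  + by rewrite -v1; case: (st1) => p x n X N /=; rewrite upd_eq.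
- move=> w ag /code_at_cat[c1 /code_at_cons[u9 _]].
  have [st1 [r1 p1 k1 v1]] := cn_ok Kk w ag c1.
  rewrite -p1 in u9; have [_ _ e3 _] := agree_keep Kk ag k1.
  eexists; split.
  + by rewrite size_cat; apply: reach_trans r1 (reach_step u9).
  + by rewrite !size_cat; case: (st1) p1 => /= *; lia.
  + apply: keep_trans k1 _.
    by case: (st1) => p x n X N; split=> //= r rk; rewrite upd_lt.
  + by rewrite -e3 -v1; case: (st1) => p x n X N /=; rewrite upd_eq.
Qed.

Lemma cb_ok b k m st : (K <= k)%N -> wfb b -> agree m st -> code_at (pc st) (cb b k (pc st)) ->
  calc (cb b k (pc st)) k st (fun st' => nreg st' k = beval m b).
Proof.
elim: b k st => [e1 e2|e1 e2|b IH|b1 IH1 b2 IH2] k st Kk /=.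
- move=> /andP[w1 w2] ag.
  move=> /code_at_cat[/code_at_cat[c1 c2] /code_at_cons[u1 /code_at_cons[u2 /code_at_cons[u3 _]]]].
  have [st1 [r1 p1 k1 v1]] := cr_ok Kk w1 ag c1.
  have ag1 := agree_keep Kk ag k1.
  rewrite -p1 in c2.
  have [st2 [r2 p2 k2 v2]] := cr_ok (leqW Kk) w2 ag1 c2.
  have v1' : rreg st2 k = reval m e1 by case: k2 => ->.
  have P2 : pc st2 = (pc st + size (cr e1 k ++ cr e2 k.+1))%N.
    by rewrite p2 p1 size_cat addnA.
  rewrite -P2 in u1 u2 u3 *.
  have k02 := keep_trans k1 (keep_le (leqnSn k) k2).
  have r02 := reach_trans r1 r2; rewrite -size_cat in r02.
  set L := size (_ ++ _) in r02 P2 *.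
  case: st2 v2 v1' P2 u1 u2 u3 k02 r02 {r2 p2 k2} => p x n X N /= v2 v1' P2 u1 u2 u3 k02 r02.
  have ra : reach st (L + 1) (State p.+1 x (upd n k 1%N) X N).
    exact: reach_trans r02 (reach_step (st := State p x n X N) u1).
  have rb : reach (State p.+1 x (upd n k 1%N) X N) 1
      (State (if x k < x k.+1 then (p + 3)%N else p.+2) x (upd n k 1%N) X N).
    exact: (reach_step (st := State p.+1 x (upd n k 1%N) X N) u2).
  have kp (v : nat) p' : keep k st (State p' x (upd n k v) X N).
    apply: keep_trans k02 _; split=> //= r rk; exact: upd_lt.
  rewrite -v1' -v2; case: ifPn rb => lt rb.
    exists (State (p + 3)%N x (upd n k 1%N) X N); split=> //=.
    + apply: reach_le (reach_trans ra rb); rewrite size_cat /= -/L; lia.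
    + by rewrite size_cat /= P2 -/L addnA.
    + by rewrite upd_eq.
  have rc : reach (State p.+2 x (upd n k 1%N) X N) 1 (State p.+3 x (upd (upd n k 1%N) k 0%N) X N).
    exact: (reach_step (st := State p.+2 x (upd n k 1%N) X N) u3).
  exists (State p.+3 x (upd (upd n k 1%N) k 0%N) X N); split=> //=.
  + apply: reach_le (reach_trans ra (reach_trans rb rc)); rewrite size_cat /= -/L; lia.
  + by rewrite size_cat /= P2 -/L; lia.
  + by apply: keep_trans (kp 1%N p) _; split=> //= r rk; rewrite !upd_lt.
  + by rewrite upd_eq.
- move=> /andP[w1 w2] ag.
  move=> /code_at_cat[/code_at_cat[c1 c2] /code_at_cons[u1 /code_at_cons[u2 /code_at_cons[u3 /code_at_cons[u4 _]]]]].
  have [st1 [r1 p1 k1 v1]] := cn_ok Kk w1 ag c1.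
  have ag1 := agree_keep Kk ag k1.
  rewrite -p1 in c2.
  have [st2 [r2 p2 k2 v2]] := cn_ok (leqW Kk) w2 ag1 c2.
  have v1' : nreg st2 k = neval m e1 by case: k2 => _ ->.
  have P2 : pc st2 = (pc st + size (cn e1 k ++ cn e2 k.+1))%N.
    by rewrite p2 p1 size_cat addnA.
  rewrite -P2 in u1 u2 u3 u4 *.
  have k02 := keep_trans k1 (keep_le (leqnSn k) k2).
  have r02 := reach_trans r1 r2; rewrite -size_cat in r02.
  set L := size (_ ++ _) in r02 P2 *.
  case: st2 v2 v1' P2 u1 u2 u3 u4 k02 r02 {r2 p2 k2} => p x n X N /= v2 v1' P2 u1 u2 u3 u4 k02 r02.
  have rb : reach (State p x n X N) 1
      (State (if (n k < n k.+1)%N then (p + 3)%N else p.+1) x n X N).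
    exact: (reach_step (st := State p x n X N) u1).
  have kp (v : nat) p' : keep k st (State p' x (upd n k v) X N).
    apply: keep_trans k02 _; split=> //= r rk; exact: upd_lt.
  rewrite -v1' -v2; case: ifPn rb => lt rb.
    have rc : reach (State (p + 3)%N x n X N) 1 (State (p + 3).+1 x (upd n k 1%N) X N).
      have u4' : onth prog (p + 3) = Some (NConst k 1) by rewrite addn3.
      exact: (reach_step (st := State (p + 3)%N x n X N) u4').
    exists (State (p + 3).+1 x (upd n k 1%N) X N); split=> //=.
    + apply: reach_le (reach_trans r02 (reach_trans rb rc)); rewrite size_cat /= -/L; lia.
    + by rewrite size_cat /= P2 -/L; lia.
    + by rewrite upd_eq.
  have rc : reach (State p.+1 x n X N) 1 (State p.+2 x (upd n k 0%N) X N).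
    exact: (reach_step (st := State p.+1 x n X N) u2).
  have rd : reach (State p.+2 x (upd n k 0%N) X N) 1 (State (p + 4)%N x (upd n k 0%N) X N).
    exact: (reach_step (st := State p.+2 x (upd n k 0%N) X N) u3).
  exists (State (p + 4)%N x (upd n k 0%N) X N); split=> //=.
  + apply: reach_le (reach_trans r02 (reach_trans rb (reach_trans rc rd))); rewrite size_cat /= -/L; lia.
  + by rewrite size_cat /= P2 -/L; lia.
  + by rewrite upd_eq.
- move=> w ag /code_at_cat[c1 /code_at_cons[u1 /code_at_cons[u2 _]]].
  have [st1 [r1 p1 k1 v1]] := IH k st Kk w ag c1.
  rewrite -p1 in u1 u2.
  set L := size (cb _ _ _) in r1 p1 *.
  case: st1 r1 p1 k1 v1 u1 u2 => p x n X N /= r1 p1 k1 v1 u1 u2.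
  have ra : reach (State p x n X N) 1 (State p.+1 x (upd n k.+1 1%N) X N).
    exact: (reach_step (st := State p x n X N) u1).
  have rb := reach_step (st := State p.+1 x (upd n k.+1 1%N) X N) u2.
  eexists; split.
  + by rewrite size_cat; apply: reach_trans r1 (reach_trans ra rb).
  + by rewrite size_cat /= p1 -/L addn2 !addnS.
  + apply: keep_trans k1 _; split=> //= r rk; rewrite !upd_lt // ltnS; exact: ltnW.
  + by rewrite /= upd_eq upd_eq upd_lt // v1; case: (beval m b).
- move=> /andP[w1 w2] ag.
  move=> /code_at_cat[c1 /code_at_cat[c2 /code_at_cons[u1 /code_at_cons[u2 /code_at_cons[u3 _]]]]].
  have [st1 [r1 p1 k1 v1]] := IH1 k st Kk w1 ag c1.
  have ag1 := agree_keep Kk ag k1.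
  rewrite -p1 in c2 u1 u2 u3 *.
  have [st2 [r2 p2 k2 v2]] := IH2 k.+1 st1 (leqW Kk) w2 ag1 c2.
  rewrite -p2 in u1 u2 u3.
  have v1' : nreg st2 k = beval m b1 by case: k2 => _ ->.
  have k02 := keep_trans k1 (keep_le (leqnSn k) k2).
  have r02 := reach_trans r1 r2.
  case: st2 r02 p2 k02 v2 v1' u1 u2 u3 {r2 k2} => p x n X N /= r02 p2 k02 v2 v1' u1 u2 u3.
  have ra := reach_step (st := State p x n X N) u1.
  have rb := reach_step (st := exec (NAdd k k k.+1) (State p x n X N)) u2.
  have rc := reach_step (st := exec (NConst k.+1 1) (exec (NAdd k k k.+1) (State p x n X N))) u3.
  eexists; split.
  + by rewrite !size_cat addnA; apply: reach_trans r02 (reach_trans ra (reach_trans rb rc)).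
  + by rewrite !size_cat /= p2 p1; lia.
  + by apply: keep_trans k02 _; split=> //= r rk; rewrite !upd_lt // ltnS; exact: ltnW.
  + rewrite /= !upd_eq upd_lt // upd_eq v1' v2.
    by case: (beval m b1); case: (beval m b2).
Qed.

Lemma size_cb b k p p' : size (cb b k p) = size (cb b k p').
Proof.
elim: b k p p' => [e1 e2|e1 e2|b IH|b1 IH1 b2 IH2] k p p' /=; rewrite !size_cat //=.
  by rewrite (IH k p p').
by rewrite (IH1 k p p') (IH2 k.+1 _ (p' + size (cb b1 k p'))).
Qed.

Lemma size_cc c p p' : size (cc c p) = size (cc c p').
Proof.
elim: c p p' => [|r e|r e|A i e|A i e|c1 IH1 c2 IH2|b c1 IH1 c2 IH2|b c IH] p p' //=.
- by rewrite !size_cat (IH1 p p') (IH2 _ (p' + size (cc c1 p'))).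
- by rewrite !size_cat /= !size_cat /= (size_cb b K p p') (IH2 _ p') (IH1 _ p')
    (IH2 (p' + _ + _) p') (IH1 (p' + _ + _ + _ + _) p').
- by rewrite !size_cat /= !size_cat (size_cb b K p p') (IH _ p') (IH (p' + _ + _) p').
Qed.

(** [M] stays fixed while the induction descends to subcommands, so that every unit counted by [run]
    is charged equally many machine steps. *)
Lemma cc_ok c m m' k : run c m m' k -> forall M st, wfc c -> (size (cc c 0) <= M)%N ->
  agree m st -> code_at (pc st) (cc c (pc st)) ->
  exists st', [/\ reach st (M * k) st', pc st' = (pc st + size (cc c 0))%N & agree m' st'].
Proof.
elim=> {c m m' k}.
- move=> m M st _ _ ag _; exists st; split=> //; first by rewrite muln0; exact: reach0.
  by rewrite /= addn0.
- move=> r e m M st /andP[rK we] sM ag /code_at_cat[c1 /code_at_cons[u1 /code_at_cons[u2 _]]].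
  have [st1 [r1 p1 k1 v1]] := cr_ok (leqnn K) we ag c1.
  rewrite -p1 in u1 u2; have [a1 b1 d1 e1] := agree_keep (leqnn K) ag k1.
  have ra := reach_step u1.
  case: st1 r1 p1 k1 v1 a1 b1 d1 e1 u1 u2 ra => p x n X N /= r1 p1 k1 v1 a1 b1 d1 e1 u1 u2 ra.
  have rb := reach_step (st := State p.+1 (upd x r 0) n X N) u2.
  eexists; split.
  + rewrite muln1; apply: reach_le sM _; rewrite /= size_cat.
    exact: reach_trans r1 (reach_trans ra rb).
  + by rewrite /= size_cat /= p1; lia.
  + have uK : upd x r 0 K = x K by rewrite /upd gtn_eqF.
    by split=> //= r' rK'; rewrite upd_eq add0r uK v1 /upd; case: eqP => // _; exact: a1.
- move=> r e m M st /andP[rK we] sM ag /code_at_cat[c1 /code_at_cons[u1 /code_at_cons[u2 _]]].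
  have [st1 [r1 p1 k1 v1]] := cn_ok (leqnn K) we ag c1.
  rewrite -p1 in u1 u2; have [a1 b1 d1 e1] := agree_keep (leqnn K) ag k1.
  have ra := reach_step u1.
  case: st1 r1 p1 k1 v1 a1 b1 d1 e1 u1 u2 ra => p x n X N /= r1 p1 k1 v1 a1 b1 d1 e1 u1 u2 ra.
  have rb := reach_step (st := State p.+1 x (upd n r 0%N) X N) u2.
  eexists; split.
  + rewrite muln1; apply: reach_le sM _; rewrite /= size_cat.
    exact: reach_trans r1 (reach_trans ra rb).
  + by rewrite /= size_cat /= p1; lia.
  + have uK : upd n r 0%N K = n K by rewrite /upd gtn_eqF.
    by split=> //= r' rK'; rewrite upd_eq add0n uK v1 /upd; case: eqP => // _; exact: b1.
- move=> A i e m M st /andP[wi we] sM ag /code_at_cat[c1 /code_at_cat[c2 /code_at_cons[u1 _]]].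
  have [st1 [r1 p1 k1 v1]] := cn_ok (leqnn K) wi ag c1.
  rewrite -p1 in c2 u1; have ag1 := agree_keep (leqnn K) ag k1.
  have [st2 [r2 p2 k2 v2]] := cr_ok (leqnSn K) we ag1 c2.
  rewrite -p2 in u1; have [a2 b2 d2 e2] := agree_keep (leqnSn K) ag1 k2.
  have v1' : nreg st2 K = neval m i by case: k2 => _ ->.
  have ra := reach_step u1.
  eexists; split.
  + rewrite muln1; apply: reach_le sM _; rewrite /= !size_cat addnA.
    exact: reach_trans (reach_trans r1 r2) ra.
  + by rewrite /= !size_cat /=; case: (st2) p2 => /= *; lia.
  + case: (st2) v2 v1' a2 b2 d2 e2 => p x n X N /= -> -> a2 b2 d2 e2.
    by split=> //=; rewrite d2.
- move=> A i e m M st /andP[wi we] sM ag /code_at_cat[c1 /code_at_cat[c2 /code_at_cons[u1 _]]].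
  have [st1 [r1 p1 k1 v1]] := cn_ok (leqnn K) wi ag c1.
  rewrite -p1 in c2 u1; have ag1 := agree_keep (leqnn K) ag k1.
  have [st2 [r2 p2 k2 v2]] := cn_ok (leqnSn K) we ag1 c2.
  rewrite -p2 in u1; have [a2 b2 d2 e2] := agree_keep (leqnSn K) ag1 k2.
  have v1' : nreg st2 K = neval m i by case: k2 => _ ->.
  have ra := reach_step u1.
  eexists; split.
  + rewrite muln1; apply: reach_le sM _; rewrite /= !size_cat addnA.
    exact: reach_trans (reach_trans r1 r2) ra.
  + by rewrite /= !size_cat /=; case: (st2) p2 => /= *; lia.
  + case: (st2) v2 v1' a2 b2 d2 e2 => p x n X N /= -> -> a2 b2 d2 e2.
    by split=> //=; rewrite e2.
- move=> c1 c2 m m1 m2 k1 k2 _ IH1 _ IH2 M st /andP[w1 w2] /= sM ag /code_at_cat[d1 d2].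
  have s1 := size_cc c1 0 (pc st); have s2 := size_cc c2 (0 + size (cc c1 0)) 0.
  rewrite size_cat s2 in sM *.
  have [st1 [r1 p1 a1]] := IH1 M st w1 (leq_trans (leq_addr _ _) sM) ag d1.
  rewrite -s1 -p1 in d2.
  have [st2 [r2 p2 a2]] := IH2 M st1 w2 (leq_trans (leq_addl _ _) sM) a1 d2.
  exists st2; split=> //; first by rewrite mulnDr; apply: reach_trans r1 r2.
  by rewrite p2 p1 addnA.
- move=> b c1 c2 m m' k _ IH M st /= /and3P[wb w1 w2] sM ag.
  set t := cb b K (pc st).
  set d2 := cc c2 (pc st + size t + 2).
  set d1 := cc c1 (pc st + size t + 2 + size d2 + 1).
  have st0 : size (cb b K 0) = size t by exact: size_cb.
  have sd2 : size (cc c2 0) = size d2 by exact: size_cc.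
  have sd1 : size (cc c1 0) = size d1 by exact: size_cc.
  rewrite !size_cat /= !size_cat /= st0 (size_cc c2 _ 0) sd2 (size_cc c1 _ 0) sd1 in sM *.
  move=> /code_at_cat[ct /code_at_cons[u1 /code_at_cons[u2 /code_at_cat[cd2 /code_at_cons[u3 cd1]]]]].
  have [st1 [r1 p1 k1 v1]] := cb_ok (leqnn K) wb ag ct.
  rewrite -/t in r1 p1.
  have ag1 := agree_keep (leqnn K) ag k1.
  rewrite -p1 in u1 u2 cd2 u3 cd1 *.
  have ra := reach_step u1.
  set st2 := exec _ st1 in ra.
  have e2 : pc st2 = (pc st1).+1 by rewrite /st2; case: (st1).
  have rb := reach_step (st := st2) (i := NJumpLt K.+1 K (pc st1 + 2 + size d2 + 1)) ltac:(by rewrite e2).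
  set st3 := exec _ st2 in rb.
  have ag3 : agree m st3.
    apply: agree_keep (leqnn K) ag1 _; rewrite /st3 /st2.
    by case: (st1) => p x n X N; split=> //= r rk; rewrite upd_lt // ltnS ltnW.
  have e3 : pc st3 = if beval m b then (pc st1 + 2 + size d2 + 1)%N else (pc st1).+2.
    rewrite /st3 /st2; case: (st1) v1 => p x n X N /= v1.
    by rewrite upd_eq upd_lt // v1; case: (beval m b).
  have r03 := reach_trans r1 (reach_trans ra rb).
  case: ifPn e3 IH => hb e3 IH.
    have [||st4 [r4 p4 a4]] := IH M st3 w1 _ ag3 _.
    + by rewrite sd1; lia.
    + rewrite e3 /d1; move: cd1; rewrite -/d1.
      have -> : (pc st1 + 2 + size d2 + 1 = (pc st1 + 2 + size d2).+1)%N by lia.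
      by rewrite /d1 p1 addn2 addn1 !addSn.
    exists st4; split=> //.
    + apply: reach_le (reach_trans r03 r4); rewrite mulnS; lia.
    + by rewrite p4 e3 sd1; lia.
  have [||st4 [r4 p4 a4]] := IH M st3 w2 _ ag3 _.
  + by rewrite sd2; lia.
  + have eD : d2 = cc c2 (pc st3) by rewrite e3 p1 /d2 addn2.
    by rewrite -eD e3; exact: cd2.
  have e4 : pc st4 = ((pc st1).+2 + size d2)%N by rewrite p4 e3 sd2.
  have rj := reach_step (st := st4) ltac:(rewrite e4; exact: u3).
  eexists; split.
  + apply: reach_le (reach_trans r03 (reach_trans r4 rj)); rewrite mulnS; lia.
  + by case: (st4) => /= *; lia.
  + by case: (st4) a4.
- move=> b c m nb M st /= /andP[wb w] sM ag.
  set t := cb b K (pc st).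
  set d := cc c (pc st + size t + 3).
  have st0 : size (cb b K 0) = size t by exact: size_cb.
  have sd : size (cc c 0) = size d by exact: size_cc.
  rewrite !size_cat /= !size_cat /= st0 (size_cc c _ 0) sd in sM *.
  move=> /code_at_cat[ct /code_at_cons[u1 /code_at_cons[u2 /code_at_cons[u3 _]]]].
  have [st1 [r1 p1 k1 v1]] := cb_ok (leqnn K) wb ag ct.
  rewrite -/t in r1 p1.
  have ag1 := agree_keep (leqnn K) ag k1.
  rewrite -p1 in u1 u2 u3 *.
  have ra := reach_step u1.
  set st2 := exec _ st1 in ra.
  have e2 : pc st2 = (pc st1).+1 by rewrite /st2; case: (st1).
  have rb := reach_step (st := st2) (i := NJumpLt K.+1 K (pc st1 + 3)) ltac:(by rewrite e2).
  set st3 := exec _ st2 in rb.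
  have ag3 : agree m st3.
    apply: agree_keep (leqnn K) ag1 _; rewrite /st3 /st2.
    by case: (st1) => p x n X N; split=> //= r rk; rewrite upd_lt // ltnS ltnW.
  have e3 : pc st3 = (pc st1).+2.
    rewrite /st3 /st2; case: (st1) v1 => p x n X N /= v1.
    by rewrite upd_eq upd_lt // v1 (negPf nb).
  have rc := reach_step (st := st3) ltac:(rewrite e3; exact: u3).
  eexists; split.
  + apply: reach_le (reach_trans r1 (reach_trans ra (reach_trans rb rc))); rewrite muln1; lia.
  + by case: (st3) => /= *; lia.
  + by case: (st3) ag3.
- move=> b c m m1 m2 k1 k2 tb _ IH1 _ IH2 M st /= /andP[wb w] sM ag CA.
  have CA' := CA; move: CA'.
  set t := cb b K (pc st).
  set d := cc c (pc st + size t + 3).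
  have st0 : size (cb b K 0) = size t by exact: size_cb.
  have sd : size (cc c 0) = size d by exact: size_cc.
  have sM' := sM.
  rewrite !size_cat /= !size_cat /= st0 (size_cc c _ 0) sd in sM' *.
  move=> /code_at_cat[ct /code_at_cons[u1 /code_at_cons[u2 /code_at_cons[u3 /code_at_cat[cd /code_at_cons[u4 _]]]]]].
  have [st1 [r1 p1 kk v1]] := cb_ok (leqnn K) wb ag ct.
  rewrite -/t in r1 p1.
  have ag1 := agree_keep (leqnn K) ag kk.
  rewrite -p1 in u1 u2 u3 cd u4.
  have ra := reach_step u1.
  set st2 := exec _ st1 in ra.
  have e2 : pc st2 = (pc st1).+1 by rewrite /st2; case: (st1).
  have rb := reach_step (st := st2) (i := NJumpLt K.+1 K (pc st1 + 3)) ltac:(by rewrite e2).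
  set st3 := exec _ st2 in rb.
  have ag3 : agree m st3.
    apply: agree_keep (leqnn K) ag1 _; rewrite /st3 /st2.
    by case: (st1) => p x n X N; split=> //= r rk; rewrite upd_lt // ltnS ltnW.
  have e3 : pc st3 = (pc st1 + 3)%N.
    rewrite /st3 /st2; case: (st1) v1 => p x n X N /= v1.
    by rewrite upd_eq upd_lt // v1 tb.
  have [||st4 [r4 p4 a4]] := IH1 M st3 w _ ag3 _.
  + by rewrite sd; lia.
  + by rewrite e3 p1; move: cd; rewrite -addn3 p1.
  have e4 : pc st4 = ((pc st1).+3 + size d)%N by rewrite p4 e3 sd addn3.
  have rj := reach_step (st := st4) ltac:(rewrite e4; exact: u4).
  set st5 := exec _ st4 in rj.
  have e5 : pc st5 = pc st by rewrite /st5; case: (st4).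
  have a5 : agree m1 st5 by rewrite /st5; case: (st4) a4.
  have [|||st6 [r6 p6 a6]] := IH2 M st5 _ _ a5 _.
  + by rewrite /= wb.
  + exact: sM.
  + by rewrite e5.
  exists st6; split=> //.
  + apply: reach_le (reach_trans r1 (reach_trans ra (reach_trans rb (reach_trans r4 (reach_trans rj r6))))).
    by rewrite mulnS mulnDr; lia.
  + rewrite p6 e5 /= !size_cat /= !size_cat /= st0 (size_cc c _ 0) sd //.
Qed.

End Correct.
End Compiler.

(** * The program *)

Section Macros.

Definition pexp : Type := (rexp * rexp)%type.
Definition eAdd (x y : rexp) := RBin Defs.Add x y.
Definition eSub (x y : rexp) := RBin Defs.Sub x y.
Definition eMul (x y : rexp) := RBin Defs.Mul x y.
Definition eDiv (x y : rexp) := RBin Defs.Div x y.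
Definition eOpp (x : rexp) := eSub (RCst 0) x.
Definition bLe (x y : rexp) := BNot (BLtR y x).

Definition pSub (a b : pexp) : pexp := (eSub a.1 b.1, eSub a.2 b.2).
Definition eCrs (a b : pexp) := eSub (eMul a.1 b.2) (eMul a.2 b.1).
Definition eDot (a b : pexp) := eAdd (eMul a.1 b.1) (eMul a.2 b.2).
Definition eDist2 (a b : pexp) := eDot (pSub a b) (pSub a b).
Definition pLerp (l : rexp) (a b : pexp) : pexp :=
  (eAdd (eMul (eSub (RCst 1) l) a.1) (eMul l b.1),
   eAdd (eMul (eSub (RCst 1) l) a.2) (eMul l b.2)).
Definition pArr (A B : nat) (i : nexp) : pexp := (RArr A i, RArr B i).
Definition pVar (x y : nat) : pexp := (RVar x, RVar y).
Definition nS (i : nexp) := NPlus i (NCst 1).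
Definition pEd (i : nexp) := pSub (pArr 0 1 (nS i)) (pArr 0 1 i).
Definition eCst (dl : rexp) (i : nexp) :=
  eAdd (eCrs (pEd i) (pArr 0 1 i)) (eMul dl (RRoot (eDot (pEd i) (pEd i)))).
Definition eDet3 (dl : rexp) (p t x : nexp) :=
  eSub (eAdd (eMul (eCrs (pEd t) (pEd x)) (eCst dl p)) (eMul (eCrs (pEd p) (pEd t)) (eCst dl x)))
       (eMul (eCrs (pEd p) (pEd x)) (eCst dl t)).
Definition bPopped (dl : rexp) (p t x : nexp) :=
  BAnd (BLtR (RCst 0) (eCrs (pEd p) (pEd t))) (BAnd (BLtR (RCst 0) (eCrs (pEd t) (pEd x)))
    (BAnd (BLtR (RCst 0) (eCrs (pEd p) (pEd x))) (bLe (RCst 0) (eDet3 dl p t x)))).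
Definition bTouch (rho : rexp) (c u x : pexp) :=
  BNot (BAnd (BLtR (eMul rho rho) (eDist2 u c)) (BAnd (BLtR (eMul rho rho) (eDist2 x c))
    (BNot (BAnd (BLtR (RCst 0) (eDot (pSub c u) (pSub x u)))
      (BAnd (BLtR (eDot (pSub c u) (pSub x u)) (eDist2 x u))
       (BNot (BLtR (eMul (eMul rho rho) (eDist2 x u))
          (eMul (eCrs (pSub c u) (pSub x u)) (eCrs (pSub c u) (pSub x u)))))))))).

Definition eCirc2 (A B : pexp) := eDist2 B A.
Definition eCirc1 (c A B : pexp) := eDot (pSub A c) (pSub B A).
Definition eCirc0 (rho : rexp) (c A : pexp) := eSub (eDist2 A c) (eMul rho rho).
Definition eTang2 (rho : rexp) (c u A B : pexp) :=
  eSub (eMul (eCrs (pSub c u) (pSub B A)) (eCrs (pSub c u) (pSub B A)))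
       (eMul (eMul rho rho) (eDist2 B A)).
Definition eTang1 (rho : rexp) (c u A B : pexp) :=
  eSub (eMul (eCrs (pSub c u) (pSub A u)) (eCrs (pSub c u) (pSub B A)))
       (eMul (eMul rho rho) (eDot (pSub A u) (pSub B A))).
Definition eTang0 (rho : rexp) (c u A : pexp) :=
  eSub (eMul (eCrs (pSub c u) (pSub A u)) (eCrs (pSub c u) (pSub A u)))
       (eMul (eMul rho rho) (eDist2 A u)).
Definition eRoot1 (a b d : rexp) :=
  eDiv (eSub (eOpp b) (RRoot (eSub (eMul b b) (eMul a d)))) a.
Definition eRoot2 (a b d : rexp) :=
  eDiv (eAdd (eOpp b) (RRoot (eSub (eMul b b) (eMul a d)))) a.
Definition eRoot3 (b d : rexp) := eDiv (eOpp d) (eMul (RCst 2) b).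
Definition eCandidates (rho : rexp) (c u A B : pexp) : seq rexp :=
  let c2 := eCirc2 A B in let c1 := eCirc1 c A B in let c0 := eCirc0 rho c A in
  let t2 := eTang2 rho c u A B in let t1 := eTang1 rho c u A B in let t0 := eTang0 rho c u A in
  [:: RCst 1; eRoot1 c2 c1 c0; eRoot2 c2 c1 c0; eRoot1 t2 t1 t0; eRoot2 t2 t1 t0; eRoot3 t1 t0].

Context {R : realType}.
Implicit Types m : mem R.

Definition peval m (p : pexp) : pt R := (reval m p.1, reval m p.2).

Lemma eval_crs m a b : reval m (eCrs a b) = crs (peval m a) (peval m b).
Proof. by []. Qed.

Lemma eval_lerp m l a b : peval m (pLerp l a b) = lerp (reval m l) (peval m a) (peval m b).
Proof. by []. Qed.

Lemma eval_touch m rho c u x : beval m (bTouch rho c u x) =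
  touchb (reval m rho) (peval m c) (peval m u) (peval m x).
Proof. by rewrite /touchb !expr2. Qed.

Lemma eval_dist2 m a b : reval m (eDist2 a b) = dist2 (peval m a) (peval m b).
Proof. by []. Qed.

Lemma eval_circ1 m c A B : reval m (eCirc1 c A B) = circ1 (peval m c) (peval m A) (peval m B).
Proof. by []. Qed.

Lemma eval_circ0 m rho c A :
  reval m (eCirc0 rho c A) = circ0 (reval m rho) (peval m c) (peval m A).
Proof. by rewrite /circ0 expr2. Qed.

Lemma eval_tang2 m rho c u A B : reval m (eTang2 rho c u A B) =
  tang2 (reval m rho) (peval m c) (peval m u) (peval m A) (peval m B).
Proof. by rewrite /tang2 !expr2. Qed.

Lemma eval_tang1 m rho c u A B : reval m (eTang1 rho c u A B) =
  tang1 (reval m rho) (peval m c) (peval m u) (peval m A) (peval m B).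
Proof. by rewrite /tang1 !expr2. Qed.

Lemma eval_tang0 m rho c u A : reval m (eTang0 rho c u A) =
  tang0 (reval m rho) (peval m c) (peval m u) (peval m A).
Proof. by rewrite /tang0 !expr2. Qed.

Lemma eval_root1 m a b d :
  reval m (eRoot1 a b d) = root1 (reval m a) (reval m b) (reval m d).
Proof. by rewrite /root1 -[- reval m b]sub0r. Qed.

Lemma eval_root2 m a b d :
  reval m (eRoot2 a b d) = root2 (reval m a) (reval m b) (reval m d).
Proof. by rewrite /root2 -[- reval m b]sub0r. Qed.

Lemma eval_root3 m b d : reval m (eRoot3 b d) = root3 (reval m b) (reval m d).
Proof. by rewrite /root3 -[- reval m d]sub0r. Qed.

Lemma eval_candidates m rho c u A B : map (reval m) (eCandidates rho c u A B) =
  candidates (reval m rho) (peval m c) (peval m u) (peval m A) (peval m B).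
Proof.
rewrite /eCandidates /candidates; cbn [map].
rewrite !eval_root1 !eval_root2 !eval_root3.
by rewrite eval_dist2 eval_circ1 eval_circ0 eval_tang2 eval_tang1 eval_tang0.
Qed.

Definition holds_q (q : seq (pt R)) (M : nat) m : Prop :=
  forall i, (i <= M)%N -> (mra m 0 i, mra m 1 i) = vx q i.

Section Lines.
Variables (q : seq (pt R)) (dl : R) (M : nat) (m : mem R) (edl : rexp).
Hypothesis hq : holds_q q M m.
Hypothesis hdl : reval m edl = dl.

Lemma eval_vx e : (neval m e <= M)%N -> peval m (pArr 0 1 e) = vx q (neval m e).
Proof. exact: hq. Qed.

Lemma eval_ed e : (neval m e < M)%N -> peval m (pEd e) = ed q (neval m e).
Proof.
move=> eM; rewrite /ed -(hq eM) -(hq (ltnW eM)).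
by rewrite /peval /pEd /pSub /vsub /= addn1.
Qed.

Lemma eval_cst e : (neval m e < M)%N -> reval m (eCst edl e) = cst q dl (neval m e).
Proof.
move=> eM; have h1 := eval_ed eM; have h2 := eval_vx (ltnW eM).
by rewrite /cst -h1 -h2 -hdl.
Qed.

Lemma eval_popped p t x : (neval m p < M)%N -> (neval m t < M)%N -> (neval m x < M)%N ->
  beval m (bPopped edl p t x) = popped q dl (neval m p) (neval m t) (neval m x).
Proof.
move=> hp ht hx; rewrite /popped /det3 -!eval_cst // -!eval_ed // /=.
by rewrite -leNgt.
Qed.

End Lines.
End Macros.

Section Loops.
Context {R : realType}.
Implicit Types (m : mem R) (Q : mem R -> nat -> Prop).

(* The potential [phi] pays for the time that the loop still needs. *)
Lemma wp_loop b c (I : mem R -> Prop) (phi : mem R -> nat) Q m T : I m ->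
  (forall m T, I m -> beval m b ->
     wp c (fun m' T' => I m' /\ (T' + phi m' < T + phi m)%N) m T) ->
  (forall m' T', I m' -> ~~ beval m' b -> (T' <= T + phi m + 1)%N -> Q m' T') ->
  wp (CWhile b c) Q m T.
Proof.
move=> i0 body stop.
apply: (wp_while (I := fun m' T' => I m' /\ (T' + phi m' <= T + phi m)%N) (mu := phi)) => //.
  move=> m1 T1 [i1 t1] b1; have [m2 [k [r2 [i2 t2]]]] := body m1 T1.+1 i1 b1.
  exists m2, k; split=> //; split; [split=> //; lia|lia].
by move=> m1 T1 [i1 t1] b1; apply: stop => //; lia.
Qed.

End Loops.

Lemma eval_le {R : realType} (m : mem R) x y : beval m (bLe x y) = (reval m x <= reval m y).
Proof. by rewrite /= -leNgt. Qed.

Lemma eval_and {R : realType} (m : mem R) b1 b2 :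
  beval m (BAnd b1 b2) = beval m b1 && beval m b2.
Proof. by []. Qed.

Ltac wps := repeat lazymatch goal with
  | |- wp (CSeq _ _) _ _ _ => apply: wp_seq
  | |- wp (CReal _ _) _ _ _ => apply: wp_real
  | |- wp (CNat _ _) _ _ _ => apply: wp_nat
  | |- wp (CRealArr _ _ _) _ _ _ => apply: wp_real_arr
  | |- wp (CNatArr _ _ _) _ _ _ => apply: wp_nat_arr
  | |- wp CSkip _ _ _ => apply: wp_skip
  end.

Notation "c1 ;; c2" := (CSeq c1 c2) (at level 70, right associativity).

(* Real registers: 0 r, 1 eps, 2-3 s, 4 the radius r + eps, 5 the shift r - eps,
   6-7 direction of the best line so far, 8-9 the current point, 10 and 11 parameters
   on an edge. Index registers: 0 the size of the output, 1 the size of Q, 2 loop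
   counter, 3 start index, 4 height of the stack, 5 position in the stack, 6 current
   stop, 7 and 8 end and width of the window, 9 eyelet, 10 last stop. Real arrays: 0-1
   the vertices of Q, listed twice to avoid reductions modulo n, 2-3 the output, 4-5
   the stops. Index array 0 is the stack. *)
Section Phases.
Context {R : realType}.
Variables (q V : seq (pt R)) (r eps : R) (s : pt R).
Notation n := (size q).
Notation N := (size V).
Notation rho := (r + eps).
Notation dl := (r - eps).
Notation Ln := (line q dl).
Hypothesis ccwq : ccw_polygon q.
Let n2 : (2 < n)%N := size_ccw ccwq.
Let n0 : (0 < n)%N := ltn_trans (isT : (0 < 2)%N) n2.
Implicit Types m : mem R.

(** The loop makes [n + 1] copies so that vertex [2 n], the end of edge [2 n - 1], is present; the
    last copy reads cell [n], which the loop itself has written. *)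
Definition c_init : cmd :=
  CReal 4 (eAdd (RVar 0) (RVar 1)) ;; CReal 5 (eSub (RVar 0) (RVar 1)) ;;
  CNat 1 (NVar 0) ;; CNat 2 (NCst 0) ;;
  CWhile (BLtN (NVar 2) (nS (NVar 1)))
    (CRealArr 0 (NPlus (NVar 1) (NVar 2)) (RArr 0 (NVar 2)) ;;
     CRealArr 1 (NPlus (NVar 1) (NVar 2)) (RArr 1 (NVar 2)) ;;
     CNat 2 (nS (NVar 2))).

Definition input : mem R :=
  Mem (nth 0 [:: r; eps; s.1; s.2]) (nth 0%N [:: n])
    (fun A => nth 0 (nth [::] [:: map fst q; map snd q] A)) (fun _ _ => 0%N).

Definition base m : Prop :=
  [/\ mn m 1 = n, (mr m 2, mr m 3) = s, mr m 4 = rho, mr m 5 = dl & holds_q q (n + n) m].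

Lemma init_ok (Q : mem R -> nat -> Prop) T :
  (forall m' T', base m' -> (T' <= T + 20 * n)%N -> Q m' T') -> wp c_init Q input T.
Proof.
move=> HQ; rewrite /c_init; wps => /=.
pose I m := [/\ mn m 1 = n, (mr m 2, mr m 3) = s, mr m 4 = rho, mr m 5 = dl &
  (mn m 2 <= n.+1)%N /\ forall i, (i < n + mn m 2)%N -> (mra m 0 i, mra m 1 i) = vx q i].
apply: (wp_loop (I := I) (phi := fun m => (5 * (n.+1 - mn m 2))%N)).
- rewrite /I /upd /=; split=> //; first by case: (s).
  split=> // i; rewrite addn0 => iN; rewrite vx_small // !(nth_map (0, 0)) //.
  by rewrite -surjective_pairing.
- move=> m T1 [h1 h2 h3 h4 [h5 h6]] /=; rewrite h1 => hb.
  wps; rewrite /I /upd /= h1; split; last lia.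
  split=> //; split; first lia.
  move=> i iN; have hj := h6 (mn m 2) ltac:(lia).
  have [->|ne] := eqVneq i (n + mn m 2)%N; last by apply: h6; lia.
  have [z|z] := eqVneq (n + mn m 2)%N (mn m 2); first lia.
  by rewrite addnC vx_addN -hj.
- move=> m' T' [h1 h2 h3 h4 [h5 h6]] /=; rewrite h1 => hb tm; apply: HQ; last by move: tm => /=; lia.
  by split=> // i iM; apply: h6; lia.
Qed.

(** Several shifted lines may pass through [s]; the one that turns furthest to the left carries the
    edge leaving [s]. The initial direction 0 has cross product 0 with all others, so the first line
    found is accepted. *)
Definition c_scan : cmd :=
  CNat 2 (NCst 0) ;; CReal 6 (RCst 0) ;; CReal 7 (RCst 0) ;;
  CWhile (BLtN (NVar 2) (NVar 1))
    (CIf (BAnd (BAnd (bLe (eSub (eCrs (pEd (NVar 2)) (pVar 2 3)) (eCst (RVar 5) (NVar 2))) (RCst 0))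
                     (bLe (RCst 0) (eSub (eCrs (pEd (NVar 2)) (pVar 2 3)) (eCst (RVar 5) (NVar 2)))))
               (bLe (RCst 0) (eCrs (pVar 6 7) (pEd (NVar 2)))))
      (CNat 3 (NVar 2) ;; CReal 6 (pEd (NVar 2)).1 ;; CReal 7 (pEd (NVar 2)).2)
      CSkip ;;
     CNat 2 (nS (NVar 2))).

Lemma scan_ok (b : nat) (Q : mem R -> nat -> Prop) m T : base m -> (b < n)%N ->
  Ln b s = 0 -> (forall j, Ln j s = 0 -> 0 <= crs (ed q j) (ed q b)) ->
  (forall j, (j < n)%N -> Ln j s = 0 -> crs (ed q j) (ed q b) = 0 -> j = b) ->
  (forall m' T', base m' -> mn m' 3 = b -> (T' <= T + 10 * n)%N -> Q m' T') ->
  wp c_scan Q m T.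
Proof.
move=> bm bn b0 bmax buniq HQ; rewrite /c_scan; wps => /=.
pose I m := [/\ base m, (mn m 2 <= n)%N,
  (mr m 6, mr m 7) = (0, 0) \/ exists2 i, Ln i s = 0 & (mr m 6, mr m 7) = ed q i &
  ((b < mn m 2)%N -> mn m 3 = b /\ (mr m 6, mr m 7) = ed q b)].
apply: (wp_loop (I := I) (phi := fun m => (6 * (n - mn m 2))%N)).
- rewrite /I /upd /=; split; [by case: bm|by []|by left|by []].
- move=> m1 T1 [bm1 jn best after] /=; have [h1 h2 h3 h4 h5] := bm1; rewrite h1 => hj.
  have jM : (neval m1 (NVar 2) < n + n)%N by rewrite /=; lia.
  have eE := eval_ed h5 jM; have cE := eval_cst h5 (h4 : reval m1 (RVar 5) = dl) jM.
  have actE : reval m1 (eSub (eCrs (pEd (NVar 2)) (pVar 2 3)) (eCst (RVar 5) (NVar 2))) = Ln (mn m1 2) s.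
    have sE : peval m1 (pVar 2 3) = s by [].
    by rewrite lineE /= -/(reval m1 (eCst _ _)) -cE -sE -eE.
  have crsE : reval m1 (eCrs (pVar 6 7) (pEd (NVar 2))) = crs (mr m1 6, mr m1 7) (ed q (mn m1 2)).
    by rewrite eval_crs eE.
  have condE : beval m1 (BAnd (BAnd (bLe (eSub (eCrs (pEd (NVar 2)) (pVar 2 3)) (eCst (RVar 5) (NVar 2))) (RCst 0))
                     (bLe (RCst 0) (eSub (eCrs (pEd (NVar 2)) (pVar 2 3)) (eCst (RVar 5) (NVar 2)))))
               (bLe (RCst 0) (eCrs (pVar 6 7) (pEd (NVar 2))))) =
      ((Ln (mn m1 2) s <= 0) && (0 <= Ln (mn m1 2) s)) && (0 <= crs (mr m1 6, mr m1 7) (ed q (mn m1 2))).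
    by rewrite !eval_and !eval_le actE crsE.
  apply: wp_seq; apply: wp_if => cond; rewrite condE in cond.
    have {}cond : [/\ Ln (mn m1 2) s <= 0, 0 <= Ln (mn m1 2) s &
        0 <= crs (mr m1 6, mr m1 7) (ed q (mn m1 2))].
      by move: cond => /andP[/andP[? ?] ?].
    case: cond => c1 c2 c3.
    have act : Ln (mn m1 2) s = 0 by apply/eqP; rewrite eq_le c1.
    have e6 : (mr m1 6, mr m1 7) = (mr m1 6, mr m1 7) by [].
    wps; rewrite /I /upd; split; last by rewrite /= ?h1; lia.
    have d1 : reval m1 (pEd (NVar 2)).1 = (ed q (mn m1 2)).1 by rewrite -eE.
    have d2 : reval m1 (pEd (NVar 2)).2 = (ed q (mn m1 2)).2 by rewrite -eE.
    split=> /=.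
    + by case: bm1.
    + by rewrite addn1.
    + right; exists (mn m1 2) => //; rewrite [RHS]surjective_pairing -d1 -d2 //.
    + rewrite addn1 ltnS => bj.
      have e : mn m1 2 = b.
        have [->//|ne] := eqVneq (mn m1 2) b.
        have [_ eb] := after ltac:(lia).
        apply: buniq => //; apply/eqP; rewrite eq_le bmax // andbT.
        by move: c3; rewrite eb crsC; lra.
      by split=> //; rewrite -e -eE /peval /= addn1.
  wps; rewrite /I /upd; split; last by rewrite /= ?h1; lia.
  split=> //=; first by rewrite addn1.
  rewrite addn1 ltnS => bj; have [e|ne] := eqVneq (mn m1 2) b; last by apply: after; lia.
  exfalso; move/negP: cond; apply; rewrite e b0 lexx /=.
  case: best => [->|[i hi ->]]; first by rewrite /crs /=; lra.
  exact: bmax.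
- move=> m' T' [bm' jn best after] /=; have [h1 _ _ _ _] := bm'.
  rewrite h1 -leqNgt => nj tm; have [h3 _] := after (leq_trans bn nj).
  by apply: HQ => //; move: tm; rewrite /upd /=; lia.
Qed.

Notation onL := (on_line q V dl).
Notation E := (ed q).
Hypothesis ccwV : ccw_polygon V.
Hypothesis dl0 : 0 < dl.
Hypothesis hullE : forall x, hull V x <-> forall j, 0 <= Ln j x.
Variables (b f : nat) (a : R).
Hypothesis bn : (b < n)%N.
Hypothesis bf : onL b f.
Notation SO := (stack_ok q V dl b).
Notation e := (b + n).+1.

Lemma stack_pop st top j : (j <= b + n)%N -> SO st top j -> (0 < top)%N ->
  popped q dl (st top.-1) (st top) j -> SO st top.-1 j.
Proof.
move=> jbn [s0 sm sj st_true npop] t0 pop.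
have lt1 : (st top.-1 < st top)%N by apply: sm => //; lia.
split=> //.
- by move=> x y xy yt; apply: sm => //; lia.
- exact: ltn_trans lt1 sj.
- move=> t k tbj tk; have [x xt xE] := st_true t k tbj tk.
  exists x => //; suff : x <> top by lia.
  move=> xe; rewrite xe in xE.
  have ge : (b <= st top.-1)%N.
    by rewrite -s0; case: (posnP top.-1) => [->//|h]; rewrite ltnW // sm //; lia.
  by have := popped_not_true ccwq ccwV dl0 hullE (k := k) lt1 _ pop; rewrite xE; apply=> //; lia.
- by move=> m mt; apply: npop; lia.
Qed.

Lemma stack_push st top j : SO st top j ->
  ~~ ((0 < top)%N && popped q dl (st top.-1) (st top) j) -> SO (upd st top.+1 j) top.+1 j.+1.
Proof.
move=> [s0 sm sj st_true npop] np.
have old x : (x <= top)%N -> upd st top.+1 j x = st x by move=> xt; rewrite upd_lt.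
split.
- by rewrite old.
- move=> x y xy; rewrite leq_eqVlt => /orP[/eqP yt|yt].
    rewrite yt in xy *; rewrite upd_eq old; last lia.
    apply: leq_ltn_trans sj; case: (eqVneq x top) => [->//|xt].
    by rewrite ltnW // sm //; lia.
  by rewrite !old; [apply: sm|..]; lia.
- by rewrite upd_eq.
- move=> t k /andP[bt tj] tk; have [->|tj'] := eqVneq t j.
    by exists top.+1; rewrite ?upd_eq.
  have [x xt xE] := st_true t k ltac:(lia) tk.
  by exists x; rewrite ?old //; lia.
- move=> m; rewrite ltnS leq_eqVlt => /orP[/eqP mt|mt].
    by subst top; rewrite upd_eq !old // in np *; rewrite /= in np.
  by rewrite !old; [apply: npop|..]; lia.
Qed.

Definition c_graham : cmd :=
  CNat 10 (nS (NPlus (NVar 3) (NVar 1))) ;; CNatArr 0 (NCst 0) (NVar 3) ;;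
  CNat 4 (NCst 0) ;; CNat 2 (nS (NVar 3)) ;;
  CWhile (BLtN (NVar 2) (NVar 10))
    (CIf (BAnd (BLtN (NCst 0) (NVar 4))
           (bPopped (RVar 5) (NArr 0 (NMinus (NVar 4) (NCst 1))) (NArr 0 (NVar 4)) (NVar 2)))
      (CNat 4 (NMinus (NVar 4) (NCst 1)))
      (CNat 4 (nS (NVar 4)) ;; CNatArr 0 (NVar 4) (NVar 2) ;; CNat 2 (nS (NVar 2)))).

Lemma graham_ok (Q : mem R -> nat -> Prop) m T : base m -> mn m 3 = b ->
  (forall m' T', base m' -> mn m' 3 = b -> mn m' 10 = e -> SO (mna m' 0) (mn m' 4) e ->
     (T' <= T + 20 * n)%N -> Q m' T') -> wp c_graham Q m T.
Proof.
move=> bm mb HQ; rewrite /c_graham; wps => /=.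
pose I m := [/\ base m, mn m 3 = b, mn m 10 = e, (mn m 2 <= e)%N &
  SO (mna m 0) (mn m 4) (mn m 2)].
(* A push consumes an index worth 2 and adds 1 to the height; a pop lowers the height by 1. Either
   way the potential pays for the round. *)
apply: (wp_loop (I := I) (phi := fun m => (5 * (2 * (e - mn m 2) + mn m 4))%N)).
- have [h1 h2 h3 h4 h5] := bm.
  rewrite /I /upd /= mb h1 !addn1; split=> //; first lia.
  split=> //=.
  + by move=> x y xy yt; lia.
  + by move=> t k tb tk; exists 0%N => //=; lia.
- move=> m1 T1 [bm1 hb he je so] /=; rewrite he => hj.
  have [h1 h2 h3 h4 h5] := bm1; have [s0 sm sj _ _] := so.
  have le x : (x <= mn m1 4)%N -> (mna m1 0 x < n + n)%N.
    move=> xt; apply: leq_ltn_trans (_ : mna m1 0 (mn m1 4) < _)%N.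
      by case: (eqVneq x (mn m1 4)) => [->//|ne]; rewrite ltnW // sm //; lia.
    lia.
  have condE : beval m1 (BAnd (BLtN (NCst 0) (NVar 4))
           (bPopped (RVar 5) (NArr 0 (NMinus (NVar 4) (NCst 1))) (NArr 0 (NVar 4)) (NVar 2))) =
      (0 < mn m1 4)%N && popped q dl (mna m1 0 (mn m1 4).-1) (mna m1 0 (mn m1 4)) (mn m1 2).
    rewrite eval_and (eval_popped h5 (h4 : reval m1 (RVar 5) = dl)) /= ?subn1 //.
    + by apply: le; lia.
    + exact: le.
    + lia.
  apply: wp_if => cond; rewrite condE in cond.
    have [t0 pop] := andP cond; wps; rewrite /I /upd /=; split; last lia.
    split=> //=; rewrite subn1.
    by apply: stack_pop => //; lia.
  wps; rewrite /I /upd /= !addn1; split; last lia.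
  split=> //=; exact: stack_push so cond.
- move=> m' T' [bm' hb he je so] /=; rewrite he -leqNgt => ej tm.
  have ee : mn m' 2 = e by lia.
  have [h1 _ _ _ _] := bm; apply: HQ => //; first by rewrite -ee.
  by move: tm; rewrite /upd /= mb; lia.
Qed.

Definition eMeet (f : pexp -> rexp) (i j : nexp) : rexp :=
  eDiv (eSub (eMul (eCst (RVar 5) i) (f (pEd j))) (eMul (eCst (RVar 5) j) (f (pEd i))))
       (eCrs (pEd i) (pEd j)).

Definition meet (i j : nat) : pt R :=
  ((cst q dl i * (E j).1 - cst q dl j * (E i).1) / crs (E i) (E j),
   (cst q dl i * (E j).2 - cst q dl j * (E i).2) / crs (E i) (E j)).

Lemma eval_meet m i j : base m -> (neval m i < n + n)%N -> (neval m j < n + n)%N ->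
  (reval m (eMeet fst i j), reval m (eMeet snd i j)) = meet (neval m i) (neval m j).
Proof.
move=> [_ _ _ h4 h5] hi hj; rewrite /meet -!(eval_cst h5 (h4 : reval m (RVar 5) = dl)) //.
by rewrite -!(eval_ed h5).
Qed.

(** Stack entries increase strictly, so the position in the stack advances by at most one per index
    and a single test suffices. The point [s] is stored at both ends of the list of stops. *)
Definition c_verts : cmd :=
  CNat 5 (NCst 0) ;; CNat 2 (nS (NVar 3)) ;;
  CWhile (BLtN (NVar 2) (NVar 10))
    (CIf (BLtN (NArr 0 (nS (NVar 5))) (NVar 2)) (CNat 5 (nS (NVar 5))) CSkip ;;
     CRealArr 4 (NVar 2) (eMeet fst (NArr 0 (NVar 5)) (NArr 0 (nS (NVar 5)))) ;;
     CRealArr 5 (NVar 2) (eMeet snd (NArr 0 (NVar 5)) (NArr 0 (nS (NVar 5)))) ;;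
     CNat 2 (nS (NVar 2))) ;;
  CRealArr 4 (NVar 3) (RVar 2) ;; CRealArr 5 (NVar 3) (RVar 3) ;;
  CRealArr 4 (NVar 10) (RVar 2) ;; CRealArr 5 (NVar 10) (RVar 3).

Notation ps := (pos q V b).

Definition stops (kap : nat -> nat) m : Prop :=
  forall j, (b <= j <= e)%N -> (mra m 4 j, mra m 5 j) = walk V (ps kap a j).

Hypothesis fa : f%:R <= a < f%:R + 1.
Hypothesis startE : walk V a = s.

Lemma verts_ok (Q : mem R -> nat -> Prop) m T : base m -> mn m 3 = b -> mn m 10 = e ->
  SO (mna m 0) (mn m 4) e ->
  (forall m' T' kap, base m' -> mn m' 3 = b -> mn m' 10 = e -> nearest_chain q V b f kap ->
     stops kap m' -> (T' <= T + 20 * n)%N -> Q m' T') -> wp c_verts Q m T.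
Proof.
move=> bm mb me so HQ; rewrite /c_verts; wps => /=.
set st := mna m 0 in so; set top := mn m 4 in so.
have [s0 sm sj _ _] := so.
have topN : top = N := stack_size ccwq ccwV dl0 hullE bf so.
have stop : st top = (b + n)%N := stack_top ccwq ccwV dl0 bf so.
have N2 : (2 < N)%N := size_ccw ccwV.
pose ok p i := [/\ (p < top)%N, (st p < i)%N & (i <= st p.+1)%N].
pose I m := [/\ base m, mn m 3 = b, mn m 10 = e, mna m 0 = st &
  [/\ (mn m 2 <= e)%N, (mn m 5 < top)%N,
     (st (mn m 5) < mn m 2)%N /\ (mn m 2 <= (st (mn m 5).+1).+1)%N &
     forall i, (b < i < mn m 2)%N -> exists2 p, ok p i &
       (mra m 4 i, mra m 5 i) = meet (st p) (st p.+1)]].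
have stb x : (x <= top)%N -> (st x < n + n)%N.
  move=> xt; apply: leq_ltn_trans (_ : st top < _)%N; last lia.
  by case: (eqVneq x top) => [->//|ne]; rewrite ltnW // sm //; lia.
apply: (wp_loop (I := I) (phi := fun m => (7 * (e - mn m 2))%N)).
- have [h1 h2 h3 h4 h5] := bm.
  rewrite /I /upd /= mb me !addn1; split=> //; split=> /=; [lia|lia| |by move=> i; lia].
  by rewrite s0; split=> //; rewrite ltnS; have := sm 0%N 1%N isT ltac:(lia); lia.
- move=> m1 T1 [bm1 hb he hst [je pt1 [pj jp] zs]] /=; rewrite he => hj.
  have [h1 h2 h3 h4 h5] := bm1.
  have main m2 T2 : base m2 -> mn m2 3 = b -> mn m2 10 = e -> mna m2 0 = st ->
      mra m2 = mra m1 -> mn m2 2 = mn m1 2 -> ok (mn m2 5) (mn m1 2) -> (T2 <= T1 + 2)%N ->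
      wp (CRealArr 4 (NVar 2) (eMeet fst (NArr 0 (NVar 5)) (NArr 0 (nS (NVar 5)))) ;;
          CRealArr 5 (NVar 2) (eMeet snd (NArr 0 (NVar 5)) (NArr 0 (nS (NVar 5)))) ;;
          CNat 2 (nS (NVar 2)))
       (fun m' T' => I m' /\ (T' + 7 * (e - mn m' 2) < T1 + 7 * (e - mn m1 2))%N) m2 T2.
    move=> bm2 hb2 he2 st2 zs2 j2 okp tm; have [k1 k2 k3 k4 k5] := bm2.
    have [ok1 ok2 ok3] := okp.
    have em := eval_meet (i := NArr 0 (NVar 5)) (j := NArr 0 (nS (NVar 5))) bm2.
    have {}em : (reval m2 (eMeet fst (NArr 0 (NVar 5)) (NArr 0 (nS (NVar 5)))),
        reval m2 (eMeet snd (NArr 0 (NVar 5)) (NArr 0 (nS (NVar 5))))) =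
        meet (st (mn m2 5)) (st (mn m2 5).+1).
      by rewrite em /= st2 ?addn1 //; apply: stb; lia.
    have emS m3 : mr m3 = mr m2 -> mn m3 = mn m2 -> mna m3 = mna m2 ->
        mra m3 0 = mra m2 0 -> mra m3 1 = mra m2 1 ->
        reval m3 (eMeet snd (NArr 0 (NVar 5)) (NArr 0 (nS (NVar 5)))) =
        reval m2 (eMeet snd (NArr 0 (NVar 5)) (NArr 0 (nS (NVar 5)))).
      by move=> q1 q2 q3 q4 q5; rewrite /= q1 q2 q3 q4 q5.
    have em1 : reval m2 (eMeet fst (NArr 0 (NVar 5)) (NArr 0 (nS (NVar 5)))) =
      (meet (st (mn m2 5)) (st (mn m2 5).+1)).1 by rewrite -em.
    have em2 : reval m2 (eMeet snd (NArr 0 (NVar 5)) (NArr 0 (nS (NVar 5)))) =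
      (meet (st (mn m2 5)) (st (mn m2 5).+1)).2 by rewrite -em.
    wps; rewrite emS // em1 em2.
    rewrite /I /upd /= j2 addn1; split; last lia.
    split; [exact: bm2|exact: hb2|exact: he2|exact: st2|].
    split; [lia|by []|by rewrite ltnS (ltnW ok2)|].
    move=> i bij; have [->|ne] := eqVneq i (mn m1 2); first by exists (mn m2 5).
    by rewrite zs2; apply: zs; lia.
  apply: wp_seq; apply: wp_if => /= cond; rewrite hst addn1 in cond.
    apply: wp_nat; apply: main => //=.
    + rewrite addn1 /upd /=; have st_top : (mn m1 5).+1 != top.
        by apply/eqP => h; move: cond; rewrite h stop; lia.
      have lt_top : ((mn m1 5).+1 < top)%N by rewrite ltn_neqAle st_top.
      split=> //; have := sm (mn m1 5).+1 (mn m1 5).+2 (ltnSn _) lt_top; lia.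
    + lia.
  by apply: wp_skip; apply: main => //; [split=> //; rewrite leqNgt|lia].
- move=> m' T' [bm' hb he hst [je pt1 [pj jp] zs]] /=; rewrite he -leqNgt => ej tm.
  have ee : mn m' 2 = e by lia.
  have [ptr hptr] : exists ptr : nat -> nat, forall i, (b < i < e)%N ->
      ok (ptr i) i /\ (mra m' 4 i, mra m' 5 i) = meet (st (ptr i)) (st (ptr i).+1).
    have : forall i, exists p, (b < i < e)%N ->
        ok p i /\ (mra m' 4 i, mra m' 5 i) = meet (st p) (st p.+1).
      move=> i; case: (boolP (b < i < e)%N) => h; last by exists 0%N.
      by have [p hp1 hp2] := zs i ltac:(by rewrite ee); exists p.
    by move=> /choice[ptr hptr]; exists ptr.
  have hptr' j : (b < j <= b + n)%N -> (ptr j < top)%N /\ (st (ptr j) < j <= st (ptr j).+1)%N.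
    by move=> bj; have [[u1 u2 u3] _] := hptr j ltac:(lia); rewrite u2 u3.
  have [chain lines] := chain_of_stack ccwq ccwV dl0 hullE bf so hptr'.
  have [h1 h2 h3 h4 h5] := bm'.
  wps; apply: HQ chain _ _ => //=.
  + move=> j bj; rewrite /upd /= hb he.
    have [->|je'] := eqVneq j e.
      rewrite pos_e walk_addN ?startE //.
      by case/andP: fa => fa0 _; apply: le_trans fa0; rewrite ler0n.
    have [->|jb] := eqVneq j b.
      by rewrite pos_b startE.
    rewrite /=; have [_ ->] := hptr j ltac:(lia).
    have rj : rank q b j by rewrite /rank; lia.
    rewrite (walk_pos _ _ _ rj).
    have [l1 l2] := lines j ltac:(lia).
    by rewrite (line_meet ccwq ccwV dl0 hullE l1 l2).
  + by move: tm; rewrite /upd /= mb; lia.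
Qed.

Variable kap : nat -> nat.
Hypothesis rho0 : 0 <= rho.
Hypothesis out : forall i, ~ hull V (vx q i).
Hypothesis chain : nearest_chain q V b f kap.
Hypothesis close : forall i z, (forall x, hull V x -> dotp (vsub (vx q i) z) (vsub x z) <= 0) ->
  dist2 z (vx q i) <= rho ^+ 2.
Notation g := (walk V).
Notation Z j := (g (ps kap a j)).
Notation stop := (at_stop q V b kap a).

Definition env m : Prop := [/\ base m, mn m 3 = b, mn m 10 = e & stops kap m].

Definition frame m0 m : Prop :=
  [/\ forall k : nat, k \notin [:: 7; 8; 9] -> mn m k = mn m0 k,
      forall k : nat, k \notin [:: 10; 11] -> mr m k = mr m0 k & mra m = mra m0].

Lemma frame_refl m : frame m m.
Proof. by []. Qed.

Lemma frame_env m0 m : frame m0 m -> env m0 -> env m.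
Proof.
move=> [fn fr fa'] [[h1 h2 h3 h4 h5] h6 h7 h8].
split; rewrite ?fn //; last by move=> j bj; rewrite fa' h8.
by split; rewrite ?fn ?fr //; move=> i; rewrite fa'; exact: h5.
Qed.

Lemma frame_nat k v m0 m : k \in [:: 7; 8; 9] -> frame m0 m ->
  frame m0 (Mem (mr m) (upd (mn m) k v) (mra m) (mna m)).
Proof.
move=> kin [fn fr fa']; split=> //= j jn; rewrite -fn // /upd.
by case: eqP jn => // ->; rewrite kin.
Qed.

Lemma frame_real k v m0 m : k \in [:: 10; 11] -> frame m0 m ->
  frame m0 (Mem (upd (mr m) k v) (mn m) (mra m) (mna m)).
Proof.
move=> kin [fn fr fa']; split=> //= j jn; rewrite -fr // /upd.
by case: eqP jn => // ->; rewrite kin.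
Qed.

Definition touch (x : R) (j : nat) (z : pt R) : bool := touchb rho (vx q j) (g x) z.

(** * The search for one horizon *)

Section Step.
Variables (m0 : mem R) (t : nat) (x : R).
Hypothesis env0 : env m0.
Hypothesis t0 : mn m0 6 = t.
Hypothesis u0 : (mr m0 8, mr m0 9) = g x.
Hypothesis tx : stop t x.
Notation H := (touch x).

Lemma touchE j z : H j z <-> hits q rho j (g x) z.
Proof. by split=> [/touchP h|h]; [exact: h|apply/touchP]. Qed.

Lemma touch_down j J J' : (t < j)%N -> (j <= J')%N -> (J' <= J)%N -> (J <= e)%N -> (j < e)%N ->
  H j (Z J) -> H j (Z J').
Proof.
move=> tj jJ' J'J Je je /touchE h; apply/touchE.
have [btx _] := tx.
by apply: (hits_down ccwq ccwV chain close fa tx tj jJ' J'J Je _ h); rewrite /rank; lia.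
Qed.

Lemma touch_self j : (t < j < e)%N -> H j (Z j).
Proof.
move=> tj; have [btx _] := tx; have rj : rank q b j by rewrite /rank; lia.
by apply/touchE; exact: (hits_self a chain close (g x) rj).
Qed.

Lemma eval_touchZ m en eg J : frame m0 m -> (neval m eg < e)%N -> peval m en = J ->
  beval m (bTouch (RVar 4) (pArr 0 1 eg) (pVar 8 9) en) = H (neval m eg) J.
Proof.
move=> fm ge <-.
have [[h1 h2 h3 h4 h5] h6 h7 h8] := frame_env fm env0.
rewrite eval_touch (eval_vx h5); last lia.
case: fm => _ fr _.
by rewrite /touch -u0 -(fr 8 isT) -(fr 9 isT) -h3.
Qed.

(** Each round confirms an eyelet or drops the last stop. By [touch_down] confirmed eyelets survive
    the shortening, so the cost is linear in the width. *)
Definition c_window : cmd :=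
  CWhile (BLtN (NVar 9) (NVar 7))
    (CIf (bTouch (RVar 4) (pArr 0 1 (NVar 9)) (pVar 8 9) (pArr 4 5 (NVar 7)))
      (CNat 9 (nS (NVar 9))) (CNat 7 (NMinus (NVar 7) (NCst 1)))).

Definition reaches J : Prop := forall j, (t < j < J)%N -> H j (Z J).
Definition blocked J : Prop := exists2 j, (t < j <= J)%N & ~~ H j (Z J.+1).

(** The result is also the largest stop of the window that is reached, so a wider window never loses
    progress already made. *)
Lemma window_ok J0 L (Q : mem R -> nat -> Prop) m T : frame m0 m ->
  mn m 7 = J0 -> mn m 8 = L -> mn m 9 = t.+1 -> (t < J0 <= e)%N ->
  (forall m' T', frame m0 m' -> mn m' 8 = L -> (t < mn m' 7 <= J0)%N ->
     reaches (mn m' 7) -> ((mn m' 7 < J0)%N -> blocked (mn m' 7)) ->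
     (forall K, (t < K <= J0)%N -> reaches K -> (K <= mn m' 7)%N) ->
     (T' <= T + 3 * (J0 - t))%N -> Q m' T') -> wp c_window Q m T.
Proof.
move=> fm mJ mL mg tJ HQ.
pose I m := [/\ frame m0 m, mn m 8 = L,
  (t < mn m 9)%N /\ (mn m 9 <= mn m 7 <= J0)%N,
  (forall j, (t < j < mn m 9)%N -> H j (Z (mn m 7))) /\ ((mn m 7 < J0)%N -> blocked (mn m 7)) &
  forall K, (t < K <= J0)%N -> reaches K -> (K <= mn m 7)%N].
apply: (wp_loop (I := I) (phi := fun m => (3 * (mn m 7 - mn m 9))%N)).
- split; rewrite ?mJ ?mg //; first lia.
    by split=> [j|]; rewrite ?ltnn; lia.
  by move=> K; lia.
- move=> m1 T1 [f1 hL [tg gJ] [hg hb] low] /= gltJ.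
  have ev : beval m1 (bTouch (RVar 4) (pArr 0 1 (NVar 9)) (pVar 8 9) (pArr 4 5 (NVar 7))) =
      H (mn m1 9) (Z (mn m1 7)).
    have [_ _ _ zs] := frame_env f1 env0.
    apply: (eval_touchZ f1) => //=; first lia.
    by have [btx _] := tx; apply: (zs (mn m1 7)); lia.
  apply: wp_if => cond; rewrite ev in cond.
    wps; rewrite /upd /= addn1; split; last lia.
    have [fn fr fa'] := f1.
    split=> //=; [|lia|].
      exact: (frame_nat (k := 9) _ isT f1).
    split=> // j /andP[tj]; rewrite ltnS leq_eqVlt => /orP[/eqP->//|jg].
    by apply: hg; rewrite tj.
  wps; rewrite /upd /= subn1; split; last lia.
  have [fn fr fa'] := f1.
  have JE : (mn m1 7).-1.+1 = mn m1 7 by lia.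
  split=> //=; [|lia| |].
  + exact: (frame_nat (k := 7) _ isT f1).
  + split=> [j tj|_]; last first.
      by exists (mn m1 9); [lia|rewrite JE].
    by apply: (touch_down (J := mn m1 7)) (hg j tj); lia.
  + move=> K tK hK; have := low K tK hK; rewrite leq_eqVlt => /orP[/eqP KJ|]; last lia.
    by move/negP: cond; case; rewrite -KJ; apply: hK; lia.
- move=> m' T' [f' hL [tg gJ] [hg hb] low] /=; rewrite -leqNgt => Jg tm.
  have Jg' : mn m' 7 = mn m' 9 by lia.
  apply: HQ => //; first lia.
    by move=> j tj; apply: hg; rewrite -Jg'.
  by move: tm; rewrite mJ mg; lia.
Qed.

(** Only a window passed completely is doubled. The final width is thus at most twice the progress,
    and the widths sum up geometrically. *)
Definition c_double : cmd :=
  CNat 7 (nS (NVar 6)) ;; CNat 8 (NCst 1) ;;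
  CWhile (BAnd (BLtN (NVar 7) (NVar 10)) (BNot (BLtN (NVar 7) (NPlus (NVar 6) (NVar 8)))))
    (CNat 8 (NPlus (NVar 8) (NVar 8)) ;; CNat 7 (NPlus (NVar 6) (NVar 8)) ;;
     CIf (BLtN (NVar 10) (NVar 7)) (CNat 7 (NVar 10)) CSkip ;;
     CNat 9 (nS (NVar 6)) ;; c_window).

Lemma double_ok (Q : mem R -> nat -> Prop) T :
  (forall m' T', frame m0 m' -> (t < mn m' 7 <= e)%N -> reaches (mn m' 7) ->
     ((mn m' 7 < e)%N -> blocked (mn m' 7)) ->
     (T' <= T + 26 * (mn m' 7 - t) + 3)%N -> Q m' T') -> wp c_double Q m0 T.
Proof.
move=> HQ; rewrite /c_double; wps => /=.
have [btx _] := tx; have [_ _ e0 _] := env0.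
(* The budget of 13 per unit of width pays for all windows so far: going from width [L] to [2 L]
   costs at most [6 L + 6] and frees [13 L]. *)
pose I m T' := [/\ frame m0 m, (0 < mn m 8)%N,
  (t < mn m 7)%N /\ (mn m 7 <= e)%N, reaches (mn m 7) &
  [/\ (mn m 7 <= t + mn m 8)%N, (mn m 8 <= 2 * (mn m 7 - t))%N,
    ((mn m 7 < t + mn m 8)%N -> (mn m 7 < e)%N -> blocked (mn m 7)) &
    (T' <= T + 2 + 13 * mn m 8)%N]].
apply: (wp_while (I := I) (mu := fun m => ((2 * e).+1 - mn m 8)%N)).
- rewrite /I /upd /= t0 addn1; split=> //.
  + exact: (frame_nat (k := 8) _ isT (frame_nat (k := 7) _ isT (frame_refl m0))).
  + by split=> //; lia.
  + by move=> j; lia.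
  + by split; lia.
- move=> m T1 [fm L0 [tJ Je] hJ [JL LJ bl tm]] /=.
  have [fn fr fa'] := fm; rewrite (fn 10) // (fn 6) // e0 t0 -leqNgt => /andP[Jlt LJ'].
  have JE : mn m 7 = (t + mn m 8)%N by lia.
  apply: wp_seq; apply: wp_nat; apply: wp_seq; apply: wp_nat; apply: wp_seq.
  rewrite /upd /= (fn 6) // t0.
  pose L := (mn m 8 + mn m 8)%N; rewrite -/L.
  have main J0 m2 T2 : J0 = minn (t + L) e -> frame m0 m2 -> mn m2 7 = J0 -> mn m2 8 = L ->
      (T2 <= T1 + 5)%N ->
      wp (CNat 9 (nS (NVar 6)) ;; c_window)
        (fun m' T' => I m' T' /\ ((2 * e).+1 - mn m' 8 < (2 * e).+1 - mn m 8)%N) m2 T2.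
    move=> J0E f2 mJ mL t2; apply: wp_seq; apply: wp_nat.
    have [fn2 fr2 fa2] := f2.
    apply: (window_ok (J0 := J0) (L := L)).
    + exact: frame_nat.
    + by rewrite /upd /= mJ.
    + by rewrite /upd /= mL.
    + by rewrite /upd /= addn1 (fn2 6) // t0.
    + by rewrite J0E /L; lia.
    move=> m' T' f' mL' tJ' hJ' bl' low tm'.
    have := low (mn m 7) ltac:(rewrite J0E /L; lia) hJ => lowJ.
    split; last by rewrite mL' /L; lia.
    rewrite /I mL'; split=> //; [by rewrite /L; lia|lia|].
    split; [lia|by rewrite /L; lia| |by rewrite /L; lia].
    by move=> h1 h2; apply: bl'; lia.
  have f2 := frame_nat (k := 7) (t + L) isT (frame_nat (k := 8) L isT fm).
  apply: wp_if => /=; rewrite (fn 10) // e0 => cond.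
    apply: wp_nat; apply: (main e) => //=; first lia.
    + exact: (frame_nat (k := 7) _ isT f2).
    + by rewrite /upd /= (fn 10).
    + lia.
  apply: wp_skip; apply: (main (t + L)%N) => //=; first lia.
  lia.
- move=> m T1 [fm L0 [tJ Je] hJ [JL LJ bl tm]] /=.
  have [fn fr fa'] := fm; rewrite (fn 10) // (fn 6) // e0 t0 negb_and negbK => stop_.
  apply: HQ => //; [by rewrite tJ|by move=> h; apply: bl => //; lia|lia].
Qed.

Lemma edge_down j J (l l' : R) : (t < j <= J)%N -> (J < e)%N -> 0 <= l' -> l' <= l -> l <= 1 ->
  H j (lerp l (Z J) (Z J.+1)) -> H j (lerp l' (Z J) (Z J.+1)).
Proof.
move=> tjJ Je l0 ll l1 /touchE h; apply/touchE.
have [btx /andP[_ xt]] := tx; have bJ : (b <= J < e)%N by move: tjJ Je btx; clear; lia.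
have rj : rank q b j by rewrite /rank; move: tjJ bJ btx; clear; lia.
have [n1 n2' n3 n4] : [/\ (b <= t.+1)%N, (t.+1 <= j)%N, (b <= j)%N & (j <= J)%N] by move: tjJ bJ btx; clear; split; lia.
have [n5 n6 n7] : [/\ (b <= J)%N, (J <= e)%N & (b <= J.+1)%N] by move: tjJ bJ btx; clear; split; lia.
have /andP[ax xa] := at_stop_range ccwq ccwV chain fa tx.
have mono := pos_mono ccwq ccwV chain fa.
have step := mono J J.+1 n5 (leqnSn J) Je.
have edge := walk_edge ccwq ccwV chain fa bJ.
have x0 : 0 <= x by case/andP: fa => fa0 _; rewrite (le_trans _ ax) // (le_trans _ fa0).
rewrite -edge ?l0 ?(le_trans ll l1) //.
rewrite -edge ?(le_trans l0 ll) ?l1 // in h.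
have tj := mono t.+1 j n1 n2' (leq_trans n4 n6).
have jJ := mono j J n3 n4 n6.
have Jl := mono J.+1 e n7 Je (leqnn e).
rewrite pos_e in Jl.
have D0 : 0 <= ps kap a J.+1 - ps kap a J by rewrite subr_ge0.
apply: (hits_mono ccwV chain close rj x0 _ _ _ _ (walk_pos V kap a rj) h).
- exact: le_trans (ltW xt) tj.
- by rewrite (le_trans jJ) // lerDl mulr_ge0.
- by rewrite lerD2l ler_wpM2r.
- rewrite (le_trans (_ : _ <= ps kap a J.+1)) //.
    by rewrite -lerBrDl -[leRHS]mul1r ler_wpM2r.
  by rewrite (le_trans Jl) // lerD2r.
Qed.

(** Every candidate is verified before it is accepted, so spurious roots and the default values of
    division and square root do no harm. *)
Definition c_try (c : rexp) : cmd :=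
  CIf (BAnd (BAnd (bLe (RCst 0) c) (BLtR (RVar 11) c))
        (BAnd (bLe c (RCst 1)) (bTouch (RVar 4) (pArr 0 1 (NVar 9)) (pVar 8 9)
           (pLerp c (pArr 4 5 (NVar 7)) (pArr 4 5 (nS (NVar 7)))))))
    (CReal 11 c) CSkip.

Definition eBest : seq rexp :=
  eCandidates (RVar 4) (pArr 0 1 (NVar 9)) (pVar 8 9) (pArr 4 5 (NVar 7)) (pArr 4 5 (nS (NVar 7))).

Definition c_best : cmd := CReal 11 (RCst 0) ;; foldr CSeq CSkip (map c_try eBest).

Section Best.
Variables (J i : nat) (lam : R).
Hypothesis tiJ : (t < i <= J)%N.
Hypothesis Je : (J < e)%N.
Notation hit l := (H i (lerp l (Z J) (Z J.+1))).

Definition at_edge m : Prop := [/\ frame m0 m, mn m 9 = i, mn m 7 = J & mr m 10 = lam].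

Lemma at_edge_stops m : at_edge m ->
  peval m (pArr 4 5 (NVar 7)) = Z J /\ peval m (pArr 4 5 (nS (NVar 7))) = Z J.+1.
Proof.
move=> [fm _ mJ _]; have [_ _ _ zs] := frame_env fm env0; have [btx _] := tx.
by rewrite /peval /= mJ addn1; split; apply: zs; lia.
Qed.

Lemma tries_ok cs vs : (forall m, at_edge m -> map (reval m) cs = vs) ->
  forall (Q : mem R -> nat -> Prop) m T, at_edge m ->
  (forall m' T', at_edge m' -> mr m 11 <= mr m' 11 ->
     mr m' 11 = mr m 11 \/ (0 <= mr m' 11 <= 1 /\ hit (mr m' 11)) ->
     (forall v, v \in vs -> 0 <= v <= 1 -> hit v -> v <= mr m' 11) ->
     (T' <= T + 2 * size vs)%N -> Q m' T') ->
  wp (foldr CSeq CSkip (map c_try cs)) Q m T.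
Proof.
elim: cs vs => [|c cs IH] vs vsE Q m T om HQ.
  apply: wp_skip; apply: HQ => //; [by left| |by rewrite leq_addr].
  by rewrite -(vsE m om).
have := vsE m om => /= vsm; rewrite -vsm in vsE HQ *.
set v := reval m c in vsm vsE HQ *; set vt := map (reval m) cs in vsm vsE HQ *.
have cE m' : at_edge m' -> reval m' c = v by move=> /vsE[].
have csE m' : at_edge m' -> map (reval m') cs = vt by move=> /vsE[].
have [z1 z2] := at_edge_stops om; have [fm mi mJ ml] := om.
have condE : beval m (BAnd (BAnd (bLe (RCst 0) c) (BLtR (RVar 11) c))
        (BAnd (bLe c (RCst 1)) (bTouch (RVar 4) (pArr 0 1 (NVar 9)) (pVar 8 9)
           (pLerp c (pArr 4 5 (NVar 7)) (pArr 4 5 (nS (NVar 7))))))) =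
    ((0 <= v) && (mr m 11 < v)) && ((v <= 1) && hit v).
  rewrite !eval_and !eval_le (eval_touchZ fm (J := lerp v (Z J) (Z J.+1))).
  - by rewrite /= mi.
  - by rewrite /= mi; lia.
  - by rewrite eval_lerp z1 z2.
apply: wp_seq; apply: wp_if => cond; rewrite condE in cond.
  have /andP[/andP[v0 bv] /andP[v1 hv]] := cond.
  apply: wp_real; rewrite -/v; apply: (IH vt csE).
    by split=> //; exact: (frame_real (k := 11) _ isT fm).
  rewrite /upd /= => m' T' om' le eq up tm; apply: HQ => //.
  - by rewrite (le_trans (ltW bv)).
  - by right; case: eq => // ->; rewrite v0 v1.
  - by move=> w; rewrite inE => /orP[/eqP->//|]; exact: up.
  - by move: tm; rewrite /=; move: (size vt) => w; clear; lia.
apply: wp_skip; apply: (IH vt csE) => // m' T' om' le eq up tm; apply: HQ => //.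
  move=> w; rewrite inE => /orP[/eqP->|]; last exact: up.
  move=> /andP[v0 v1] hv; rewrite leNgt; apply/negP => bv.
  by move/negP: cond; apply; rewrite v0 v1 hv (le_lt_trans le bv).
by move: tm; rewrite /=; move: (size vt) => w; clear; lia.
Qed.

Lemma best_ok (Q : mem R -> nat -> Prop) m T : at_edge m -> hit 0 ->
  (forall m' T', at_edge m' -> 0 <= mr m' 11 <= 1 -> hit (mr m' 11) ->
     (forall l, mr m' 11 < l <= 1 -> ~~ hit l) -> (T' <= T + 13)%N -> Q m' T') ->
  wp c_best Q m T.
Proof.
move=> om h0 HQ; have touchA : touches rho (vx q i) (g x) (Z J).
  by apply/touchP; rewrite -[Z J](lerp0 (Z J) (Z J.+1)).
have [l l01 [hl lmax]] := last_touch rho0 (Z J.+1) touchA.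
have lc := last_touch_candidate touchA l01 hl lmax.
apply: wp_seq; apply: wp_real.
apply: (tries_ok (vs := candidates rho (vx q i) (g x) (Z J) (Z J.+1))).
- move=> m1 o1; have [z1 z2] := at_edge_stops o1; have [f1 mi mJ ml] := o1.
  have [[h1 h2 h3 h4 h5] _ _ _] := frame_env f1 env0.
  rewrite eval_candidates z1 z2 (eval_vx h5) /= mi; last lia.
  case: f1 => _ fr _; congr candidates => //.
  by rewrite /peval /= !fr.
- have [fm mi mJ ml] := om.
  by split=> //; exact: (frame_real (k := 11) _ isT fm).
rewrite /upd /= => m' T' om' le eq up tm.
have b01 : 0 <= mr m' 11 <= 1 /\ hit (mr m' 11).
  by case: eq => // ->; rewrite lexx ler01.
have [/andP[_ b1] hb] := b01.
apply: HQ => //; last by move: tm; clear; lia.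
- by case: b01.
- move=> w /andP[bw w1]; apply/negP => /touchP hw.
  have w01 : 0 <= w <= 1 by rewrite w1 (le_trans le (ltW bw)).
  have wl := lmax w w01 hw; have lb := up l lc l01 (introT (touchP _ _ _ _) hl).
  by have := lt_le_trans bw (le_trans wl lb); rewrite ltxx.
Qed.

End Best.

Definition c_edge : cmd :=
  CReal 10 (RCst 1) ;; CNat 9 (nS (NVar 6)) ;;
  CWhile (BLtN (NVar 9) (nS (NVar 7)))
    (c_best ;; CIf (BLtR (RVar 11) (RVar 10)) (CReal 10 (RVar 11)) CSkip ;; CNat 9 (nS (NVar 9))).

Lemma edge_ok J (Q : mem R -> nat -> Prop) m T : frame m0 m -> mn m 7 = J -> (t < J < e)%N ->
  reaches J -> blocked J ->
  (forall m' T' y, frame m0 m' -> mn m' 7 = J -> stop J y ->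
     lerp (mr m' 10) (Z J) (Z J.+1) = g y -> is_horizon q V rho (g x) (g y) ->
     (T' <= T + 17 * (J - t) + 3)%N -> Q m' T') ->
  wp c_edge Q m T.
Proof.
move=> fm mJ tJ reachJ blockJ HQ.
have [btx _] := tx; have Je : (J < e)%N by case/andP: tJ.
have t9 : mn m 6 = t by case: fm => fn _ _; rewrite (fn 6).
apply: wp_seq; apply: wp_real; apply: wp_seq; apply: wp_nat.
rewrite /upd /= t9 addn1.
have hitJ j : (t < j <= J)%N -> H j (Z J).
  move=> /andP[tj]; rewrite leq_eqVlt => /orP[/eqP->|jJ]; last by apply: reachJ; rewrite tj.
  exact: touch_self.
pose I m := exists2 i, (t < i <= J.+1)%N & [/\ at_edge J i (mr m 10) m, 0 <= mr m 10 <= 1,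
  (forall j (l : R), (t < j < i)%N -> 0 <= l <= mr m 10 -> H j (lerp l (Z J) (Z J.+1))) &
  (mr m 10 < 1 -> exists2 j, (t < j < i)%N &
     forall l : R, mr m 10 < l <= 1 -> ~~ H j (lerp l (Z J) (Z J.+1)))].
apply: (wp_loop (I := I) (phi := fun m => (17 * (J.+1 - mn m 9))%N)).
- exists t.+1; first by move: tJ; clear; lia.
  split; rewrite /= ?ler01 ?lexx ?ltxx //.
    split=> //=.
    exact: (frame_nat (k := 9) _ isT (frame_real (k := 10) _ isT fm)).
  by move=> j l /andP[h1 h2]; move: h1 h2; clear; lia.
- move=> m1 T1 [i tiJ [om l01 oks blk]] /=; have [f1 mi mJ1 _] := om.
  rewrite mi mJ1 addn1 => iJ; have {}tiJ : (t < i <= J)%N by move: tiJ iJ; clear; lia.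
  apply: wp_seq; apply: (best_ok tiJ Je om); first by rewrite lerp0; exact: hitJ.
  move=> m2 T2 om2 b01 hb nb tm2; have [f2 mi2 mJ2 lam2] := om2.
  have below (l : R) : 0 <= l <= mr m2 11 -> H i (lerp l (Z J) (Z J.+1)).
    by move=> /andP[u1 u2]; apply: (edge_down tiJ Je u1 u2 _ hb); case/andP: b01.
  have step m3 T3 : at_edge J i (mr m3 10) m3 -> 0 <= mr m3 10 <= 1 ->
      mr m3 10 <= mr m2 10 -> mr m3 10 <= mr m2 11 ->
      mr m3 10 = mr m2 10 \/ mr m3 10 = mr m2 11 -> (T3 <= T2 + 2)%N ->
      wp (CNat 9 (nS (NVar 9))) (fun m' T' =>
        I m' /\ (T' + 17 * (J.+1 - mn m' 9) < T1 + 17 * (J.+1 - i))%N) m3 T3.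
    move=> om3 l3 le1 le2 eq3 tm3; have [f3 mi3 mJ3 _] := om3.
    apply: wp_nat; rewrite /upd /= mi3 addn1; split; last first.
      by move: tm3 tm2 tiJ; clear; lia.
    exists i.+1; first by move: tiJ; clear; lia.
    split=> //=.
    + split=> //=; exact: (frame_nat (k := 9) _ isT f3).
    + move=> j l /andP[tj]; rewrite ltnS leq_eqVlt => /orP[/eqP->|ji] /andP[u1 u2].
        by apply: below; rewrite u1 (le_trans u2).
      by apply: oks; rewrite ?tj // u1 -lam2 (le_trans u2).
    + case: eq3 => ->; last by move=> _; exists i => //; move: tiJ; clear; lia.
      rewrite lam2 => /blk[j tj hj]; exists j => //; move: tj; clear; lia.
  apply: wp_seq; apply: wp_if => /= cond.
    apply: wp_real; apply: step => //=.
    + split=> //; exact: (frame_real (k := 10) _ isT f2).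
    + by rewrite /upd /= ltW.
    + by rewrite /upd /=; right.
    + by clear; lia.
  apply: wp_skip; apply: step => //.
  + by rewrite lam2.
  + by rewrite leNgt.
  + by left.
  + by clear; lia.
- move=> m' T' [i tiJ [om l01 oks blk]] /=; have [f1 mi mJ1 _] := om.
  rewrite mi mJ1 addn1 -leqNgt => iJ tm; have iE : i = J.+1 by move: tiJ iJ; clear; lia.
  (* A minimum of 1 would mean that all eyelets are still met at the next stop, contrary to
     [blocked J]. *)
  have lam1 : mr m' 10 < 1.
    rewrite lt_neqAle; have /andP[l0 l1] := l01; rewrite l1 andbT; apply/eqP => lE.
    have [j tj /negP] := blockJ; apply; rewrite -[Z J.+1](lerp1 (Z J) (Z J.+1)).
    by apply: oks; rewrite ?lE ?ler01 ?lexx // iE.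
  have /andP[l0 l1] := l01.
  have [y [sy yE hy]] : exists y, [/\ stop J y,
      lerp (mr m' 10) (Z J) (Z J.+1) = g y & is_horizon q V rho (g x) (g y)].
    apply: (horizonP ccwq ccwV rho0 out chain close fa tx tJ l0 lam1).
    + by move=> j tj; apply/touchE; exact: reachJ.
    + by have [j tj hj] := blockJ; exists j => //; move/touchE; exact/negP.
    + by move=> j l tj l0l; apply/touchE; apply: oks; rewrite ?iE.
    + have [j tj hj] := blk lam1; exists j; first by move: tj; rewrite iE.
      by move=> l /hj /negP h /touchE.
  by apply: HQ sy yE hy _ => //; move: tm tJ; clear; lia.
Qed.

End Step.

Definition c_emit : cmd :=
  CReal 8 (pLerp (RVar 10) (pArr 4 5 (NVar 7)) (pArr 4 5 (nS (NVar 7)))).1 ;;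
  CReal 9 (pLerp (RVar 10) (pArr 4 5 (NVar 7)) (pArr 4 5 (nS (NVar 7)))).2 ;;
  CRealArr 2 (NVar 0) (RVar 8) ;; CRealArr 3 (NVar 0) (RVar 9) ;;
  CNat 0 (nS (NVar 0)) ;; CNat 6 (NVar 7).

Definition c_walk : cmd :=
  CReal 8 (RVar 2) ;; CReal 9 (RVar 3) ;;
  CRealArr 2 (NCst 0) (RVar 8) ;; CRealArr 3 (NCst 0) (RVar 9) ;;
  CNat 0 (NCst 1) ;; CNat 6 (NVar 3) ;; CNat 7 (NVar 3) ;;
  CWhile (BLtN (NVar 7) (NVar 10))
    (c_double ;; CIf (BLtN (NVar 7) (NVar 10)) (c_edge ;; c_emit) CSkip).

Definition listed (P : seq (pt R)) m : Prop :=
  mn m 0 = size P /\ forall j, (j < size P)%N -> (mra m 2 j, mra m 3 j) = nth (0, 0) P j.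

Definition partial_region (P : seq (pt R)) (u : pt R) : Prop :=
  [/\ (0 < size P)%N, nth (0, 0) P 0 = s, last (0, 0) P = u &
      forall j, (j.+1 < size P)%N -> ~ good q V rho (nth (0, 0) P j) s /\
        is_horizon q V rho (nth (0, 0) P j) (nth (0, 0) P j.+1)].

Lemma partial_region_rcons P u v : partial_region P u -> ~ good q V rho u s -> is_horizon q V rho u v ->
  partial_region (rcons P v) v.
Proof.
move=> [P0 Ps Pu Pc] ng hor; split; rewrite ?size_rcons ?last_rcons // ?nth_rcons ?P0 //.
move=> j; rewrite ltnS leq_eqVlt => /orP[/eqP jP|jP].
  have jl : (j < size P)%N by rewrite -jP.
  rewrite !nth_rcons jl jP ltnn eqxx.
  suff -> : nth (0, 0) P j = u by [].
  by rewrite -Pu -nth_last -jP.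
by rewrite !nth_rcons jP (ltnW jP); exact: Pc.
Qed.

Lemma good_s t x : stop t x -> good q V rho (g x) s <->
  forall j, (t < j < e)%N -> touch x j (Z e).
Proof.
move=> tx; have a0 : 0 <= a by case/andP: fa => fa0 _; apply: le_trans fa0; rewrite ler0n.
have -> : s = g (ps kap a e) by rewrite pos_e walk_addN.
rewrite (good_end ccwq ccwV rho0 out chain close fa tx).
by split=> h j tj; apply/touchE; exact: h.
Qed.

Lemma walk_ok (Q : mem R -> nat -> Prop) m T : env m ->
  (forall m' T' P, partial_region P (last (0, 0) P) -> good q V rho (last (0, 0) P) s -> listed P m' ->
     (T' <= T + 60 * n + 80)%N -> Q m' T') ->
  wp c_walk Q m T.
Proof.
move=> em HQ.
pose I m := env m /\ exists P x, [/\ partial_region P (g x), listed P m, (mr m 8, mr m 9) = g x,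
  stop (mn m 6) x & if (mn m 7 < e)%N then mn m 7 = mn m 6 else good q V rho (g x) s].
(* For a progress of [d] stops the search takes time [26 d], the edge [17 d], each up to a constant;
   [d] is at least 1, so [60 d] covers everything. *)
pose phi m := if (mn m 7 < e)%N then (60 * (e - mn m 6))%N else 0%N.
rewrite /c_walk; wps => /=; rewrite /upd /=.
apply: (wp_loop (I := I) (phi := phi)).
- have [[h1 h2 h3 h4 h5] hb he zs] := em.
  split; first by split.
  exists [:: s], a; rewrite startE; split=> //.
  + by split=> //= -[].
  + rewrite /upd /= hb; split; first by clear; lia.
    by rewrite pos_b lexx /=; apply: (pos_gt_a ccwq ccwV chain fa); clear; lia.
  + by rewrite /upd /= hb ltnS leq_addr.
- move=> m1 T1 [em1 [P [x [pP lP u8 st end1]]]] /=.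
  have [_ _ he _] := em1; rewrite he => Jlt.
  have [bt _] := st.
  have ph1 : phi m1 = (60 * (e - mn m1 6))%N by rewrite /phi Jlt.
  apply: wp_seq; apply: (double_ok em1 erefl u8 st).
  move=> m2 T2 f2 tJ reachJ blockJ tm2; have [fn fr fa2] := f2.
  have em2 := frame_env f2 em1; have [_ _ he2 _] := em2.
  have l2 : listed P m2.
    by case: lP => lP1 lP2; split; [rewrite (fn 0)|move=> j jP; rewrite fa2 lP2].
  have u2 : (mr m2 8, mr m2 9) = g x by rewrite !fr.
  apply: wp_if => /=; rewrite he2 => cond; last first.
    apply: wp_skip; have JE : mn m2 7 = e by move: tJ cond; clear; lia.
    split; last first.
      rewrite ph1 /phi JE ltnn; move: tm2 bt; rewrite JE; clear; lia.
    split=> //; exists P, x; split=> //; first by rewrite (fn 6).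
    by rewrite JE ltnn; apply/(good_s st) => j tj; rewrite JE in reachJ; exact: reachJ.
  have tJe : (mn m1 6 < mn m2 7 < e)%N by rewrite cond andbT; case/andP: tJ.
  apply: wp_seq; apply: (edge_ok em1 erefl u8 st f2 erefl tJe reachJ (blockJ cond)).
  move=> m3 T3 y f3 mJ3 sy yE hor tm3; have [fn3 fr3 fa3] := f3.
  have em3 := frame_env f3 em1; have [[h1 h2 h3 h4 h5] hb3 he3 zs3] := em3.
  have [lP1 lP2] := lP.
  have zJ : peval m3 (pArr 4 5 (NVar 7)) = Z (mn m2 7) /\
      peval m3 (pArr 4 5 (nS (NVar 7))) = Z (mn m2 7).+1.
    by rewrite /peval /= mJ3 addn1; split; apply: zs3; move: bt tJe; clear; lia.
  have uE : (reval m3 (pLerp (RVar 10) (pArr 4 5 (NVar 7)) (pArr 4 5 (nS (NVar 7)))).1,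
      reval m3 (pLerp (RVar 10) (pArr 4 5 (NVar 7)) (pArr 4 5 (nS (NVar 7)))).2) = g y.
    by rewrite -yE -zJ.1 -zJ.2.
  have ng : ~ good q V rho (g x) s.
    move=> /(good_s st) gd; have [j tj /negP] := blockJ cond; apply.
    by apply: (touch_down (erefl (mn m1 6)) st) (gd j _); move: tj tJe; clear; lia.
  pose u1 := (g y).1; pose v1 := (g y).2.
  have [uE1 uE2] : reval m3 (pLerp (RVar 10) (pArr 4 5 (NVar 7)) (pArr 4 5 (nS (NVar 7)))).1 = u1 /\
      reval m3 (pLerp (RVar 10) (pArr 4 5 (NVar 7)) (pArr 4 5 (nS (NVar 7)))).2 = v1.
    by rewrite /u1 /v1 -uE.
  rewrite /c_emit; apply: wp_seq; apply: wp_real; rewrite uE1.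
  apply: wp_seq; apply: wp_real.
  have -> : forall w, reval (Mem (upd (mr m3) 8 w) (mn m3) (mra m3) (mna m3))
      (pLerp (RVar 10) (pArr 4 5 (NVar 7)) (pArr 4 5 (nS (NVar 7)))).2 = v1 by move=> w; rewrite -uE2.
  wps => /=; rewrite /upd /=; split; last first.
    rewrite ph1 /phi /upd /= mJ3 cond; move: tm3 tm2 bt tJe; clear; lia.
  split; first by split.
  exists (rcons P (g y)), y; split.
  + exact: partial_region_rcons pP ng hor.
  + rewrite /listed size_rcons /upd /= (fn3 0) // lP1 addn1; split=> // j jP.
    rewrite nth_rcons; case: (ltngtP j (size P)) jP => [jlt|jgt|->] jP.
    + by rewrite fa3 lP2.
    + by move: jgt jP; clear; lia.
    by rewrite -surjective_pairing.
  + by rewrite /upd /= -surjective_pairing.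
  + by rewrite /upd /= mJ3.
  + by rewrite /upd /= mJ3 cond.
- move=> m' T' [em' [P [x [pP lP u8 st end']]]] /=; have [_ _ he _] := em'.
  rewrite he => stop_ tm; rewrite (negbTE stop_) in end'.
  have PE : last (0, 0) P = g x by case: pP.
  apply: (HQ _ _ P) => //; rewrite ?PE //.
  have [_ hb _ _] := em; move: tm; rewrite /phi /upd /= hb ltnS leq_addr; clear; lia.
Qed.

End Phases.

(** * The line carrying the edge that leaves the initial vertex *)

Section Start.
Context {R : realType}.
Variables (q V : seq (pt R)) (dl : R).
Notation Ln := (line q dl).
Hypothesis ccwq : ccw_polygon q.
Hypothesis ccwV : ccw_polygon V.
Hypothesis dl0 : 0 < dl.
Hypothesis hullE : forall x, hull V x <-> forall j, 0 <= Ln j x.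
Variables (b f : nat) (t : R) (s : pt R).
Hypothesis bn : (b < size q)%N.
Hypothesis bf : on_line q V dl b f.
Hypothesis t01 : 0 <= t < 1.
Hypothesis sE : s = lerp t (vx V f) (vx V f.+1).

Lemma start_line : Ln b s = 0.
Proof. by rewrite sE line_lerp bf.1 bf.2 !mulr0 addr0. Qed.

(** As [t] is below 1, the next vertex is a proper step from [s] in the direction of edge [b]. *)
Lemma start_next : exists2 c : R, 0 < c &
  forall j, Ln j (vx V f.+1) - Ln j s = c * crs (ed q j) (ed q b).
Proof.
have [m m0 edE] := on_line_dir ccwq ccwV dl0 hullE bf.
case/andP: t01 => t0 t1; exists ((1 - t) * m); first by rewrite mulr_gt0 // subr_gt0.
move=> j; rewrite line_diff sE.
have e1 : (vx V f.+1).1 - (vx V f).1 = m * (ed q b).1 by rewrite -[LHS]/(ed V f).1 edE.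
have e2 : (vx V f.+1).2 - (vx V f).2 = m * (ed q b).2 by rewrite -[LHS]/(ed V f).2 edE.
move: (ed q j) (ed q b) e1 e2 => u v e1 e2; rewrite /crs /vsub /lerp /=.
have -> : (vx V f.+1).2 = (vx V f).2 + m * v.2 by rewrite -e2; ring.
have -> : (vx V f.+1).1 = (vx V f).1 + m * v.1 by rewrite -e1; ring.
ring.
Qed.

Lemma start_max j : Ln j s = 0 -> 0 <= crs (ed q j) (ed q b).
Proof.
move=> j0; have [c c0 /(_ j)] := start_next; rewrite j0 subr0 => h.
have : 0 <= Ln j (vx V f.+1) by exact: line_vx.
by rewrite h pmulr_rge0.
Qed.

(** A second parallel line through [s] would be antiparallel to line [b], confining the hull to that
    line; then edge [f + 1] would lie on line [b] as well. *)
Lemma start_unique j : (j < size q)%N -> Ln j s = 0 -> crs (ed q j) (ed q b) = 0 -> j = b.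
Proof.
move=> jn j0 c0; apply/eqP/negP => /negP ne.
have [c cpos /(_ j)] := start_next; rewrite j0 subr0 c0 mulr0 => jf.
have anti : dotp (ed q j) (ed q b) < 0.
  have [lt|gt|eq] := ltngtP j b; last by rewrite eq eqxx in ne.
    by apply: ed_parallel => //; lia.
  rewrite dotpC; apply: ed_parallel => //; first lia.
  by rewrite crsC c0 oppr0.
have b2 : 0 <= Ln b (vx V f.+2) by exact: line_vx.
have j2 : 0 <= Ln j (vx V f.+2) by exact: line_vx.
have bd := line_diff q dl b (vx V f.+2) (vx V f.+1).
have jd := line_diff q dl j (vx V f.+2) (vx V f.+1).
rewrite bf.2 subr0 in bd; rewrite jf subr0 in jd.
have par : crs (ed q j) (vsub (vx V f.+2) (vx V f.+1)) * dotp (ed q b) (ed q b) =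
    dotp (ed q j) (ed q b) * crs (ed q b) (vsub (vx V f.+2) (vx V f.+1)).
  have -> : forall u v w : pt R, crs u w * dotp v v =
      dotp u v * crs v w + crs u v * dotp v w by move=> u v w; rewrite /crs /dotp; ring.
  by rewrite c0 mul0r addr0.
rewrite -bd -jd in par.
have bz : Ln b (vx V f.+2) = 0.
  apply/eqP; rewrite eq_le b2 andbT -(nmulr_rge0 _ anti) -par mulr_ge0 //.
  by rewrite -len2 sqr_ge0.
have N2 := size_ccw ccwV.
apply: (on_line_edge_inj ccwq ccwV dl0 hullE (ltnSn f) _ bf (conj bf.2 bz)); lia.
Qed.

End Start.

Definition program : cmd := c_init ;; c_scan ;; c_graham ;; c_verts ;; c_walk.

Lemma program_ok (R : realType) (q V : seq (pt R)) (r eps : R) (s : pt R) :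
  ccw_polygon q -> 0 < eps -> eps < r -> ccw_polygon V ->
  hull V = inset (offset (hull q) eps) r ->
  eps_close eps (offset (hull V) r) (hull q) -> boundary (hull V) s ->
  wp program (fun m T => exists2 P, is_region q V (r + eps) s P &
    listed P m /\ (T <= 200 * size q)%N) (input q r eps s) 0.
Proof.
move=> ccwq eps0 epsr ccwV hullV closeV bs.
have dl0 : 0 < r - eps by rewrite subr_gt0.
have r0 : 0 < r := lt_trans eps0 epsr.
have rho0 : 0 <= r + eps by rewrite addr_ge0 ?ltW.
have n2 := size_ccw ccwq.
have hullE x : hull V x <-> forall j, 0 <= line q (r - eps) j x.
  by rewrite hullV; apply: inset_line.
have [a /andP[a0 _] sa] := boundary_walkP ccwV bs.
have [f [t [t01 aE gE]]] := floorP V a0.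
have [j0 [l1 l2]] := on_line_ex ccwq ccwV hullE f.
pose b := (j0 %% size q)%N.
have bn : (b < size q)%N by rewrite ltn_mod; lia.
have bf : on_line q V (r - eps) b f by split; rewrite -line_mod.
have sE : s = lerp t (vx V f) (vx V f.+1) by rewrite sa.
have fa : f%:R <= a < f%:R + 1.
  by case/andP: t01 => t0 t1; rewrite aE lerDl t0 ltrD2l.
have out := vx_not_hull ccwq dl0 hullE.
have close i z : (forall x, hull V x -> dotp (vsub (vx q i) z) (vsub x z) <= 0) ->
    dist2 z (vx q i) <= (r + eps) ^+ 2.
  by apply: nearest_close closeV _ => //; exact: hull_vx.
apply: wp_seq; apply: init_ok => // m1 T1 bm1 tm1.
apply: wp_seq; apply: (scan_ok ccwq bm1 bn).
- exact: start_line bf sE.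
- by move=> j; apply: (start_max ccwq ccwV dl0 hullE bf t01 sE).
- by move=> j; apply: (start_unique ccwq ccwV dl0 hullE bn bf t01 sE).
move=> m2 T2 bm2 hb2 tm2.
apply: wp_seq; apply: (graham_ok ccwq ccwV dl0 hullE bn bm2 hb2).
move=> m3 T3 bm3 hb3 he3 so tm3.
apply: wp_seq; apply: (verts_ok ccwq ccwV dl0 hullE bn bf fa (esym sa) bm3 hb3 he3 so).
move=> m4 T4 kap bm4 hb4 he4 chain zs tm4.
apply: (walk_ok ccwq ccwV dl0 bn fa (esym sa) rho0 out chain close).
  by split.
move=> m5 T5 P [P0 Ps _ Pc] gd lP tm5; exists P; first by split.
(* The phases add up to at most [130 n + 80], and [n] is at least 3. *)
split=> //; move: tm1 tm2 tm3 tm4 tm5 n2; clear; lia.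
Qed.

Theorem theorem30 (R : realType) :
  exists (prog : seq instr) (C : nat),
  forall (n : nat) (q : seq (pt R)) (r eps : R) (V : seq (pt R)) (s : pt R),
    size q = n -> ccw_polygon q ->
    0 < eps -> eps < r ->
    ccw_polygon V -> hull V = inset (offset (hull q) eps) r ->
    eps_close eps (offset (hull V) r) (hull q) ->
    boundary (hull V) s ->
    exists P : seq (pt R),
      is_region q V (r + eps) s P /\
      computes_within prog (init_state q r eps s) P (C * n).
Proof.
(* The compiled code is made opaque to prevent its unfolding. The program names only registers below
   12, so scratch space starts there. *)
have [code codeE] : exists c, c = cc 12 program 0 by eexists.
exists code, (size code * 200)%N => n q r eps V s <- ccwq eps0 epsr ccwV hullV closeV bs.
have [m [k [rk [P regP [[lP0 lP] tk]]]]] := program_ok ccwq eps0 epsr ccwV hullV closeV bs.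
exists P; split=> //; rewrite add0n in tk.
have wf : wfc 12 program by [].
have at0 : code_at code 0 code by exists [::], [::]; rewrite cats0.
have ag0 : agree 12 (input q r eps s) (init_state q r eps s) by [].
have := cc_ok (prog := code) rk wf (M := size code) (st := init_state q r eps s).
rewrite [cc 12 program _](_ : _ = code) // => /(_ (leqnn _) ag0 at0).
move=> [st [[T TM itE] [pcE [agr agn agR agN]]]].
exists T; rewrite itE; split.
- by rewrite (leq_trans TM) // -mulnA leq_mul2l tk orbT.
- by rewrite /halted pcE add0n.
- split; first by rewrite agn.
  by move=> j jP; rewrite agR lP.
Qed.
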